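(* Let $k$ be an algebraically closed field, let $Q$ be a finite quiver without sources, let $J\subseteq kQ$ be the two-sided ideal generated by all arrows of $Q$, and let $m$ be a positive integer. Then $R:=kQ/J^m$ is an ideally ordered monomial algebra and there is an isomorphism of quasi-hereditary algebras $$E_R^{\mathrm{ADR}}\cong E_R.$$
   Context: Modules are finitely generated left modules; in $kQ$ the product $pq$ is the path $q$ followed by the path $p$; products in endomorphism algebras are compositions. A source is a vertex with no incoming arrow. A monomial of $R=kQ/I$ (with $I$ generated by paths) is the class of a path (including lazy paths); a finite dimensional such $R$ is ideally ordered if for every primitive idempotent $e\in R$ and every pair of monomials $p,q\in eR$ there is an epimorphism of left $R$-modules $Rp\to Rq$ or $Rq\to Rp$. $\operatorname{add}$ of a class of modules is the smallest full subcategory containing it and closed under isomorphisms, finite direct sums and direct summands. $E_R:=\operatorname{End}_R(\mathrm{SUB}(R))$, where $\mathrm{SUB}(R)$ is the direct sum of all indecomposables, up to isomorphism, in $\mathrm{sub}(R):=\operatorname{add}\{U\mid U\subseteq R^{\oplus n}\}$. $E_R^{\mathrm{ADR}}:=\operatorname{End}_R(\mathrm{ADR}(R))$, where $\mathrm{ADR}(R)$ is the direct sum of all indecomposables, up to isomorphism, in $\mathrm{adr}(R):=\operatorname{add}\{Re/\operatorname{rad}^iRe\mid e\text{ a primitive idempotent},\ 1\le i\le L_R\}$, with $L_R$ the Loewy length of $R$. For $E=\operatorname{End}_R(M)$ with $M$ basic, the simple modules $S(N)$ are indexed by the indecomposable summands $N$ of $M$, $S(N)$ being the top of the projective $P(N)=\operatorname{Hom}_R(N,M)$.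 The orders used are: for $E_R$, the ideal layer order $S(N)<S(N')$ iff $\dim_kN>\dim_kN'$; for $E_R^{\mathrm{ADR}}$, $S(N)<S(N')$ iff the Loewy length of $N$ is greater than that of $N'$ (i.e. the layer function $Re_i/\operatorname{rad}^lRe_i\mapsto L_R-l$ for $1\le l\le$ Loewy length of $Re_i$). Both algebras are quasi-hereditary for these orders. For a partial order on the simples $S_i$, the standard module $\Delta_i$ is the largest quotient of the projective cover $P_i$ all of whose composition factors $S_j$ satisfy $j\le i$. An isomorphism of quasi-hereditary algebras is an algebra isomorphism identifying the standard modules (i.e. the quasi-hereditary structures). *)

(* Defs.v *)
From HB Require Import structures.
From mathcomp Require Import all_boot all_algebra.
From mathcomp Require Import boolp classical_sets.
From mathcomp Require Import finmap.
From mathcomp Require Import monalg.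

Set Implicit Arguments.
Unset Strict Implicit.
Unset Printing Implicit Defensive.

Import GRing.Theory.

Local Open Scope classical_set_scope.
Local Open Scope ring_scope.

(* A k-algebra is a ring with a ring homomorphism from k to its centre.  The   *)
(* structure algType is not used because it excludes the zero algebra, which   *)
(* occurs here as an endomorphism algebra and as the algebra of the empty      *)
(* quiver.                                                                     *)
Record algebra (k : fieldType) := Algebra {
  alg_ring :> pzRingType;
  scal : {rmorphism k -> alg_ring};
  scalC : forall c x, scal c * x = x * scal c }.

Definition surj (X Y : Type) (f : X -> Y) : Prop := forall y, exists x, f x = y.

Definition alg_hom (k : fieldType) (A B : algebra k) (f : {rmorphism A -> B}) : Prop :=
  forall c, f (scal A c) = scal B c.

Section Ideals.
Context (A : pzRingType).
Implicit Types (I J X : set A).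

Definition two_sided_ideal I : Prop :=
  [/\ I 0, forall x y, I x -> I y -> I (x + y) & forall a b x, I x -> I (a * x * b)].

Definition ideal_gen X : set A :=
  [set x | forall I, two_sided_ideal I -> X `<=` I -> I x].

Definition ideal_mul I J : set A :=
  ideal_gen [set x | exists a b, [/\ I a, J b & x = a * b]].

Definition ideal_pow I (n : nat) : set A := iter n (ideal_mul I) [set: A].

Definition idempotent (e : A) : Prop := e * e = e.

Definition primitive_idempotent (e : A) : Prop :=
  [/\ idempotent e, e <> 0 &
      forall f g, idempotent f -> idempotent g -> f * g = 0 -> g * f = 0 ->
        e = f + g -> f = 0 \/ g = 0].

Definition left_ideal (x : A) : set A^o := [set y | exists r : A, y = r * x].

End Ideals.

Record quiver := Quiver {
  vertex : finType;
  arrow : finType;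
  src : arrow -> vertex;
  tgt : arrow -> vertex }.

Definition no_sources (Q : quiver) : Prop := forall v : vertex Q, exists a, tgt a = v.

(* A path is a starting vertex with the list of its arrows in the order in     *)
(* which they are traversed; the empty list gives the lazy paths.              *)
Section Paths.
Context (Q : quiver).

Fixpoint walk (v : vertex Q) (s : seq (arrow Q)) : bool :=
  if s is a :: s' then (src a == v) && walk (tgt a) s' else true.

Definition walk_end (v : vertex Q) (s : seq (arrow Q)) : vertex Q :=
  last v [seq tgt a | a <- s].

Definition qpath : Type := {p : vertex Q * seq (arrow Q) | walk p.1 p.2}.
HB.instance Definition _ := SubChoice.on qpath.

Definition psrc (p : qpath) : vertex Q := (val p).1.
Definition parrows (p : qpath) : seq (arrow Q) := (val p).2.
Definition ptgt (p : qpath) : vertex Q := walk_end (psrc p) (parrows p).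

Definition lazy_path (v : vertex Q) : qpath := exist (fun p => walk p.1 p.2) (v, [::]) isT.

Fact arrow_path_proof (a : arrow Q) : walk (src a) [:: a].
Proof. by rewrite /= eqxx. Qed.
Definition arrow_path (a : arrow Q) : qpath :=
  exist (fun p => walk p.1 p.2) (src a, [:: a]) (arrow_path_proof a).

Lemma walk_cat v s t : walk v (s ++ t) = walk v s && walk (walk_end v s) t.
Proof. by elim: s v => //= a s IHs v; rewrite IHs andbA. Qed.

Lemma walk_end_cat v s t : walk_end v (s ++ t) = walk_end (walk_end v s) t.
Proof. by rewrite /walk_end map_cat last_cat. Qed.

(* The path q followed by the path p, if it is defined. *)
Definition pmul (p q : qpath) : option qpath :=
  if ptgt q == psrc p then (insub (psrc q, parrows q ++ parrows p) : option qpath) else None.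

Lemma pmul_some p q : ptgt q = psrc p ->
  exists r, [/\ pmul p q = Some r, psrc r = psrc q & parrows r = parrows q ++ parrows p].
Proof.
move=> e; rewrite /pmul e eqxx; case: insubP => [r _ er|/negP[]].
  by exists r; rewrite /psrc /parrows er.
by rewrite /= walk_cat (valP q) -/(ptgt q) e (valP p).
Qed.

Lemma pmul_none p q : ptgt q != psrc p -> pmul p q = None.
Proof. by rewrite /pmul => /negbTE->. Qed.

Lemma qpathP p q : psrc p = psrc q -> parrows p = parrows q -> p = q.
Proof.
move=> e1 e2; apply: val_inj; move: e1 e2; rewrite /psrc /parrows.
by case: (val p) (val q) => [? ?] [? ?] /= -> ->.
Qed.

Lemma pmulA p q r :
  obind (pmul p) (pmul q r) = obind (fun x => pmul x r) (pmul p q).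
Proof.
have tgtM x y z : pmul x y = Some z -> ptgt y = psrc x -> ptgt z = ptgt x.
  move=> e1 e2; have [z' [e3 e4 e5]] := pmul_some e2.
  move: e1; rewrite e3 => -[<-].
  by rewrite /ptgt e4 e5 walk_end_cat -/(ptgt y) e2.
case: (eqVneq (ptgt r) (psrc q)) => e; last first.
  rewrite (pmul_none e); case: (eqVneq (ptgt q) (psrc p)) => e'; last by rewrite (pmul_none e').
  have [x [-> ex _]] := pmul_some e' => /=.
  by rewrite pmul_none // ex.
have [x [ex sx ax]] := pmul_some e.
case: (eqVneq (ptgt q) (psrc p)) => e'; last first.
  by rewrite (pmul_none e') ex /= pmul_none // (tgtM _ _ _ ex e).
have [y [ey sy ay]] := pmul_some e'.
rewrite ex ey /=.
have [z [-> sz az]] : exists z, [/\ pmul p x = Some z, psrc z = psrc x & parrows z = parrows x ++ parrows p].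
  by apply: pmul_some; rewrite (tgtM _ _ _ ex e).
have [t [-> st at_]] : exists t, [/\ pmul y r = Some t, psrc t = psrc r & parrows t = parrows r ++ parrows y].
  by apply: pmul_some; rewrite sy.
by congr Some; apply: qpathP; rewrite ?sz ?st ?az ?at_ ?sx ?ax ?ay ?catA.
Qed.

End Paths.

Definition path_ring (k : fieldType) (Q : quiver) : Type :=
  Eval cbv beta delta [reverse_coercion] in {malg k[qpath Q]}.
HB.instance Definition _ (k : fieldType) (Q : quiver) := GRing.Lmodule.on (path_ring k Q).

(* The next definitions are locked because unification would unfold them too   *)
(* eagerly.                                                                    *)
HB.lock Definition pvec (k : fieldType) (Q : quiver) (p : qpath Q) : path_ring k Q := << p >>.

Definition pmulv (k : fieldType) (Q : quiver) (p q : qpath Q) : path_ring k Q :=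
  oapp (@pvec k Q) 0 (pmul p q).

HB.lock Definition path_mul (k : fieldType) (Q : quiver) (f g : path_ring k Q) : path_ring k Q :=
  \sum_(p <- msupp f) \sum_(q <- msupp g) (f@_p * g@_q) *: pmulv k p q.

HB.lock Definition path_one (k : fieldType) (Q : quiver) : path_ring k Q :=
  \sum_(v : vertex Q) pvec k (lazy_path v).

Section PathAlgebra.
Context (k : fieldType) (Q : quiver).
Local Notation path_ring := (path_ring k Q).
Local Notation pvec := (@pvec k Q).
Local Notation pmulv := (@pmulv k Q).
Local Notation path_mul := (@path_mul k Q).
Local Notation path_one := (@path_one k Q).

Implicit Types (f g h : path_ring) (p q r : qpath Q).

Lemma path_mulwl (d : {fset qpath Q}) f g : (msupp f `<=` d)%fset ->
  path_mul f g = \sum_(p <- d) \sum_(q <- msupp g) (f@_p * g@_q) *: pmulv p q.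
Proof.
move=> le; rewrite path_mul.unlock (big_fset_incl _ le) //= => p _ pN.
by rewrite big1 // => q _; rewrite mcoeff_outdom // mul0r scale0r.
Qed.

Lemma path_mulwr (d : {fset qpath Q}) f g : (msupp g `<=` d)%fset ->
  path_mul f g = \sum_(p <- msupp f) \sum_(q <- d) (f@_p * g@_q) *: pmulv p q.
Proof.
move=> le; rewrite path_mul.unlock; apply: eq_bigr => p _.
rewrite (big_fset_incl _ le) //= => q _ qN.
by rewrite [g@_q]mcoeff_outdom // mulr0 scale0r.
Qed.

Lemma path_mulDl : left_distributive path_mul +%R.
Proof.
move=> f g h; set d := (msupp f `|` msupp g)%fset.
rewrite (path_mulwl _ (msuppD_le f g)) (@path_mulwl d f) ?fsubsetUl //.
rewrite (@path_mulwl d g) ?fsubsetUr // -big_split /=; apply: eq_bigr => p _.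
rewrite -big_split /=; apply: eq_bigr => q _.
by rewrite mcoeffD mulrDl scalerDl.
Qed.

Lemma path_mulDr : right_distributive path_mul +%R.
Proof.
move=> f g h; set d := (msupp g `|` msupp h)%fset.
rewrite (path_mulwr _ (msuppD_le g h)) (@path_mulwr d f g) ?fsubsetUl //.
rewrite (@path_mulwr d f h) ?fsubsetUr // -big_split /=; apply: eq_bigr => p _.
rewrite -big_split /=; apply: eq_bigr => q _.
by rewrite mcoeffD mulrDr scalerDl.
Qed.

Lemma path_mul0l g : path_mul 0 g = 0.
Proof. by apply: (addrI (path_mul 0 g)); rewrite -path_mulDl !addr0. Qed.

Lemma path_mul0r g : path_mul g 0 = 0.
Proof. by apply: (addrI (path_mul g 0)); rewrite -path_mulDr !addr0. Qed.

Lemma path_mul_suml I (s : seq I) (F : I -> path_ring) g :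
  path_mul (\sum_(i <- s) F i) g = \sum_(i <- s) path_mul (F i) g.
Proof. exact: (big_morph (path_mul^~ g) (fun x y => path_mulDl x y g) (path_mul0l g)). Qed.

Lemma path_mul_sumr I (s : seq I) (F : I -> path_ring) g :
  path_mul g (\sum_(i <- s) F i) = \sum_(i <- s) path_mul g (F i).
Proof. exact: (big_morph (path_mul g) (path_mulDr g) (path_mul0r g)). Qed.

Lemma path_mulZl (c : k) f g : path_mul (c *: f) g = c *: path_mul f g.
Proof.
rewrite (path_mulwl _ (msuppZ_le c f)) path_mul.unlock scaler_sumr; apply: eq_bigr => p _.
rewrite scaler_sumr; apply: eq_bigr => q _.
by rewrite mcoeffZ scalerA mulrA.
Qed.

Lemma path_mulZr (c : k) f g : path_mul f (c *: g) = c *: path_mul f g.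
Proof.
rewrite (path_mulwr _ (msuppZ_le c g)) path_mul.unlock scaler_sumr; apply: eq_bigr => p _.
rewrite scaler_sumr; apply: eq_bigr => q _.
by rewrite mcoeffZ scalerA mulrCA.
Qed.

Lemma path_mulvv p q : path_mul (pvec p) (pvec q) = pmulv p q.
Proof.
have e r : msupp (pvec r) = [fset r]%fset by rewrite pvec.unlock msuppU oner_eq0.
by rewrite path_mul.unlock (e p) (e q) 2!big_seq_fset1 pvec.unlock 2!mcoeffUU mulr1 scale1r.
Qed.

Lemma pvecE f : f = \sum_(p <- msupp f) f@_p *: pvec p.
Proof.
rewrite {1}[f]monalgE; apply: eq_bigr => p _; apply/malgP => q.
by rewrite [RHS]mcoeffZ pvec.unlock [LHS]mcoeffU [in RHS]mcoeffU mulr_natr.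
Qed.

Lemma path_mulA : associative path_mul.
Proof.
have vvv p q r : path_mul (pvec p) (path_mul (pvec q) (pvec r)) =
                 path_mul (path_mul (pvec p) (pvec q)) (pvec r).
  rewrite !path_mulvv; have := pmulA p q r; rewrite /pmulv.
  case: (pmul q r) (pmul p q) => [x|] [y|] /= e; rewrite ?path_mul0l ?path_mul0r //.
  - by rewrite !path_mulvv /pmulv e.
  - by rewrite path_mulvv /pmulv e.
  - by rewrite path_mulvv /pmulv -e.
have vvh p q h : path_mul (pvec p) (path_mul (pvec q) h) =
                 path_mul (path_mul (pvec p) (pvec q)) h.
  rewrite (pvecE h) !path_mul_sumr; apply: eq_bigr => r _.
  by rewrite !path_mulZr vvv.
have vgh p g h : path_mul (pvec p) (path_mul g h) = path_mul (path_mul (pvec p) g) h.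
  rewrite (pvecE g) path_mul_suml !path_mul_sumr path_mul_suml; apply: eq_bigr => q _.
  by rewrite -> path_mulZl, path_mulZr, path_mulZr, path_mulZl, vvh.
move=> f g h; rewrite (pvecE f) !path_mul_suml; apply: eq_bigr => p _.
by rewrite -> 3!path_mulZl, vgh.
Qed.

Lemma path_mul1l : left_id path_one path_mul.
Proof.
suff e p : path_mul path_one (pvec p) = pvec p.
  move=> f; rewrite {1}(pvecE f) path_mul_sumr [RHS]pvecE.
  by apply: eq_bigr => p _; rewrite path_mulZr e.
rewrite path_one.unlock path_mul_suml (bigD1 (ptgt p)) //= big1 ?addr0 => [|v vN].
  rewrite path_mulvv /pmulv.
  have [r [-> er ar]] : exists r, [/\ pmul (lazy_path (ptgt p)) p = Some r, psrc r = psrc p &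
      parrows r = parrows p ++ parrows (lazy_path (ptgt p))] by apply: pmul_some.
  by congr pvec; apply: qpathP; rewrite // ar cats0.
by rewrite path_mulvv /pmulv pmul_none // eq_sym.
Qed.

Lemma path_mul1r : right_id path_one path_mul.
Proof.
suff e p : path_mul (pvec p) path_one = pvec p.
  move=> f; rewrite {1}(pvecE f) path_mul_suml [RHS]pvecE.
  by apply: eq_bigr => p _; rewrite path_mulZl e.
rewrite path_one.unlock path_mul_sumr (bigD1 (psrc p)) //= big1 ?addr0 => [|v vN].
  rewrite path_mulvv /pmulv.
  have [r [-> er ar]] : exists r, [/\ pmul p (lazy_path (psrc p)) = Some r, psrc r = psrc p &
      parrows r = [::] ++ parrows p] by apply: (@pmul_some _ p (lazy_path (psrc p))).
  by congr pvec; apply: qpathP.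
by rewrite path_mulvv /pmulv pmul_none.
Qed.

HB.instance Definition _ := GRing.Zmodule_isPzRing.Build path_ring
  path_mulA path_mul1l path_mul1r path_mulDl path_mulDr.

Definition path_scal (c : k) : path_ring := c *: (1 : path_ring).

Fact path_scal_zmod : zmod_morphism path_scal.
Proof. by move=> c d; rewrite /path_scal scalerBl. Qed.
Fact path_scal_monoid : monoid_morphism path_scal.
Proof.
split=> [|c d]; first exact: scale1r.
by rewrite /path_scal [RHS]path_mulZl [path_mul _ _]path_mul1l scalerA.
Qed.
HB.instance Definition _ := GRing.isZmodMorphism.Build k path_ring path_scal path_scal_zmod.
HB.instance Definition _ := GRing.isMonoidMorphism.Build k path_ring path_scal path_scal_monoid.

Fact path_scalC (c : k) (f : path_ring) : path_scal c * f = f * path_scal c.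
Proof.
rewrite /path_scal [LHS]path_mulZl [RHS]path_mulZr.
by rewrite [path_mul _ _]path_mul1l [path_mul _ _]path_mul1r.
Qed.

Definition path_algebra : algebra k := Algebra path_scalC.

Definition arrow_ideal : set path_algebra :=
  ideal_gen [set x | exists a : arrow Q, x = pvec (arrow_path a)].

End PathAlgebra.

Arguments arrow_ideal : clear implicits.

Section Submodules.
Context (A : pzRingType).
Implicit Types (M N T : lmodType A).

Definition submodule M (U : set M) : Prop :=
  U 0 /\ forall a x y, U x -> U y -> U (a *: x + y).

Definition linear_on M N (U : set M) (g : M -> N) : Prop :=
  forall a x y, U x -> U y -> g (a *: x + y) = a *: g x + g y.

(* For submodules U of M and V of N, there is an epimorphism U -> V. *)
Definition epimorphic M N (U : set M) (V : set N) : Prop :=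
  exists g : M -> N, linear_on U g /\ g @` U = V.

(* For submodules W <= U of M, the module U / W is isomorphic to T. *)
Definition subquotient_iso M (U W : set M) T : Prop :=
  exists g : M -> T,
    [/\ linear_on U g, g @` U = [set: T] & forall x, U x -> (g x = 0 <-> W x)].

Definition maximal_submodule M (U V : set M) : Prop :=
  [/\ submodule V, V `<=` U, V <> U &
      forall W, submodule W -> V `<=` W -> W `<=` U -> W = V \/ W = U].

Definition rad M (U : set M) : set M :=
  [set x | U x /\ forall V, maximal_submodule U V -> V x].

Definition rad_pow M (i : nat) (U : set M) : set M := iter i (@rad M) U.

(* The default value 0 of xget is used only if no power of the radical is 0. *)
Definition loewy_length M : nat :=
  xget 0%N [set l | rad_pow l [set: M] = [set 0] /\
                    forall i, (i < l)%N -> rad_pow i [set: M] <> [set 0]].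

Definition isomorphic M N : Prop := exists f : {linear M -> N}, bijective f.

Definition is_zero M : Prop := forall x : M, x = 0.

Definition indecomposable M : Prop :=
  ~ is_zero M /\
  forall N T, isomorphic M (N * T)%type -> is_zero N \/ is_zero T.

Definition composition_series M (n : nat) (F : nat -> set M) : Prop :=
  [/\ F 0%N = [set 0], F n = [set: M] &
      forall i, (i < n)%N -> submodule (F i.+1) /\ maximal_submodule (F i.+1) (F i)].

Definition composition_factor M T : Prop :=
  exists n F, composition_series n F /\
    exists2 i, (i < n)%N & @subquotient_iso M (F i.+1) (F i) T.

(* T is isomorphic to M / rad M. *)
Definition is_top M T : Prop := subquotient_iso [set: M] (rad [set: M]) T.

(* The standard modules for the simple modules S_i := top (P i) and the        *)
(* partial order le on their indices.                                          *)
Section Standard.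
Context (I : Type) (P : I -> lmodType A) (le : I -> I -> Prop) (i : I).

(* Every quotient X of P i considered below has a composition series, as P i is *)
(* finite dimensional over k in the applications.                              *)
Definition factors_le (X : lmodType A) : Prop :=
  forall T, composition_factor X T -> exists2 j, le j i & is_top (P j) T.

Definition is_standard (D : lmodType A) : Prop :=
  exists f : {linear P i -> D},
    [/\ surj f, factors_le D &
        forall (X : lmodType A) (g : {linear P i -> X}), surj g -> factors_le X ->
          exists h : {linear D -> X}, forall x, g x = h (f x)].

End Standard.

Inductive add_closure (C : lmodType A -> Prop) : lmodType A -> Prop :=
| add_in M : C M -> add_closure C M
| add_iso M N : isomorphic M N -> add_closure C M -> add_closure C N
| add_zero M : is_zero M -> add_closure C M
| add_sum M N : add_closure C M -> add_closure C N -> add_closure C (M * N)%type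
| add_summand M N : add_closure C (M * N)%type -> add_closure C M.

(* N is a list without repetition, up to isomorphism, of all indecomposable    *)
(* modules in the class C.                                                     *)
Definition indecomposables_of (C : lmodType A -> Prop) (I : finType)
    (N : I -> lmodType A) : Prop :=
  [/\ forall i, C (N i) /\ indecomposable (N i),
      forall X, C X -> indecomposable X -> exists i, isomorphic X (N i) &
      forall i j, isomorphic (N i) (N j) -> i = j].

(* Up to isomorphism, a submodule of A^n is a module that embeds into A^n. *)
Definition sub_mod : lmodType A -> Prop :=
  add_closure (fun M => exists n (f : {linear M -> 'rV[A]_n}), injective f).

Definition adr_mod : lmodType A -> Prop :=
  add_closure (fun M => exists e i,
    [/\ primitive_idempotent e, (1 <= i <= loewy_length A^o)%N &
        subquotient_iso (left_ideal e) (rad_pow i (left_ideal e)) M]).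

End Submodules.

Section DirectSum.
Context (A : pzRingType) (I : finType) (N : I -> lmodType A).

Definition dsum : Type := {dffun forall i, N i}.
HB.instance Definition _ := Choice.on dsum.
Implicit Types (x y z : dsum).

Definition dsum_zero : dsum := [ffun i => 0 : N i].
Definition dsum_opp x : dsum := [ffun i => - x i : N i].
Definition dsum_add x y : dsum := [ffun i => x i + y i : N i].
Definition dsum_scale (a : A) x : dsum := [ffun i => a *: x i : N i].

Fact dsum_addA : associative dsum_add.
Proof. by move=> x y z; apply/ffunP=> i; rewrite !ffunE addrA. Qed.
Fact dsum_addC : commutative dsum_add.
Proof. by move=> x y; apply/ffunP=> i; rewrite !ffunE addrC. Qed.
Fact dsum_add0 : left_id dsum_zero dsum_add.
Proof. by move=> x; apply/ffunP=> i; rewrite !ffunE add0r. Qed.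
Fact dsum_addN : left_inverse dsum_zero dsum_opp dsum_add.
Proof. by move=> x; apply/ffunP=> i; rewrite !ffunE addNr. Qed.
HB.instance Definition _ :=
  GRing.isZmodule.Build dsum dsum_addA dsum_addC dsum_add0 dsum_addN.

Fact dsum_scaleA a b x : dsum_scale a (dsum_scale b x) = dsum_scale (a * b) x.
Proof. by apply/ffunP=> i; rewrite !ffunE scalerA. Qed.
Fact dsum_scale1 : left_id 1 dsum_scale.
Proof. by move=> x; apply/ffunP=> i; rewrite !ffunE scale1r. Qed.
Fact dsum_scaleDr : right_distributive dsum_scale +%R.
Proof. by move=> a x y; apply/ffunP=> i; rewrite !ffunE scalerDr. Qed.
Fact dsum_scaleDl x : {morph dsum_scale^~ x : a b / a + b}.
Proof. by move=> a b; apply/ffunP=> i; rewrite !ffunE scalerDl. Qed.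
HB.instance Definition _ := GRing.Zmodule_isLmodule.Build A dsum
  dsum_scaleA dsum_scale1 dsum_scaleDr dsum_scaleDl.

End DirectSum.

(* Hom N M is a left module over End M, the product in End M being composition. *)
Section Hom.
Context (A : pzRingType) (N M : lmodType A).

Definition Hom : Type := {linear N -> M}.
HB.instance Definition _ := gen_eqMixin Hom.
HB.instance Definition _ := gen_choiceMixin Hom.

Definition hom_zero : Hom := (\0 : N -> M).
Definition hom_opp (f : Hom) : Hom := (\- (f : {linear N -> M}) : N -> M).
Definition hom_add (f g : Hom) : Hom :=
  ((f : {linear N -> M}) \+ (g : {linear N -> M}) : N -> M).

Lemma homP (f g : Hom) :
  (forall x, (f : {linear N -> M}) x = (g : {linear N -> M}) x) -> f = g.
Proof.
case: f g => [f cf] [g cg] /= /funext e; case: g / e cg => cg.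
congr GRing.Linear.Pack; case: cf cg => [[f1] [f2]] [[g1] [g2]].
by rewrite (Prop_irrelevance f1 g1) (Prop_irrelevance f2 g2).
Qed.

Fact hom_addA : associative hom_add.
Proof. by move=> f g h; apply: homP => x /=; rewrite addrA. Qed.
Fact hom_addC : commutative hom_add.
Proof. by move=> f g; apply: homP => x /=; rewrite addrC. Qed.
Fact hom_add0 : left_id hom_zero hom_add.
Proof. by move=> f; apply: homP => x /=; rewrite add0r. Qed.
Fact hom_addN : left_inverse hom_zero hom_opp hom_add.
Proof. by move=> f; apply: homP => x /=; rewrite addNr. Qed.
HB.instance Definition _ :=
  GRing.isZmodule.Build Hom hom_addA hom_addC hom_add0 hom_addN.

End Hom.

Section Endomorphisms.
Context (A : pzRingType) (M : lmodType A).

Definition End : Type := Hom M M.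
HB.instance Definition _ := GRing.Zmodule.on End.

Definition hom_comp (N : lmodType A) (f : End) (g : Hom N M) : Hom N M :=
  ((f : {linear M -> M}) \o (g : {linear N -> M}) : N -> M).
Definition end_one : End := (idfun : M -> M).

Fact end_mulA : associative (@hom_comp M).
Proof. by move=> f g h; apply: homP. Qed.
Fact end_mul1l : left_id end_one (@hom_comp M).
Proof. by move=> f; apply: homP. Qed.
Fact end_mul1r : right_id end_one (@hom_comp M).
Proof. by move=> f; apply: homP. Qed.
Fact end_mulDl : left_distributive (@hom_comp M) +%R.
Proof. by move=> f g h; apply: homP. Qed.
Fact end_mulDr : right_distributive (@hom_comp M) +%R.
Proof. by move=> f g h; apply: homP => x /=; rewrite raddfD. Qed.
HB.instance Definition _ := GRing.Zmodule_isPzRing.Build End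
  end_mulA end_mul1l end_mul1r end_mulDl end_mulDr.

Section HomModule.
Context (N : lmodType A).
Fact hom_scaleA (f g : End) (h : Hom N M) :
  hom_comp f (hom_comp g h) = hom_comp (f * g) h.
Proof. exact: homP. Qed.
Fact hom_scale1 : left_id 1 (@hom_comp N).
Proof. by move=> f; apply: homP. Qed.
Fact hom_scaleDr : right_distributive (@hom_comp N) +%R.
Proof. by move=> f g h; apply: homP => x /=; rewrite raddfD. Qed.
Fact hom_scaleDl (h : Hom N M) : {morph (@hom_comp N)^~ h : f g / f + g}.
Proof. by move=> f g; apply: homP. Qed.
HB.instance Definition _ := GRing.Zmodule_isLmodule.Build End (Hom N M)
  hom_scaleA hom_scale1 hom_scaleDr hom_scaleDl.
End HomModule.

End Endomorphisms.

Section Algebras.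
Context (k : fieldType).

Section EndAlgebra.
Context (R : algebra k) (M : lmodType R).

Section Homothety.
Context (c : k).
Definition homothety (x : M) : M := scal R c *: x.
Fact homothety_linear : linear homothety.
Proof. by move=> a x y; rewrite /homothety scalerDr !scalerA scalC. Qed.
HB.instance Definition _ := GRing.isLinear.Build R M M _ homothety homothety_linear.
End Homothety.

Definition end_scal (c : k) : End M := (homothety c : M -> M).

Fact end_scal_zmod : zmod_morphism end_scal.
Proof. by move=> c d; apply: homP => x; rewrite /= /homothety rmorphB scalerBl. Qed.
Fact end_scal_monoid : monoid_morphism end_scal.
Proof.
split=> [|c d]; apply: homP => x; rewrite /= /homothety ?rmorph1 ?scale1r //.
by rewrite rmorphM scalerA.
Qed.
HB.instance Definition _ := GRing.isZmodMorphism.Build k (End M) end_scal end_scal_zmod.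
HB.instance Definition _ := GRing.isMonoidMorphism.Build k (End M) end_scal end_scal_monoid.

Fact end_scalC (c : k) (f : End M) : end_scal c * f = f * end_scal c.
Proof. by apply: homP => x; rewrite /= /homothety linearZ. Qed.

Definition end_algebra : algebra k := Algebra end_scalC.

End EndAlgebra.

Section Dimension.
Context (R : algebra k) (M : lmodType R).

Definition is_basis (d : nat) (b : 'I_d -> M) : Prop :=
  forall x, exists! c : {ffun 'I_d -> k}, x = \sum_i scal R (c i) *: b i.

(* The default value 0 of xget is used only in infinite dimension. *)
Definition dim : nat := xget 0%N [set d | exists b : 'I_d -> M, is_basis b].

Definition finite_dimensional : Prop := exists d (b : 'I_d -> M), is_basis b.

End Dimension.

(* R is considered together with the map pi from kQ that presents it. *)
Section Monomial.
Context (Q : quiver) (R : algebra k) (pi : {rmorphism path_algebra k Q -> R}).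

Definition monomial (x : R) : Prop := exists p : qpath Q, x = pi (pvec k p).

Definition presents (I : set (path_algebra k Q)) : Prop :=
  [/\ alg_hom pi, surj pi & forall x, pi x = 0 <-> I x].

Definition monomial_algebra : Prop :=
  exists X : set (qpath Q), presents (ideal_gen [set pvec k p | p in X]).

Definition ideally_ordered : Prop :=
  [/\ monomial_algebra, @finite_dimensional R R^o &
      forall e p q : R, primitive_idempotent e -> monomial p -> monomial q ->
        (exists r, p = e * r) -> (exists r, q = e * r) ->
        epimorphic (left_ideal p) (left_ideal q) \/
        epimorphic (left_ideal q) (left_ideal p)].

End Monomial.

Section Layers.
Context (R : algebra k) (I : finType) (N : I -> lmodType R).

(* The orders on the indices of the simple modules S(N i): a module of larger  *)
(* dimension, resp. Loewy length, gives a smaller simple module.               *)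
Definition ideal_layer_le (i j : I) : Prop := i = j \/ (dim (N j) < dim (N i))%N.

Definition loewy_le (i j : I) : Prop :=
  i = j \/ (loewy_length (N j) < loewy_length (N i))%N.

Definition proj (i : I) : lmodType (end_algebra (dsum N)) := Hom (N i) (dsum N).

End Layers.

(* The endomorphism algebras of the direct sums of N and N', with the orders   *)
(* le and le' on their simple modules.                                         *)
Definition quasi_hereditary_isomorphic (R : algebra k) (I I' : finType)
    (N : I -> lmodType R) (le : I -> I -> Prop)
    (N' : I' -> lmodType R) (le' : I' -> I' -> Prop) : Prop :=
  exists phi : {rmorphism end_algebra (dsum N) -> end_algebra (dsum N')},
    [/\ bijective phi, alg_hom phi &
        exists s : I -> I', bijective s /\
          forall i, exists D D',
            [/\ is_standard (proj N) le i D, is_standard (proj N') le' (s i) D' &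
                exists f : {linear D -> D' | phi \; *:%R}, bijective f]].

End Algebras.

(* Main.v *)
(* Let e_v be the idempotent of the vertex v.  The coefficient of a path p in a product r s is
   the sum over all ways to cut p of products of coefficients of r and s, so if u in e_v R^n has
   a nonzero coefficient at a path of length s and none at shorter paths, then R u is isomorphic
   to R e_v / J^(m-s) e_v.  As Q has no sources, every R e_v / J^l e_v with 0 < l <= m arises in
   this way inside R, namely as R p for a path p of length m - l ending at v.

   These modules have local endomorphism rings.  They generate adr(R), as every primitive
   idempotent is conjugate to some e_v.  They also generate sub(R): if p is a path of minimal
   length in the support of U in R^n, then the projection onto the span of the paths starting
   with p is linear on U and maps U onto a module isomorphic to R p, which splits off; iterate on
   the kernel.  By the exchange property the indecomposable modules of both classes are the
   R e_v / J^l e_v, so both endomorphism algebras are the same up to isomorphism.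

   Let y be a nonzero element of J^(l-1) N_i, where l is the Loewy length of N_i.  A homomorphism
   from N_i to some N_j is injective if it does not kill y; otherwise it factors through a proper
   quotient N_j' of N_i, which has both smaller dimension and at most the same Loewy length.  So
   for both orders the standard module of i is the image of Hom(N_i, M) under evaluation at y,
   as an End(M)-submodule of the direct sum M. *)
Require Import Defs.
From HB Require Import structures.
From mathcomp Require Import all_boot all_algebra.
From mathcomp Require Import boolp classical_sets.
From mathcomp Require Import finmap.
From mathcomp Require Import monalg.

Set Implicit Arguments.
Unset Strict Implicit.
Unset Printing Implicit Defensive.

Import GRing.Theory.

Local Open Scope classical_set_scope.
Local Open Scope ring_scope.

(** * Coefficients in the path algebra *)

(** [R] is known only through a surjection from kQ with kernel J^m. As J^m is spanned by the paths
    of length at least m, coefficients at shorter paths do not depend on the lift, and computations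
    in [R] are done with them. Modules are known only up to isomorphism, so R e_v / J^l e_v is
    recorded by a generator and its annihilator; submodules, images and quotients can then be
    recognized directly. The quiver may have sinks: if no path of length l - 1 starts at v, lowering
    l does not change the module. Requiring such a path normalizes l, which becomes the Loewy length
    and, together with v, an invariant.

    The two orders are never compared. All that is used of dimension and Loewy length is that on the
    listed modules they grow strictly along an injection that is not an isomorphism and do not grow
    along a surjection. The universal property of a standard module concerns arbitrary quotients of
    Hom(N_i, M); their composition series come from the finite dimension of M over k. *)

Section PathCuts.
Context (Q : quiver).
Implicit Types (p q r : qpath Q) (v : vertex Q).

Definition plen p : nat := size (parrows p).

Lemma walk_take_drop (v : vertex Q) s i : walk v s ->
  walk v (take i s) && walk (walk_end v (take i s)) (drop i s).
Proof. by rewrite -walk_cat cat_take_drop. Qed.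

Fact ptake_proof i p : walk (psrc p) (take i (parrows p)).
Proof. by have /andP[] := walk_take_drop i (valP p). Qed.
Definition ptake i p : qpath Q :=
  exist (fun p : vertex Q * seq (arrow Q) => walk p.1 p.2) (psrc p, take i (parrows p)) (ptake_proof i p).

Fact pdrop_proof i p :
  walk (walk_end (psrc p) (take i (parrows p))) (drop i (parrows p)).
Proof. by have /andP[] := walk_take_drop i (valP p). Qed.
Definition pdrop i p : qpath Q :=
  exist (fun p : vertex Q * seq (arrow Q) => walk p.1 p.2)
    (walk_end (psrc p) (take i (parrows p)), drop i (parrows p)) (pdrop_proof i p).

Lemma plen_take i p : (i <= plen p)%N -> plen (ptake i p) = i.
Proof. by move=> le; rewrite /plen /= size_takel. Qed.

Lemma plen_drop i p : plen (pdrop i p) = (plen p - i)%N.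
Proof. by rewrite /plen /= size_drop. Qed.

Lemma ptgt_take i p : ptgt (ptake i p) = psrc (pdrop i p). Proof. by []. Qed.

Lemma ptake0 p : ptake 0 p = lazy_path (psrc p).
Proof. by apply: qpathP; rewrite // /parrows /= take0. Qed.

Lemma pdrop0 p : pdrop 0 p = p.
Proof. by apply: qpathP; rewrite /psrc /parrows /= ?take0 ?drop0. Qed.

Lemma ptake_len p : ptake (plen p) p = p.
Proof. by apply: qpathP; rewrite // /parrows /= /plen take_size. Qed.

Lemma pdrop_len p : pdrop (plen p) p = lazy_path (ptgt p).
Proof. by apply: qpathP; rewrite /parrows /psrc /= /plen ?take_size ?drop_size. Qed.

Lemma plen0P p : plen p = 0%N -> p = lazy_path (psrc p).
Proof. by move/size0nil=> e; apply: qpathP. Qed.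

Lemma pmul_cut p i : pmul (pdrop i p) (ptake i p) = Some p.
Proof.
have [r [-> e1 e2]] := pmul_some (ptgt_take i p).
by congr Some; apply: qpathP; rewrite // e2 /parrows /= cat_take_drop.
Qed.

Lemma pmul_cutP p q r : pmul p q = Some r ->
  [/\ (plen r = plen q + plen p)%N, p = pdrop (plen q) r & q = ptake (plen q) r].
Proof.
have [e|/pmul_none->//] := eqVneq (ptgt q) (psrc p).
have [x [-> e1 e2]] := pmul_some e => -[<-].
split; first by rewrite /plen e2 size_cat.
  apply: qpathP; rewrite /psrc /parrows /= -/(psrc _) -/(parrows _) ?e1 e2.
    by rewrite take_size_cat // -/(ptgt q) e.
  by rewrite drop_size_cat.
by apply: qpathP; rewrite /psrc /parrows /= -/(psrc _) -/(parrows _) ?e1 // e2 take_size_cat.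
Qed.

Lemma pmul_ex p q : ptgt q = psrc p -> exists r, pmul p q = Some r.
Proof. by move=> /pmul_some[r [? _ _]]; exists r. Qed.

End PathCuts.

Section PathCoef.
Context (k : fieldType) (Q : quiver).
Implicit Types (f g : path_ring k Q) (p q : qpath Q).

Lemma mcoeff_pvec p q : (pvec k p)@_q = (p == q)%:R.
Proof. by rewrite pvec.unlock mcoeffU. Qed.

(** At most one term is nonzero: if [p] after [q] is [r], the cut is at the length of [q]. *)
Lemma mcoeff_pmulv p q r : (pmulv k p q)@_r =
  \sum_(i < (plen r).+1) ((p == pdrop i r) && (q == ptake i r))%:R.
Proof.
rewrite /pmulv; case e : (pmul p q) => [s|] /=; last first.
  rewrite mcoeff0 big1 // => i _; case: eqP => //= ep; case: eqP => //= eq.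
  by move: e; rewrite ep eq pmul_cut.
have [e1 e2 e3] := pmul_cutP e; rewrite mcoeff_pvec.
case: eqP => [<-|ne].
  have lt : (plen q < (plen s).+1)%N by rewrite e1 ltnS leq_addr.
  rewrite (bigD1 (Ordinal lt)) //= -e2 -e3 !eqxx big1 ?addr0 // => i /eqP ni.
  case: (p == _) => //=; case: eqP => // eq; case: ni; apply: val_inj => /=.
  by rewrite eq plen_take // -ltnS.
rewrite big1 // => i _; case: eqP => //= ep; case: eqP => //= eq.
by case: ne; move: e; rewrite ep eq pmul_cut => -[].
Qed.

Lemma mcoeff_mul f g p :
  (f * g)@_p = \sum_(i < (plen p).+1) f@_(pdrop i p) * g@_(ptake i p).
Proof.
have ex (h : path_ring k Q) q : h@_q = \sum_(r <- msupp h) h@_r * (r == q)%:R.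
  rewrite {1}[h]monalgE raddf_sum /=; apply: eq_bigr => r _.
  by rewrite mcoeffU mulr_natr.
have -> : f * g = path_mul f g by [].
rewrite path_mul.unlock raddf_sum /=.
transitivity (\sum_(i < (plen p).+1) \sum_(q <- msupp f) \sum_(r <- msupp g)
   (f@_q * g@_r) * ((q == pdrop i p) && (r == ptake i p))%:R).
  rewrite exchange_big /=; apply: eq_bigr => q _.
  rewrite exchange_big /= raddf_sum /=; apply: eq_bigr => r _.
  by rewrite mcoeffZ mcoeff_pmulv mulr_sumr.
apply: eq_bigr => i _; rewrite [in RHS](ex f) [in RHS](ex g) big_distrlr /=.
apply: eq_bigr => q _; apply: eq_bigr => r _.
by rewrite mulrACA -natrM mulnb.
Qed.

End PathCoef.

(** * Powers of the arrow ideal *)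

Section IdealGen.
Context (A : pzRingType).

Lemma ideal_gen_ideal (X : set A) : two_sided_ideal (ideal_gen X).
Proof.
split=> [I [] //|x y Ix Iy I iI XI|a b x Ix I iI XI]; have [I0 ID IM] := iI.
- by apply: ID; [apply: Ix | apply: Iy].
- by apply: IM; apply: Ix.
Qed.

Lemma sub_ideal_gen (X : set A) : X `<=` ideal_gen X.
Proof. by move=> x Xx I _; apply. Qed.

Lemma ideal_pow_ideal (I : set A) n : two_sided_ideal (ideal_pow I n).
Proof. by case: n => [|n]; [split | apply: ideal_gen_ideal]. Qed.

Lemma ideal_sum (I : set A) T (s : seq T) (P : pred T) (F : T -> A) : two_sided_ideal I ->
  (forall t, P t -> I (F t)) -> I (\sum_(t <- s | P t) F t).
Proof. by case=> I0 ID _ IF; elim/big_ind: _. Qed.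

End IdealGen.

Section ArrowIdealPowers.
Context (k : fieldType) (Q : quiver).
Implicit Types (p q : qpath Q) (n : nat).

(** The span of the paths of length at least [n], which [ideal_pow_arrow] identifies with the n-th
    power of the arrow ideal. *)
Definition lowfree n : set (path_algebra k Q) :=
  [set f | forall p, (plen p < n)%N -> (f : path_ring k Q)@_p = 0].

(** However a path of length below a + b is cut, its second piece is shorter than [a] or its first
    piece is shorter than [b]. *)
Lemma lowfree_mul a b f g : lowfree a f -> lowfree b g -> lowfree (a + b) (f * g).
Proof.
move=> fa gb p lt; rewrite [LHS](mcoeff_mul (f : path_ring k Q) g p).
apply: big1 => i _; have [lt1|le1] := ltnP (plen p - i)%N a.
  by rewrite fa ?mul0r // plen_drop.
have le : (i <= plen p)%N by rewrite -ltnS.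
by rewrite gb ?mulr0 // plen_take // -(ltn_add2l a) (leq_ltn_trans _ lt) // addnC -leq_subRL.
Qed.

Lemma lowfree_ideal n : two_sided_ideal (lowfree n).
Proof.
split=> [p _|f g f0 g0 p lt|a b f f0].
- by rewrite mcoeff0.
- by rewrite [LHS]mcoeffD f0 // g0 // addr0.
- have h c : lowfree 0 c by [].
  by have := lowfree_mul (lowfree_mul (h a) f0) (h b); rewrite addn0.
Qed.

Lemma path_algebraE (f : path_algebra k Q) :
  f = \sum_(p <- msupp (f : path_ring k Q))
        (path_scal Q ((f : path_ring k Q)@_p) : path_algebra k Q) * pvec k p.
Proof.
rewrite {1}[f](pvecE (f : path_ring k Q)); apply: eq_bigr => p _.
by rewrite /path_scal [RHS]path_mulZl [path_mul _ _]path_mul1l.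
Qed.

Lemma pvec_cut p i :
  pvec k p = (pvec k (pdrop i p) : path_algebra k Q) * pvec k (ptake i p).
Proof. by rewrite [RHS]path_mulvv /pmulv pmul_cut. Qed.

Lemma ideal_pow_pvec n p : (n <= plen p)%N -> ideal_pow (arrow_ideal k Q) n (pvec k p).
Proof.
elim: n p => [//|n IHn] p lt.
(* Only length exactly n + 1 needs an argument: a longer path is a multiple of its initial segment
   of that length. *)
have {}IHn : ideal_pow (arrow_ideal k Q) n.+1 (pvec k (ptake n.+1 p)); last first.
  rewrite (pvec_cut p n.+1); have [_ _ h] := ideal_pow_ideal (arrow_ideal k Q) n.+1.
  by rewrite -[X in _ * X]mulr1 mulrA; apply: h.
have len : plen (ptake n.+1 p) = n.+1 by rewrite plen_take.
move: {p lt}(ptake _ _) len => p len.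
rewrite (pvec_cut p n); apply: sub_ideal_gen.
exists (pvec k (pdrop n p)), (pvec k (ptake n p)); split=> //; last first.
  by apply: IHn; rewrite plen_take ?len.
apply: sub_ideal_gen; have := plen_drop n p; rewrite len subSnn /plen.
case ep : (parrows _) => [|a []] // _; exists a; congr pvec; apply: qpathP => //.
by have := valP (pdrop n p); rewrite -/(psrc _) -/(parrows _) ep /= andbT => /eqP.
Qed.

Lemma ideal_pow_arrow n : ideal_pow (arrow_ideal k Q) n = lowfree n.
Proof.
rewrite predeqE => f; split; last first.
  move=> f0; rewrite [f]path_algebraE big_seq; apply: ideal_sum => [|p pf].
    exact: ideal_pow_ideal.
  have [_ _ h] := ideal_pow_ideal (arrow_ideal k Q) n.
  rewrite -[X in ideal_pow _ _ X]mulr1; apply/h/ideal_pow_pvec.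
  by rewrite leqNgt; apply: contraTN pf => lt; rewrite -mcoeff_eq0 f0.
elim: n f => [//|n IHn] f; apply; first exact: lowfree_ideal.
move=> _ [a [b [Ja Jb ->]]]; apply: (@lowfree_mul 1 n); last exact: IHn.
apply: Ja; first exact: lowfree_ideal.
move=> _ [c ->] p; rewrite ltnS leqn0 => /eqP len.
by rewrite [LHS]mcoeff_pvec; case: eqP len => // <-.
Qed.

End ArrowIdealPowers.

(** * The truncated path algebra *)

Section ShortPaths.
Context (Q : quiver) (m : nat).

(** The type of all paths is infinite in general, so the enumeration goes through the finite type of
    arrow sequences of length at most m; [insub] discards those that are not walks. *)
Definition short : seq (qpath Q) :=
  [seq p <- undup (pmap insub [seq (v, s : seq (arrow Q)) |
     v <- enum (vertex Q), s <- [seq bseqval s | s <- enum {bseq m of arrow Q}]]) |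
     (plen p < m)%N].

Lemma mem_short p : (p \in short) = (plen p < m)%N.
Proof.
rewrite mem_filter; case: (ltnP (plen p) m) => //= lt; rewrite mem_undup mem_pmap.
apply/mapP; exists (val p); last by rewrite valK.
apply/allpairsP; exists (val p); split; rewrite ?mem_enum //; last by case: (val p).
by apply/mapP; exists (Bseq (ltnW lt : size (parrows p) <= m)%N) => //; rewrite mem_enum.
Qed.

Lemma short_uniq : uniq short.
Proof. exact/filter_uniq/undup_uniq. Qed.

End ShortPaths.

Section Truncated.
Context (k : fieldType) (Q : quiver) (m : nat) (R : algebra k).
Context (pi : {rmorphism path_algebra k Q -> R}).
Hypothesis pres : presents pi (ideal_pow (arrow_ideal k Q) m).
Implicit Types (p q : qpath Q) (v w : vertex Q) (r s x : R).

Let kQ := path_ring k Q.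

Definition lift r : path_algebra k Q :=
  let: And3 _ pi_surj _ := pres in sval (cid (pi_surj r)).

Lemma liftK r : pi (lift r) = r.
Proof. by rewrite /lift; case: pres => _ h _; case: cid. Qed.

(* The coefficient of r at p; it is 0 by convention if p has length at least m. *)
Definition coef p r : k := if (plen p < m)%N then (lift r : kQ)@_p else 0.
Definition mon p : R := pi (pvec k p).
Definition vid v : R := mon (lazy_path v).
(* The ideal J^d of R. *)
Definition ford d : set R := [set r | forall p, (plen p < d)%N -> coef p r = 0].

(** Two lifts of the same element differ by an element of J^m, which has no coefficient at a path of
    length below m. *)
Lemma coef_pi p (f : path_algebra k Q) :
  coef p (pi f) = if (plen p < m)%N then (f : kQ)@_p else 0.
Proof.
rewrite /coef; case: ltnP => // lt; apply/eqP; rewrite -subr_eq0; apply/eqP.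
have [_ _ h] := pres; have /h : pi (lift (pi f) - f) = 0 by rewrite rmorphB liftK subrr.
by rewrite ideal_pow_arrow => /(_ p lt); rewrite [LHS]mcoeffB.
Qed.

Lemma coef_long p r : (m <= plen p)%N -> coef p r = 0.
Proof. by rewrite /coef ltnNge => ->. Qed.

Fact coef_zmod p : zmod_morphism (coef p).
Proof.
move=> r s; rewrite -[r]liftK -[s]liftK -rmorphB !coef_pi; case: ifP; rewrite ?subrr //.
by move=> _; rewrite [LHS]mcoeffB.
Qed.
HB.instance Definition _ p := GRing.isZmodMorphism.Build R k (coef p) (coef_zmod p).

Lemma coef_scal p c r : coef p (scal R c * r) = c * coef p r.
Proof.
have [h _ _] := pres; rewrite -[r]liftK -h -rmorphM !coef_pi; case: ifP; rewrite ?mulr0 //.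
have -> : scal (path_algebra k Q) c * lift r = c *: (lift r : kQ) :> path_algebra k Q.
  by rewrite [LHS]path_mulZl [path_mul _ _]path_mul1l.
by move=> _; rewrite [LHS]mcoeffZ.
Qed.

Lemma coef_inj r s : (forall p, coef p r = coef p s) -> r = s.
Proof.
move=> e; apply/eqP; rewrite -subr_eq0 -[r - s]liftK; apply/eqP.
have [_ _ h] := pres; apply/h; rewrite ideal_pow_arrow => p lt.
by have := coef_zmod p r s; rewrite e subrr {1}/coef lt.
Qed.

Lemma coef_mul p r s : (plen p < m)%N ->
  coef p (r * s) = \sum_(i < (plen p).+1) coef (pdrop i p) r * coef (ptake i p) s.
Proof.
move=> lt; rewrite -[r]liftK -[s]liftK -rmorphM coef_pi lt.
rewrite [LHS](mcoeff_mul (lift r : kQ) (lift s)); apply: eq_bigr => i _.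
have le : (i <= plen p)%N by rewrite -ltnS.
by rewrite !coef_pi plen_drop (leq_ltn_trans (leq_subr _ _) lt) plen_take ?(leq_ltn_trans le lt).
Qed.

Lemma coef_mon p q : coef p (mon q) = ((plen p < m)%N && (q == p))%:R.
Proof. by rewrite coef_pi [X in if _ then X else _]mcoeff_pvec; case: ifP. Qed.

Lemma coef_mul_mon p q r : (plen p < m)%N -> coef p (r * mon q) =
  if (plen q <= plen p)%N && (q == ptake (plen q) p) then coef (pdrop (plen q) p) r else 0.
Proof.
move=> lt; rewrite coef_mul //; case: ifP => [/andP[le /eqP eq]|ne].
  have lt' : (plen q < (plen p).+1)%N by rewrite ltnS.
  rewrite (bigD1 (Ordinal lt')) //= -eq coef_mon (leq_ltn_trans le lt) eqxx mulr1.
  rewrite big1 ?addr0 // => i /eqP ni; rewrite coef_mon; case: eqP => e; last by rewrite andbF mulr0.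
  by case: ni; apply: val_inj; rewrite /= e plen_take // -ltnS.
rewrite big1 // => i _; rewrite coef_mon; case: eqP => e; last by rewrite andbF mulr0.
have le : (i <= plen p)%N by rewrite -ltnS.
by move: ne; rewrite e plen_take // le eqxx.
Qed.

Lemma mon_cut i p : mon p = mon (pdrop i p) * mon (ptake i p).
Proof. by rewrite -rmorphM -pvec_cut. Qed.

Lemma mon_mul p q : mon p * mon q = oapp mon 0 (pmul p q).
Proof.
rewrite -rmorphM [X in pi X]path_mulvv /pmulv.
by case: pmul => //=; rewrite rmorph0.
Qed.

Lemma coef_mul_vid p r v : coef p (r * vid v) = if psrc p == v then coef p r else 0.
Proof.
have [lt|le] := ltnP (plen p) m; last by rewrite !coef_long // if_same.
rewrite coef_mul_mon //= ptake0 pdrop0.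
by rewrite -(inj_eq val_inj) /= xpair_eqE andbT eq_sym.
Qed.

Lemma coef_vid_mul p r v : coef p (vid v * r) = if ptgt p == v then coef p r else 0.
Proof.
have [lt|le] := ltnP (plen p) m; last by rewrite !coef_long // if_same.
rewrite coef_mul // big_ord_recr /= big1 ?add0r => [|i _]; last first.
  rewrite coef_mon; case: eqP => e; last by rewrite andbF mul0r.
  by have := plen_drop i p; rewrite -e => /esym/eqP; rewrite subn_eq0 leqNgt ltn_ord.
rewrite pdrop_len ptake_len coef_mon /= (leq_ltn_trans _ lt) //.
by rewrite -(inj_eq val_inj) /= xpair_eqE andbT eq_sym; case: eqP; rewrite ?mul1r ?mul0r.
Qed.

Lemma vid_sum : \sum_v vid v = 1.
Proof.
have -> : (1 : R) = pi (path_one k Q) by rewrite -[LHS](rmorph1 pi).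
by rewrite path_one.unlock [RHS](rmorph_sum pi).
Qed.

Lemma vid_mon_mul p : vid (ptgt p) * mon p = mon p.
Proof. by have := mon_cut (plen p) p; rewrite pdrop_len ptake_len. Qed.

Lemma mon_vid_mul p : mon p * vid (psrc p) = mon p.
Proof. by have := mon_cut 0 p; rewrite pdrop0 ptake0. Qed.

Lemma vidM v w : vid v * vid w = if v == w then vid v else 0.
Proof.
case: eqVneq => [<-|ne]; first exact: (mon_vid_mul (lazy_path v)).
by rewrite mon_mul pmul_none // eq_sym.
Qed.

Lemma coef_expand r : r = \sum_(p <- short Q m) scal R (coef p r) * mon p.
Proof.
apply: coef_inj => p; rewrite raddf_sum /=.
have [lt|le] := ltnP (plen p) m; last first.
  by rewrite coef_long // big1 // => q _; rewrite coef_scal coef_mon ltnNge le mulr0.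
rewrite (bigD1_seq p) ?mem_short ?short_uniq //= coef_scal coef_mon lt eqxx mulr1.
by rewrite big1 ?addr0 // => q /negbTE ne; rewrite coef_scal coef_mon ne andbF mulr0.
Qed.

End Truncated.

(** * Powers of J, units and idempotents of R *)

Section Filtration.
Context (k : fieldType) (Q : quiver) (m : nat) (R : algebra k).
Context (pi : {rmorphism path_algebra k Q -> R}).
Hypothesis pres : presents pi (ideal_pow (arrow_ideal k Q) m).
Hypothesis m_gt0 : (0 < m)%N.
Implicit Types (p q : qpath Q) (v w : vertex Q) (r s x : R).
Local Notation coef := (coef pres).
Local Notation mon := (mon pi).
Local Notation vid := (vid pi).
Local Notation ford := (ford pres).

Lemma ford_mul a b r s : ford a r -> ford b s -> ford (a + b) (r * s).
Proof.
move=> ra sb p lt; have [ltm|le] := ltnP (plen p) m; last by rewrite coef_long.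
rewrite coef_mul //; apply: big1 => i _; have le : (i <= plen p)%N by rewrite -ltnS.
have [lt1|le1] := ltnP (plen p - i)%N a; first by rewrite ra ?mul0r // plen_drop.
by rewrite sb ?mulr0 // plen_take // -(ltn_add2l a) (leq_ltn_trans _ lt) // addnC -leq_subRL.
Qed.

Lemma ford_ideal d : two_sided_ideal (ford d).
Proof.
split=> [p _|r s r0 s0 p lt|a b r r0]; first by rewrite raddf0.
  by rewrite raddfD /= r0 ?s0 // addr0.
have h x : ford 0 x by [].
by have := ford_mul (ford_mul (h a) r0) (h b); rewrite addn0.
Qed.

Lemma ford_zero d : ford d 0. Proof. by have [] := ford_ideal d. Qed.

Lemma fordD d r s : ford d r -> ford d s -> ford d (r + s).
Proof. by have [_ h _] := ford_ideal d; apply: h. Qed.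

Lemma fordMl d r s : ford d s -> ford d (r * s).
Proof. exact: (@ford_mul 0). Qed.

Lemma fordMr d r s : ford d r -> ford d (r * s).
Proof. by rewrite -{2}[d]addn0; move/ford_mul; apply. Qed.

Lemma fordN d r : ford d r -> ford d (- r).
Proof. by rewrite -mulN1r; apply: fordMl. Qed.

Lemma ford_le a b r : (a <= b)%N -> ford b r -> ford a r.
Proof. by move=> le rb p lt; apply/rb/(leq_trans lt). Qed.

Lemma ford_eq0 r : ford m r -> r = 0.
Proof.
move=> r0; apply: (@coef_inj _ _ _ _ _ pres) => p; rewrite raddf0.
by have [/r0|/coef_long->] := ltnP (plen p) m.
Qed.

Lemma ford_mon d p : (d <= plen p)%N -> ford d (mon p).
Proof.
move=> le q lt; rewrite coef_mon; case: eqP => [e|]; rewrite ?andbF //.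
by move: lt; rewrite -e ltnNge le.
Qed.

Lemma ford_exp n r : ford 1 r -> ford n (r ^+ n).
Proof. by move=> r1; elim: n => // n IHn; rewrite exprS; apply: (@ford_mul 1). Qed.

Lemma ford1P r : reflect (forall v, coef (lazy_path v) r = 0) `[< ford 1 r >].
Proof.
apply: (iffP (asboolP _)) => [h v|h p]; first exact: h.
by rewrite ltnS leqn0 => /eqP /plen0P ->.
Qed.

(** These coefficients are the characters of R / J, a product of copies of k indexed by the
    vertices. *)
Lemma coef_lazy_mul v r s :
  coef (lazy_path v) (r * s) = coef (lazy_path v) r * coef (lazy_path v) s.
Proof. by rewrite coef_mul // big_ord1 ptake0 pdrop0. Qed.

Lemma coef_lazy_vid v w : coef (lazy_path v) (vid w) = (w == v)%:R.
Proof. by rewrite coef_mon m_gt0 -(inj_eq val_inj) /= xpair_eqE andbT. Qed.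

Lemma coef_lazy1 v : coef (lazy_path v) 1 = 1.
Proof.
rewrite -(vid_sum pi) raddf_sum /= (bigD1 v) //= coef_lazy_vid eqxx big1 ?addr0 // => w.
by rewrite coef_lazy_vid => /negbTE->.
Qed.

Lemma vid_neq0 v : vid v <> 0.
Proof.
move=> e; have := coef_lazy_vid v v; rewrite e raddf0 eqxx => /esym/eqP.
by rewrite oner_eq0.
Qed.

(** An element of J is nilpotent, so the geometric series is finite. *)
Lemma ford1_inv n : ford 1 n -> exists y, y * (1 - n) = 1 /\ (1 - n) * y = 1.
Proof.
move=> n1; have e : n ^+ m = 0 by apply/ford_eq0/ford_exp.
exists (\sum_(i < m) n ^+ i).
have h : (1 - n) * (\sum_(i < m) n ^+ i) = 1.
  by rewrite -[1 - n]opprB mulNr -subrX1 e sub0r opprK.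
split; last exact: h.
rewrite -[RHS]h; suff : GRing.comm (1 - n) (\sum_(i < m) n ^+ i) by move->.
by apply: commr_sum => i _; apply/commrX/commr_sym/commrB; [apply: commr1 | ].
Qed.

Lemma inv_cong1 u : ford 1 (u - 1) ->
  exists y, [/\ y * u = 1, u * y = 1 & ford 1 (y - 1)].
Proof.
move=> /fordN u1; have [y []] := ford1_inv u1; rewrite opprK addrC subrK => yu uy.
exists y; split=> //; rewrite -[y - 1]opprB -{1}yu -{2}[y]mulr1 -mulrBr -mulrN.
exact: fordMl.
Qed.

(** Under either condition n = e_v - c^-1 x lies in J. Then (1 - n) e_v = c^-1 x in the first case,
    e_v (1 - n) = c^-1 x in the second, and 1 - n is a unit. *)
Lemma vid_inv v x : coef (lazy_path v) x != 0 ->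
  (x * vid v = x -> exists z, z * x = vid v) /\
  (vid v * x = x -> exists z, x * z = vid v).
Proof.
set c := coef _ x => c0.
have cK : scal R c^-1 * scal R c = 1 by rewrite -rmorphM mulVf // rmorph1.
have h : (x * vid v = x \/ vid v * x = x) -> ford 1 (vid v - scal R c^-1 * x).
  move=> hx; apply/asboolP/ford1P => w; rewrite raddfB /= coef_scal coef_lazy_vid.
  have [<-|ne] := eqVneq v w; first by rewrite mulVf // subrr.
  case: hx => <-; rewrite ?coef_mul_vid ?coef_vid_mul [_ (lazy_path w)]/= /ptgt /= /psrc /=.
    by rewrite eq_sym (negbTE ne) mulr0 subrr.
  by rewrite eq_sym (negbTE ne) mulr0 subrr.
split=> hx.
  have [|y [y1 _]] := ford1_inv (h _); first by left.
  exists (y * scal R c^-1); rewrite -[X in _ = X]mul1r -y1 -!mulrA; congr (y * _).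
  by rewrite mulrBl mul1r mulrBl vidM eqxx -mulrA hx opprB addrC subrK.
have [|y [_ y1]] := ford1_inv (h _); first by right.
exists (scal R c^-1 * y); rewrite -[X in _ = X]mulr1 -y1 mulrA -scalC mulrA; congr (_ * y).
by rewrite mulrBr mulr1 mulrBr vidM eqxx mulrA -scalC -mulrA hx opprB addrC subrK.
Qed.

Lemma ford1_idempotent f : Defs.idempotent f -> ford 1 f -> f = 0.
Proof.
move=> ff f1; apply/ford_eq0; suff fn n : f ^+ n.+1 = f.
  by rewrite -(fn m.-1) prednK //; apply: ford_exp.
by elim: n => [|n IHn]; rewrite ?expr1 // exprS IHn.
Qed.

Definition vidsum (P : pred (vertex Q)) : R := \sum_(v | P v) vid v.

Lemma vidsumM P P' : vidsum P * vidsum P' = vidsum (fun v => P v && P' v).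
Proof.
rewrite /vidsum big_distrlr /= big_mkcondr /=; apply: eq_bigr => v _.
case: ifP => [Pv|Pv].
  rewrite (bigD1 v) //= vidM eqxx big1 ?addr0 // => w /andP[_ /negbTE].
  by rewrite vidM eq_sym => ->.
by rewrite big1 // => w Pw; rewrite vidM; case: eqP => // e; rewrite e Pw in Pv.
Qed.

Lemma coef_lazy_vidsum v P : coef (lazy_path v) (vidsum P) = (P v)%:R.
Proof.
rewrite raddf_sum /=; case Pv : (P v).
  rewrite (bigD1 v) //= coef_lazy_vid eqxx big1 ?addr0 // => w /andP[_ /negbTE].
  by rewrite coef_lazy_vid => ->.
by rewrite big1 // => w Pw; rewrite coef_lazy_vid; case: eqP => // e; rewrite -e Pw in Pv.
Qed.

Lemma idempotent_coef_lazy e v : Defs.idempotent e ->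
  coef (lazy_path v) e = (coef (lazy_path v) e == 1)%:R.
Proof.
move=> ee; case: eqP => [//|ne]; have := coef_lazy_mul v e e; rewrite ee => /eqP.
rewrite -{1}[coef _ e]mulr1 -subr_eq0 -mulrBr mulf_eq0 subr_eq0 => /orP[/eqP//|/eqP h].
by case: ne.
Qed.

(** Modulo J the decomposition takes place in a single copy of k, so one of the two idempotents lies
    in J; being nilpotent, it is 0. *)
Lemma primitive_vid v : primitive_idempotent (vid v).
Proof.
split=> [||f g ff gg fg _ e]; [by rewrite /Defs.idempotent vidM eqxx | exact: vid_neq0 |].
have hw w : coef (lazy_path w) f = 0 \/ coef (lazy_path w) g = 0.
  have := coef_lazy_mul w f g; rewrite fg raddf0 => /esym/eqP.
  by rewrite mulf_eq0 => /orP[] /eqP; [left | right].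
have sw w : coef (lazy_path w) f + coef (lazy_path w) g = (v == w)%:R.
  by rewrite -coef_lazy_vid e raddfD.
have off w : v != w -> coef (lazy_path w) f = 0 /\ coef (lazy_path w) g = 0.
  by move/negbTE=> ne; have := sw w; rewrite ne; case: (hw w) => ->; rewrite ?add0r ?addr0.
have [h|h] := hw v; [left | right]; apply: ford1_idempotent => //; apply/asboolP/ford1P => w;
  have [<-//|/off[]//] := eqVneq v w.
Qed.

(** The clause that [u'] is 1 modulo J is there for [ideally_ordered_truncated]: left multiplication
    by [u'] then keeps the coefficient of [mon p] at [p]. *)
Lemma primitive_conj e : primitive_idempotent e -> exists v u u',
  [/\ u * u' = 1, u' * u = 1, ford 1 (u' - 1) & e = u * vid v * u'].
Proof.
move=> [ee e0 eP]; pose P := [pred v | coef (lazy_path v) e == 1].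
have dP v : coef (lazy_path v) e = (P v)%:R by apply: idempotent_coef_lazy.
pose e' := vidsum P; pose u := e * e' + (1 - e) * (1 - e').
(* [e] and [e'] agree modulo J, and [u] is the usual intertwiner of two such idempotents: it is 1
   modulo J, hence a unit, and satisfies [e * u = u * e']. *)
have e'e' : e' * e' = e' by rewrite vidsumM; apply: eq_bigl => v; rewrite andbb.
have [|u' [u'u uu' u1]] := @inv_cong1 u.
  apply/asboolP/ford1P => v.
  rewrite raddfB raddfD /= !coef_lazy_mul !raddfB /= coef_lazy1 coef_lazy_vidsum dP.
  by case: (P v); rewrite /= ?subrr ?subr0 ?mulr1 ?mulr0 ?addr0 ?add0r subrr.
have eu : e * u = u * e'.
  rewrite /u mulrDr !mulrA ee [e * (1 - e)]mulrBr mulr1 ee subrr mul0r addr0.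
  by rewrite mulrDl -!mulrA e'e' [(1 - e') * e']mulrBl mul1r e'e' subrr mulr0 addr0.
have eE : e = u * e' * u' by rewrite -eu -mulrA uu' mulr1.
have conjM a b : (u * a * u') * (u * b * u') = u * (a * b) * u'.
  by rewrite -!mulrA [u' * (u * _)]mulrA u'u mul1r.
have conj0 a : u * a * u' = 0 -> a = 0.
  move=> h; have {}h : u * (a * (u' * u)) = 0 by rewrite !mulrA h mul0r.
  by rewrite -[a]mul1r -u'u -mulrA -[a]mulr1 -u'u h mulr0.
have [v Pv] : exists v, P v.
  apply: contrapT => h; case: e0; apply: ford1_idempotent => //.
  by apply/asboolP/ford1P => v; rewrite dP; case Pv: (P v) => //; case: h; exists v.
(* Conjugation turns e' = e_v + (the remaining vertices) into an orthogonal decomposition of [e];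
   primitivity kills the second part. *)
exists v, u, u'; split=> //; pose P' := [pred w | P w && (w != v)].
have e'E : e' = vid v + vidsum P' by rewrite /e' /vidsum (bigD1 v).
have vE : vid v = vidsum (pred1 v) by rewrite /vidsum big_pred1_eq.
have P'0 : vidsum [pred _ | false] = 0 by rewrite /vidsum big_pred0_eq.
have [|||||h|h] := eP (u * vid v * u') (u * vidsum P' * u').
- by rewrite /Defs.idempotent conjM vidM eqxx.
- by rewrite /Defs.idempotent conjM vidsumM; congr (u * _ * u'); apply: eq_bigl => w; rewrite andbb.
- rewrite conjM vE vidsumM (_ : vidsum _ = 0) ?mulr0 ?mul0r // -[RHS]P'0.
  by apply: eq_bigl => w /=; case: (w == v) => //=; rewrite ?andbF ?andbT /= ?andbF.
- rewrite conjM vE vidsumM (_ : vidsum _ = 0) ?mulr0 ?mul0r // -[RHS]P'0.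
  by apply: eq_bigl => w /=; case: (w == v) => //=; rewrite ?andbF ?andbT /= ?andbF.
- by rewrite -mulrDl -mulrDr -e'E.
- by case: (vid_neq0 (conj0 _ h)).
- by rewrite eE e'E mulrDr mulrDl h addr0.
Qed.

End Filtration.

(** * Submodules and quotients *)

Section Linear.
Context (A : pzRingType).
Implicit Types (M N T X : lmodType A).

Section MakeLinear.
Context (M N : lmodType A) (f : M -> N).
Hypothesis f_lin : forall a x y, f (a *: x + y) = a *: f x + f y.
Definition linear_fun : M -> N := f.
HB.instance Definition _ := GRing.isLinear.Build A M N _ linear_fun f_lin.
Definition make_linear : {linear M -> N} := linear_fun.
End MakeLinear.

Lemma linear_inverse M N (f : {linear M -> N}) : bijective f ->
  exists g : {linear N -> M}, cancel f g /\ cancel g f.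
Proof.
move=> [g fK gK]; have g_lin a x y : g (a *: x + y) = a *: g x + g y.
  by rewrite -{1}[x]gK -{1}[y]gK -linearP fK.
by exists (make_linear g_lin).
Qed.

Lemma isomorphic_sym M N : isomorphic M N -> isomorphic N M.
Proof. by case=> f /linear_inverse[g [fK gK]]; exists g, f. Qed.

Lemma isomorphic_trans M N T : isomorphic M N -> isomorphic N T -> isomorphic M T.
Proof. by case=> f bf [g bg]; exists (g \o f : {linear M -> T}); apply: bij_comp. Qed.

Lemma submoduleD M (U : set M) x y : submodule U -> U x -> U y -> U (x + y).
Proof. by case=> _ UP Ux Uy; rewrite -[x]scale1r; apply: UP. Qed.

Lemma submoduleZ M (U : set M) a x : submodule U -> U x -> U (a *: x).
Proof. by case=> U0 UP Ux; rewrite -[a *: x]addr0; apply: UP. Qed.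

Lemma submoduleB M (U : set M) x y : submodule U -> U x -> U y -> U (x - y).
Proof. by move=> sU Ux Uy; rewrite addrC -scaleN1r; case: sU => _; apply. Qed.

Lemma submodule_sum M (U : set M) I (s : seq I) (P : pred I) (F : I -> M) :
  submodule U -> (forall i, P i -> U (F i)) -> U (\sum_(i <- s | P i) F i).
Proof.
by move=> sU UF; elim/big_ind: _ => // [|x y]; [case: sU | apply: submoduleD].
Qed.

Lemma submodule_preim M N (f : {linear M -> N}) (U : set N) :
  submodule U -> submodule (f @^-1` U).
Proof.
move=> [U0 UP]; split; first by rewrite /preimage /= linear0.
by move=> a x y; rewrite /preimage /= linearP; apply: UP.
Qed.

Lemma submodule_im M N (f : {linear M -> N}) (U : set M) :
  submodule U -> submodule (f @` U).
Proof.
move=> [U0 UP]; split; first by exists 0; rewrite ?linear0.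
by move=> a _ _ [x Ux <-] [y Uy <-]; exists (a *: x + y); rewrite ?linearP //; apply: UP.
Qed.

Lemma submodule0 M : submodule [set (0 : M)].
Proof. by split=> // a x y -> ->; rewrite scaler0 addr0. Qed.

Lemma submoduleT M : submodule [set: M]. Proof. by []. Qed.

Lemma linear_onD M N (U : set M) (g : M -> N) x y : linear_on U g -> U x -> U y ->
  g (x + y) = g x + g y.
Proof. by move=> gP Ux Uy; rewrite -[x]scale1r gP // !scale1r. Qed.

Lemma linear_on0 M N (U : set M) (g : M -> N) : submodule U -> linear_on U g -> g 0 = 0.
Proof.
move=> [U0 _] /linear_onD gD; apply: (addrI (g 0)).
by rewrite addr0 -gD // addr0.
Qed.

Lemma linear_onZ M N (U : set M) (g : M -> N) a x : submodule U -> linear_on U g ->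
  U x -> g (a *: x) = a *: g x.
Proof.
by move=> sU gP Ux; have [U0 _] := sU; rewrite -[a *: x]addr0 gP // (linear_on0 sU gP) addr0.
Qed.

Section SubmoduleType.
Context (M : lmodType A) (U : set M) (sU : submodule U).

(** The beta-redex keeps the proof [sU] inside the type, so that the module structure, which depends
    on it, can be attached to the type. *)
Definition subm : Type := (fun _ : submodule U => {x : M | `[< U x >]}) sU.
HB.instance Definition _ := SubChoice.on subm.

Fact subm_closed : GRing.subsemimod_closed (fun x : M => `[< U x >]).
Proof.
have [U0 UP] := sU; apply: GRing.submod_closed_semi; split; first exact/asboolP.
by move=> a x y /asboolP Ux /asboolP Uy; apply/asboolP/UP.
Qed.
HB.instance Definition _ :=
  GRing.SubChoice_isSubLmodule.Build A M (fun x : M => `[< U x >]) subm subm_closed.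

Definition subm_mk x (Ux : U x) : subm := exist (fun x => `[< U x >]) x (asboolT Ux).

Lemma submP (x : subm) : U (val x). Proof. exact/asboolP/(valP x). Qed.

Fact subm_val_linear a (x y : subm) : val (a *: x + y) = a *: val x + val y.
Proof. by []. Qed.
Definition subm_val : {linear subm -> M} := make_linear subm_val_linear.

Section Corestriction.
Context (N : lmodType A) (f : {linear N -> M}) (fU : forall x, U (f x)).
Fact subm_lift_linear a (x y : N) :
  subm_mk (fU (a *: x + y)) = a *: subm_mk (fU x) + subm_mk (fU y).
Proof. by apply: val_inj; rewrite /= linearP. Qed.
Definition subm_lift : {linear N -> subm} := make_linear subm_lift_linear.
End Corestriction.

End SubmoduleType.

Section QuotientType.
Context (M : lmodType A) (U : set M) (sU : submodule U).

(** A representative that depends only on the coset of [x]; the default 0 of [xget] never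
    intervenes, as [x] itself is a candidate. *)
Definition qrep (x : M) : M := xget 0 [set y | U (x - y)].

Lemma qrepP x : U (x - qrep x).
Proof.
rewrite /qrep; case: xgetP => [y _ //|/(_ x)]; rewrite /= subrr.
by case: sU.
Qed.

Lemma qrep_eq x y : U (x - y) -> qrep x = qrep y.
Proof.
move=> Uxy; congr xget; rewrite predeqE => z; split=> /= h.
  have -> : y - z = (x - z) - (x - y) by rewrite opprB [RHS]addrC addrA subrK.
  exact: submoduleB.
have -> : x - z = (x - y) + (y - z) by rewrite addrA subrK.
exact: submoduleD.
Qed.

Lemma qrepK x : qrep (qrep x) == qrep x.
Proof.
by apply/eqP/qrep_eq; rewrite -opprB -scaleN1r; apply: submoduleZ => //; apply: qrepP.
Qed.

Definition quotm : Type := (fun _ : submodule U => {x : M | qrep x == x}) sU.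
HB.instance Definition _ := SubChoice.on quotm.

Definition qpi (x : M) : quotm := exist (fun x => qrep x == x) (qrep x) (qrepK x).

Lemma qpi_eq x y : U (x - y) -> qpi x = qpi y.
Proof. by move=> /qrep_eq e; apply: val_inj. Qed.

Lemma qpi_eqP x y : qpi x = qpi y -> U (x - y).
Proof.
move=> /(congr1 val) /= e; have -> : x - y = (x - qrep x) - (y - qrep y).
  by rewrite opprB e addrA subrK.
by apply: submoduleB => //; apply: qrepP.
Qed.

Lemma qpi_val (x : quotm) : qpi (val x) = x.
Proof. by apply: val_inj; apply/eqP; exact: (valP x). Qed.

Definition quotm_opp (x : quotm) := qpi (- val x).
Definition quotm_add (x y : quotm) := qpi (val x + val y).
Definition quotm_scale a (x : quotm) := qpi (a *: val x).

Fact quotm_addE x y : quotm_add (qpi x) (qpi y) = qpi (x + y).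
Proof.
apply/qpi_eq; rewrite /= opprD addrACA; apply: submoduleD => //;
  rewrite -opprB -scaleN1r; apply: submoduleZ => //; exact: qrepP.
Qed.
Fact quotm_oppE x : quotm_opp (qpi x) = qpi (- x).
Proof. by apply/qpi_eq; rewrite /= opprK addrC; apply: qrepP. Qed.
Fact quotm_scaleE a x : quotm_scale a (qpi x) = qpi (a *: x).
Proof.
apply/qpi_eq; rewrite /= -scalerBr; apply: submoduleZ => //.
by rewrite -opprB -scaleN1r; apply: submoduleZ => //; apply: qrepP.
Qed.

Fact quotm_addA : associative quotm_add.
Proof. by move=> x y z; rewrite -[x]qpi_val -[y]qpi_val -[z]qpi_val !quotm_addE addrA. Qed.
Fact quotm_addC : commutative quotm_add.
Proof. by move=> x y; rewrite -[x]qpi_val -[y]qpi_val !quotm_addE addrC. Qed.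
Fact quotm_add0 : left_id (qpi 0) quotm_add.
Proof. by move=> x; rewrite -[x]qpi_val !quotm_addE add0r. Qed.
Fact quotm_addN : left_inverse (qpi 0) quotm_opp quotm_add.
Proof. by move=> x; rewrite -[x]qpi_val quotm_oppE quotm_addE addNr. Qed.
HB.instance Definition _ :=
  GRing.isZmodule.Build quotm quotm_addA quotm_addC quotm_add0 quotm_addN.

Fact quotm_scaleA a b x : quotm_scale a (quotm_scale b x) = quotm_scale (a * b) x.
Proof. by rewrite -[x]qpi_val !quotm_scaleE scalerA. Qed.
Fact quotm_scale1 : left_id 1 quotm_scale.
Proof. by move=> x; rewrite -[x]qpi_val quotm_scaleE scale1r. Qed.
Fact quotm_scaleDr : right_distributive quotm_scale +%R.
Proof.
by move=> a x y; rewrite -[x]qpi_val -[y]qpi_val [_ + _]quotm_addE !quotm_scaleE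
  [RHS]quotm_addE scalerDr.
Qed.
Fact quotm_scaleDl x : {morph quotm_scale^~ x : a b / a + b}.
Proof.
by move=> a b; rewrite -[x]qpi_val !quotm_scaleE [RHS]quotm_addE scalerDl.
Qed.
HB.instance Definition _ := GRing.Zmodule_isLmodule.Build A quotm
  quotm_scaleA quotm_scale1 quotm_scaleDr quotm_scaleDl.

Fact qpi_linear a x y : qpi (a *: x + y) = a *: qpi x + qpi y.
Proof. by rewrite [_ *: qpi x]quotm_scaleE [RHS]quotm_addE. Qed.
Definition quotm_pi : {linear M -> quotm} := make_linear qpi_linear.

Lemma quotm_pi_surj : surj quotm_pi.
Proof. by move=> y; exists (val y); apply: qpi_val. Qed.

Lemma quotm_pi_eq0 x : quotm_pi x = 0 <-> U x.
Proof.
rewrite -[X in _ = X](linear0 quotm_pi) -{2}[x]subr0.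
by split; [apply: qpi_eqP | apply: qpi_eq].
Qed.

End QuotientType.

Lemma composition_subquotient M n (F : nat -> set M) t (W := F t) (U := F t.+1) :
  composition_series n F -> (t < n)%N -> exists T : lmodType A,
  subquotient_iso U W T.
Proof.
move=> [_ _ h] lt; have {h} [sU [sW WU _ _]] := h t lt.
have sV := submodule_preim (subm_val sU) sW.
(* Outside [U] the value is immaterial, since [subquotient_iso] looks at [g] on [U] only. *)
pose g (x : M) : quotm sV := if pselect (U x) is left Ux then qpi sV (subm_mk sU Ux) else 0.
exists (quotm sV : lmodType A), g.
have gE x (Ux : U x) : g x = quotm_pi sV (subm_mk sU Ux).
  by rewrite /g; case: pselect => // Ux'; congr qpi; apply: val_inj.
split.
- move=> a x y Ux Uy; have Uz : U (a *: x + y) by have [_ UP] := sU; apply: UP.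
  by rewrite !gE -linearP; congr (quotm_pi sV _); apply: val_inj.
- rewrite predeqE => z; split=> // _; have [y <-] := quotm_pi_surj z.
  exists (val y); first exact: submP.
  by rewrite (gE _ (submP y)); congr (quotm_pi sV _); apply: val_inj.
- by move=> x Ux; rewrite (gE _ Ux); rewrite quotm_pi_eq0.
Qed.

End Linear.

(** * Modules with local endomorphism rings *)

Section Exchange.
Context (A : pzRingType).
Implicit Types (M N T X : lmodType A).

Section Pairs.
Context (M N : lmodType A).
Fact pfst_lin a (x y : M * N) : (a *: x + y).1 = a *: x.1 + y.1. Proof. by []. Qed.
Fact psnd_lin a (x y : M * N) : (a *: x + y).2 = a *: x.2 + y.2. Proof. by []. Qed.
Fact pinl_lin a (x y : M) : (a *: x + y, 0 : N) = a *: (x, 0) + (y, 0).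
Proof. by apply/pair_eqP; rewrite /= eqxx scaler0 addr0 eqxx. Qed.
Fact pinr_lin a (x y : N) : (0 : M, a *: x + y) = a *: (0, x) + (0, y).
Proof. by apply/pair_eqP; rewrite /= eqxx scaler0 addr0 eqxx. Qed.
Definition pfst : {linear (M * N)%type -> M} := make_linear pfst_lin.
Definition psnd : {linear (M * N)%type -> N} := make_linear psnd_lin.
Definition pinl : {linear M -> (M * N)%type} := make_linear pinl_lin.
Definition pinr : {linear N -> (M * N)%type} := make_linear pinr_lin.
End Pairs.

Definition local_end M : Prop := ~ is_zero M /\
  forall a : {linear M -> M}, bijective a \/ bijective (fun x => x - a x).

(** Locality is applied to the idempotent projecting onto the first factor: if it is bijective the
    second factor vanishes, otherwise the first. *)
Lemma local_indecomposable M : local_end M -> indecomposable M.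
Proof.
move=> [M0 Mloc]; split=> // N T [f /linear_inverse[g [fK gK]]].
have [ab|ab] := Mloc (g \o (pinl N T \o (pfst N T \o f)) : {linear M -> M}); [right=> t | left=> n].
  have h0 : g (0, t) = 0.
    by apply: (bij_inj ab); rewrite linear0 /= gK; exact: (linear0 g).
  by have := gK (0, t); rewrite h0 linear0 => -[].
have h0 : g (n, 0) = 0.
  by apply: (bij_inj ab); rewrite linear0 subr0 /= gK subrr.
by have := gK (n, 0); rewrite h0 linear0 => -[].
Qed.

(** [X] is the direct sum of a copy of [N] and the kernel of [q], so the kernel must vanish. *)
Lemma retract_isomorphic X N (p : {linear N -> X}) (q : {linear X -> N}) :
  indecomposable X -> ~ is_zero N -> cancel p q -> isomorphic X N.
Proof.
move=> [_ Xi] N0 pK; have sK : submodule [set x | q x = 0].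
  exact: (submodule_preim q (submodule0 N)).
have hK x : q (x - p (q x)) = 0 by rewrite linearB pK subrr.
have f_lin a x y : (q (a *: x + y), subm_mk sK (hK (a *: x + y))) =
    a *: (q x, subm_mk sK (hK x)) + (q y, subm_mk sK (hK y)).
  congr (_, _); first by rewrite linearP.
  by apply: val_inj; rewrite /= (linearP q) (linearP p) scalerBr opprD addrACA.
have [] := Xi N (subm sK); [|by []|move=> K0].
  exists (make_linear f_lin), (fun z => p z.1 + val z.2) => [x|[n u]].
    by rewrite /= addrC subrK.
  have qu : q (val u) = 0 := submP u.
  have e : q (p n + val u) = n by rewrite linearD pK qu addr0.
  rewrite /= /linear_fun; congr (_, _); first exact: e.
  by apply: val_inj; rewrite /= e addrC addKr.
exists q, p => // x; apply/eqP; rewrite eq_sym -subr_eq0; apply/eqP.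
exact: (congr1 val (K0 (subm_mk sK (hK x)))).
Qed.

(** Finite sums of maps that factor through modules of [C]. For the identity this says that [M] is a
    direct summand of a finite direct sum of modules of [C], without forming that sum. *)
Inductive facsum (C : lmodType A -> Prop) M : (M -> M) -> Prop :=
| facsum0 : facsum C (fun _ => 0)
| facsumS (f : M -> M) N (i : {linear M -> N}) (p : {linear N -> M}) :
    C N -> facsum C f -> facsum C (fun x => f x + p (i x)).

Section FacSum.
Context (C : lmodType A -> Prop).

Lemma facsum_lin M f a (x y : M) : facsum C f -> f (a *: x + y) = a *: f x + f y.
Proof.
elim=> [|f' N i p _ _ IH]; first by rewrite scaler0 addr0.
by rewrite IH !linearP scalerDr addrACA.
Qed.

Lemma facsumD M (f g : M -> M) : facsum C f -> facsum C g -> facsum C (fun x => f x + g x).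
Proof.
move=> fS; elim=> [|g' N i p CN _ IH].
  by rewrite (_ : (fun _ => _) = f) //; apply/funext => x; rewrite addr0.
rewrite (_ : (fun _ => _) = (fun x => f x + g' x + p (i x))); first exact: facsumS.
by apply/funext => x; rewrite addrA.
Qed.

Lemma facsum_comp M N (u : {linear M -> N}) (v : {linear N -> M}) f :
  facsum C f -> facsum C (fun x => u (f (v x))).
Proof.
elim=> [|f' T i p CT _ IH].
  by rewrite (_ : (fun _ => _) = (fun=> 0)); [apply: facsum0 | apply/funext => x; rewrite linear0].
rewrite (_ : (fun _ => _) = (fun x => u (f' (v x)) +
    (u \o p : {linear T -> N}) ((i \o v : {linear N -> T}) x))); first exact: facsumS.
by apply/funext => x; rewrite linearD.
Qed.

Lemma facsum_in M : C M -> facsum C (@id M).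
Proof.
move=> CM; rewrite (_ : id = (fun x : M => 0 + (idfun : {linear M -> M}) ((idfun : {linear M -> M}) x))).
  by apply: facsumS => //; apply: facsum0.
by apply/funext => x; rewrite add0r.
Qed.

Lemma facsum_retract M N (p : {linear N -> M}) (q : {linear M -> N}) :
  cancel q p -> facsum C (@id N) -> facsum C (@id M).
Proof.
move=> qK /(facsum_comp p q); rewrite (_ : (fun _ => _) = id) //.
by apply/funext.
Qed.

Lemma facsum_iso M N : isomorphic M N -> facsum C (@id M) -> facsum C (@id N).
Proof. by case=> f /linear_inverse[g [_ gK]]; apply: (facsum_retract (q := g) (p := f)). Qed.

Lemma facsum_add_closure (D : lmodType A -> Prop) M :
  (forall N, D N -> facsum C (@id N)) -> add_closure D M -> facsum C (@id M).
Proof.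
move=> DC; elim=> {M} [M /DC //|M N e _|M M0|M N _ IM _ IN|M N _ IMN].
- exact: facsum_iso.
- by rewrite (_ : id = fun=> 0); [apply: facsum0 | apply/funext].
- rewrite (_ : id = fun x => pinl M N (pfst M N x) + pinr M N (psnd M N x)); last first.
    by apply/funext => -[x y]; apply/esym/pair_eqP; rewrite /= addr0 add0r !eqxx.
  by apply: facsumD; [apply: (facsum_comp _ _ IM) | apply: (facsum_comp _ _ IN)].
- exact: (facsum_retract (q := pinl M N) (p := pfst M N)).
Qed.

(* If 1 - ab is invertible, then so is 1 - ba. *)
Lemma bij_sub_comp M N (p : {linear N -> M}) (i : {linear M -> N}) :
  bijective (fun n => n - i (p n)) -> bijective (fun x => x - p (i x)).
Proof.
move=> bij; have l_lin a x y : (a *: x + y) - i (p (a *: x + y)) =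
    a *: (x - i (p x)) + (y - i (p y)).
  by rewrite (linearP p) (linearP i) scalerBr opprD addrACA.
have [b [bK Kb]] := @linear_inverse _ _ _ (make_linear l_lin) bij.
exists (fun x => x + p (b (i x))) => x.
  have -> : i (x - p (i x)) = make_linear l_lin (i x) by rewrite linearB.
  by rewrite bK subrK.
have := Kb (i x); set n := b (i x); rewrite /= /linear_fun => h.
have -> : i (x + p n) = n by rewrite linearD -h subrK.
by rewrite addrK.
Qed.

(* Azumaya's exchange argument: if h = f + p i is bijective, then either the
   summand N on which i h^-1 p is bijective splits off X, or f is bijective. *)
Lemma facsum_indecomposable X (f : X -> X) : (forall N, C N -> local_end N) -> indecomposable X ->
  facsum C f -> bijective f -> exists2 N, C N & isomorphic X N.
Proof.
move=> Cloc Xi; have [X0 _] := Xi; elim=> [|f' N i p CN fS IH] bij.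
  by case: X0 => x; apply: (bij_inj bij).
have h_lin a x y : f' (a *: x + y) + p (i (a *: x + y)) =
    a *: (f' x + p (i x)) + (f' y + p (i y)).
  by rewrite (facsum_lin a x y fS) (linearP i) (linearP p) scalerDr addrACA.
have [g [gK Kg]] := @linear_inverse _ _ _ (make_linear h_lin) bij.
have [N0 Nloc] := Cloc N CN.
have [ab|ab] := Nloc (i \o (g \o p) : {linear N -> N}).
  have [b [bK Kb]] := linear_inverse ab; exists N => //.
  exact: (@retract_isomorphic _ _ (g \o p : {linear N -> X}) (b \o i : {linear X -> N})).
(* Now 1 - i g p is bijective, hence so is 1 - g p i, and f' is h = f' + p i composed with it. *)
apply: IH; have := @bij_sub_comp X N (g \o p : {linear N -> X}) i ab => gf.
rewrite (_ : f' = make_linear h_lin \o (fun x => x - (g \o p) (i x))); first exact: bij_comp.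
apply/funext => x; rewrite [RHS]/= linearB Kg /= /linear_fun.
by rewrite addrK.
Qed.

Lemma add_closure_indecomposable (D : lmodType A -> Prop) X :
  (forall N, C N -> local_end N) -> (forall N, D N -> facsum C (@id N)) ->
  add_closure D X -> indecomposable X -> exists2 N, C N & isomorphic X N.
Proof.
move=> Cloc DC DX Xi; apply: (facsum_indecomposable Cloc Xi (facsum_add_closure DC DX)).
by exists id.
Qed.

End FacSum.
End Exchange.

(** * Composition series *)

Section CompositionSeries.
Context (A : pzRingType).
Implicit Types (M N X : lmodType A).

Definition strict_chain M n (F : nat -> set M) : Prop :=
  (forall i, (i <= n)%N -> submodule (F i)) /\ forall i, (i < n)%N -> F i `<` F i.+1.

Definition length_le M d : Prop := forall n F, @strict_chain M n F -> (n <= d)%N.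

Lemma length_le_surj M X (g : {linear M -> X}) d : surj g -> length_le M d -> length_le X d.
Proof.
move=> g_surj Md n F [sF cF]; apply: (Md n (fun i => g @^-1` F i)); split=> i lt.
  exact/submodule_preim/sF.
have [FF nF] := cF i lt; split=> [x|h]; first exact: FF.
by apply: nF => y; have [x <-] := g_surj y; apply: h.
Qed.

Lemma length_le_inj M X (g : {linear X -> M}) d : injective g -> length_le M d -> length_le X d.
Proof.
move=> g_inj Md n F [sF cF]; apply: (Md n (fun i => g @` F i)); split=> i lt.
  exact/submodule_im/sF.
have [FF nF] := cF i lt; split=> [_ [x Fx <-]|h]; first by exists x => //; apply: FF.
by apply: nF => y Fy; have [|x Fx /g_inj <-//] := h (g y); exists y.
Qed.

(** A strict chain of maximal length from 0 to [X] cannot be refined, so each of its terms is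
    maximal in the next. *)
Lemma composition_series_ex X d : length_le X d -> exists n F, @composition_series A X n F.
Proof.
move=> Xd; pose P n := `[< exists F, [/\ @strict_chain X n F, F 0%N = [set 0] & F n = [set: X]] >].
have exP : exists n, P n.
  have [X0|/existsNP[x x0]] := pselect (forall x : X, x = 0).
    exists 0%N; apply/asboolP; exists (fun=> [set 0]); split=> //.
      by split=> // i _; apply: submodule0.
    by rewrite predeqE => x; split=> // _; apply: X0.
  exists 1%N; apply/asboolP; exists (fun i => if i is 0 then [set 0] else setT); split=> //.
  split=> [[|i] _ //|[|i] // _]; first exact: submodule0.
  by split=> // h; apply: x0; apply: (h x).
have leP n : P n -> (n <= d)%N by move/asboolP => [F [h _ _]]; apply: Xd h.
have [n /asboolP[F [[sF cF] F0 Fn]] n_max] := ex_maxnP exP leP.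
exists n, F; split=> // t lt; split; first exact: sF.
have [FF nF] := cF t lt; split=> //; first exact/sF/ltnW.
  by move=> e; apply: nF; rewrite e.
move=> W sW FW WF; apply: contrapT => /not_orP[n1 n2].
suff /n_max : P n.+1 by rewrite ltnn.
have FW' : F t `<` W by split=> // h; apply: n1; rewrite eqEsubset.
have WF' : W `<` F t.+1 by split=> // h; apply: n2; rewrite eqEsubset.
(* The chain with [W] inserted between positions t and t + 1, the later terms being shifted by
   one. *)
apply/asboolP; exists (fun i => if (i <= t)%N then F i else if i == t.+1 then W else F i.-1).
split=> //; last by rewrite ltnNge ltnW // gtn_eqF // ltnS.
split=> i; first case: (leqP i t) => [le _|lti len].
- by apply: sF; apply: leq_trans le (ltnW lt).
- case: eqP => // _; apply: sF; by case: i len {lti}.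
rewrite ltnS => len; case: (ltngtP i t) => [lti|lti|->].
- apply: cF; apply: ltn_trans lti lt.
- rewrite eqSS (gtn_eqF lti).
  case: i len lti => // i len lti; case: eqP => [[->] //|_]; exact: cF.
- by rewrite eqxx.
Qed.

End CompositionSeries.

(** * The modules R e_v / J^l e_v *)

Lemma inj_surj_bijective (X Y : Type) (f : X -> Y) : injective f -> surj f -> bijective f.
Proof.
move=> f_inj f_surj; exists (fun y => sval (cid (f_surj y))) => [x|y]; last by case: cid.
by apply: f_inj; case: cid.
Qed.

Lemma cyclic_linear (A : pzRingType) (N M : lmodType A) (x : N) (u : M) :
  (forall y, exists a, y = a *: x) -> (forall a, a *: x = 0 -> a *: u = 0) ->
  exists f : {linear N -> M}, forall a, f (a *: x) = a *: u.
Proof.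
move=> x_gen x_ann; pose f y := sval (cid (x_gen y)) *: u.
have fE a : f (a *: x) = a *: u.
  rewrite /f; case: cid => b /= /eqP; rewrite -subr_eq0 -scalerBl => /eqP/x_ann/eqP.
  by rewrite scalerBl subr_eq0 => /eqP->.
have f_lin a y z : f (a *: y + z) = a *: f y + f z.
  have [b ->] := x_gen y; have [c ->] := x_gen z.
  by rewrite scalerA -scalerDl !fE scalerDl scalerA.
by exists (make_linear f_lin).
Qed.

Lemma linear_inj (A : pzRingType) (N M : lmodType A) (f : {linear N -> M}) :
  (forall x, f x = 0 -> x = 0) -> injective f.
Proof.
move=> h x y e; apply/eqP; rewrite -subr_eq0; apply/eqP/h.
by rewrite linearB e subrr.
Qed.

Section Typed.
Context (k : fieldType) (Q : quiver) (m : nat) (R : algebra k).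
Context (pi : {rmorphism path_algebra k Q -> R}).
Hypothesis pres : presents pi (ideal_pow (arrow_ideal k Q) m).
Hypothesis m_gt0 : (0 < m)%N.
Hypothesis Q_ns : no_sources Q.
Implicit Types (p q : qpath Q) (v w : vertex Q) (a b r : R) (s l n : nat) (N M : lmodType R).
Local Notation coef := (coef pres).
Local Notation mon := (mon pi).
Local Notation vid := (vid pi).
Local Notation ford := (ford pres).

(** The absence of sources enters here: a path into [v] is built backwards from its end. *)
Lemma path_into v n : exists p, ptgt p = v /\ plen p = n.
Proof.
elim: n v => [|n IHn] v; first by exists (lazy_path v).
have [a <-] := Q_ns v; have [p [tp lp]] := IHn (src a).
have [r [er sr ar]] := @pmul_some _ (arrow_path a) p tp.
exists r; split; last by rewrite /plen ar size_cat addn1 [X in X.+1]lp.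
by rewrite /ptgt sr ar walk_end_cat -/(ptgt p) tp.
Qed.

Definition path_from v n : Prop := exists p, psrc p = v /\ plen p = n.

(* The module N is isomorphic to R e_v / J^l e_v, and x corresponds to the class of e_v. *)
Definition typed_gen v (l : nat) N (x : N) : Prop :=
  (forall y, exists a, y = a *: x) /\ (forall a, a *: x = 0 <-> ford l (a * vid v)).

(* The last condition makes l the Loewy length of N. *)
Definition typed_at v l N (x : N) : Prop :=
  [/\ typed_gen v l x, (0 < l <= m)%N & path_from v l.-1].

Definition typed N : Prop := exists v l (x : N), typed_at v l x.

Lemma typed_gen_vid v l N (x : N) : typed_gen v l x -> vid v *: x = x.
Proof.
move=> [_ /(_ (1 - vid v)) [_ h]]; apply/esym/eqP; rewrite -subr_eq0; apply/eqP.
rewrite -{1}[x]scale1r -scalerBl; apply: h.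
by rewrite mulrBl mul1r vidM eqxx subrr; apply: ford_zero.
Qed.

Lemma typed_gen_map v l N M (x : N) (u : M) : typed_gen v l x ->
  (forall a, ford l (a * vid v) -> a *: u = 0) ->
  exists f : {linear N -> M}, forall a, f (a *: x) = a *: u.
Proof. by move=> [gx ax] h; apply: cyclic_linear => // a /ax; apply: h. Qed.

Lemma typed_gen_iso v l N M (x : N) (u : M) :
  typed_gen v l x -> typed_gen v l u -> isomorphic N M.
Proof.
move=> tx [gu au]; have [|f fE] := @typed_gen_map v l N M x u tx; first by move=> a /au.
have [gx ax] := tx; exists f; apply: inj_surj_bijective => [|y]; last first.
  by have [a ->] := gu y; exists (a *: x).
apply: linear_inj => y; have [a ->] := gx y.
by rewrite fE => /au /ax.
Qed.

Lemma typed_gen_transfer v l N M (f : {linear N -> M}) (x : N) :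
  bijective f -> typed_gen v l x -> typed_gen v l (f x).
Proof.
move=> bf [gx ax]; split=> [y|a].
  have [g fK gK] := bf; have [a e] := gx (g y).
  by exists a; rewrite -linearZ -e gK.
rewrite -ax -linearZ; split=> [h|->]; last exact: linear0.
by apply: (bij_inj bf); rewrite linear0.
Qed.

Lemma typed_iso N M : isomorphic N M -> typed N -> typed M.
Proof.
move=> [f bf] [v [l [x [tx lx px]]]]; exists v, l, (f x); split=> //.
exact: typed_gen_transfer.
Qed.

Lemma typed_neq0 v l N (x : N) : typed_at v l x -> x <> 0.
Proof.
move=> [[_ ax] /andP[l0 _] _] x0; have [+ _] := ax 1; rewrite scale1r mul1r => /(_ x0).
move/(_ (lazy_path v) l0); rewrite coef_lazy_vid // eqxx => /eqP.
by rewrite oner_eq0.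
Qed.

(** On generators, homomorphisms are given by elements of e_v R e_w; a nonzero coefficient at the
    lazy path will make such a map onto. *)
Lemma typed_hom v l w l' N M (x : N) (x' : M) (f : {linear N -> M}) :
  typed_gen v l x -> typed_gen w l' x' ->
  exists r, [/\ f x = r *: x', vid v * r = r & r * vid w = r].
Proof.
move=> tx tx'; have [a e] := tx'.1 (f x); exists (vid v * a * vid w); split.
- rewrite -!scalerA (typed_gen_vid tx') -e -linearZ (typed_gen_vid tx) //.
- by rewrite !mulrA vidM eqxx.
- by rewrite -!mulrA vidM eqxx.
Qed.

Lemma typed_hom_surj v w l N M (x : N) (x' : M) (f : {linear N -> M}) r :
  typed_gen w l x' -> f x = r *: x' -> vid v * r = r -> r * vid w = r ->
  coef (lazy_path w) r != 0 -> v = w /\ surj f.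
Proof.
move=> tx' fx vr rw r0; split.
  apply/eqP; apply: contraNT r0; rewrite -vr coef_vid_mul /ptgt /= /psrc /= eq_sym.
  by move/negbTE->.
have [/(_ rw)[z zr] _] := vid_inv m_gt0 r0 => y.
have [b ->] := tx'.1 y; exists (b *: (z *: x)).
by rewrite !linearZ /= fx [z *: _]scalerA zr (typed_gen_vid tx').
Qed.

Lemma typed_hom_bij v l N M (x : N) (x' : M) (f : {linear N -> M}) r :
  typed_gen v l x -> typed_gen v l x' -> f x = r *: x' -> vid v * r = r -> r * vid v = r ->
  coef (lazy_path v) r != 0 -> bijective f.
Proof.
move=> tx tx' fx vr rv r0; apply: inj_surj_bijective; last first.
  by have [] := typed_hom_surj tx' fx vr rv r0.
apply: linear_inj => y; have [b ->] := tx.1 y; rewrite linearZ /= fx scalerA => /tx'.2 h.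
have [_ /(_ vr)[z rz]] := vid_inv m_gt0 r0; apply/tx.2.
by rewrite -rz mulrA; apply: fordMr; rewrite -rv mulrA.
Qed.

(** For an endomorphism given by [r], the elements [r] and e_v - r cannot both have coefficient 0 at
    the lazy path of [v]. *)
Lemma typed_local N : typed N -> local_end N.
Proof.
move=> [v [l [x tx]]]; have := tx => -[tg _ _]; split=> [N0|f].
  exact: (typed_neq0 tx).
have [r [fx vr rv]] := typed_hom f tg tg.
have [r0|r0] := eqVneq (coef (lazy_path v) r) 0; [right | left]; last exact: (typed_hom_bij tg tg fx vr rv r0).
have g_lin a y z : (a *: y + z) - f (a *: y + z) = a *: (y - f y) + (z - f z).
  by rewrite linearP scalerBr opprD addrACA.
apply: (@typed_hom_bij v l N N x x (make_linear g_lin) (vid v - r)) => //.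
- by rewrite /= /linear_fun fx scalerBl (typed_gen_vid tg).
- by rewrite mulrBr vr vidM eqxx.
- by rewrite mulrBl rv vidM eqxx.
- by rewrite raddfB /= r0 subr0 coef_lazy_vid // eqxx oner_eq0.
Qed.

Definition order_at (s : nat) r : Prop := ford s r /\ exists2 p, plen p = s & coef p r != 0.

Lemma order_ex r : r <> 0 -> exists2 s, (s < m)%N & order_at s r.
Proof.
move=> r0; have exP : exists s, `[< exists2 p, plen p = s & coef p r != 0 >].
  apply: contrapT => h; apply: r0; apply: (@coef_inj _ _ _ _ _ pres) => p.
  rewrite raddf0; apply/eqP; apply: contrapT => /negP h'; apply: h.
  by exists (plen p); apply/asboolP; exists p.
have [s /asboolP[p ps p0] s_min] := ex_minnP exP; exists s.
  by rewrite ltnNge; apply: contra_neqN p0 => le; rewrite coef_long // ps.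
split; last by exists p.
move=> q lt; apply/eqP; apply: contraLR lt => q0; rewrite -leqNgt; apply: s_min.
by apply/asboolP; exists q.
Qed.

(** Orders add in a product as long as the sum stays below m. Let q and p be leading paths of a e_v
    and [u]; they are composable because q starts and p ends at [v]. Only the cut at [s] contributes
    to the coefficient at the composed path, and it contributes the product of the two leading
    coefficients. *)
Lemma order_ann v u (s : nat) a : vid v * u = u -> order_at s u ->
  a * u = 0 <-> ford (m - s) (a * vid v).
Proof.
move=> vu [us [p ps p0]]; rewrite -vu mulrA; set b := a * vid v; split=> [bu0|h]; last first.
  apply: (@ford_eq0 _ _ _ _ _ pres).
  have [le|lt] := leqP s m; first by apply: (@ford_le _ _ _ _ _ pres _ _ _ (eq_leq (esym (subnK le)))); apply: ford_mul.
  by apply: fordMl; apply: ford_le us; apply: ltnW.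
apply: contrapT => bN.
have b0 : b <> 0 by move=> e; apply: bN; rewrite e; apply: ford_zero.
have [t _ [bt [q qt q0]]] := order_ex b0.
have lt : (t + s < m)%N.
  by rewrite ltnNge; apply/negP => le; apply: bN; apply: ford_le bt; rewrite leq_subLR addnC.
have sq : psrc q = v.
  by apply/eqP; apply: contraNT q0; rewrite coef_mul_vid => /negbTE->.
have tp : ptgt p = v.
  by apply/eqP; apply: contraNT p0; rewrite -vu coef_vid_mul => /negbTE->.
have [|r er] := @pmul_ex _ q p; first by rewrite sq.
have [lr eq ep] := pmul_cutP er; rewrite ps qt in lr ep eq.
have : coef r (b * u) = 0 by rewrite bu0 raddf0.
rewrite coef_mul; last by rewrite lr addnC.
have lt' : (s < (plen r).+1)%N by rewrite ltnS lr leq_addr.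
rewrite (bigD1 (Ordinal lt')) //= big1 ?addr0 => [/eqP|i ni].
  by rewrite -eq -ep mulf_eq0 (negbTE q0) (negbTE p0).
have le : (i <= plen r)%N by rewrite -ltnS.
have [lti|lti|e] := ltngtP i s.
- by rewrite us ?mulr0 // plen_take.
- rewrite bt ?mul0r // plen_drop ltn_subLR //.
  by apply: (leq_ltn_trans (eq_leq lr)); rewrite ltn_add2r.
- by case/eqP: ni; apply: val_inj.
Qed.

Lemma path_from_ford v n a : ~ path_from v n -> ford n (a * vid v) -> ford n.+1 (a * vid v).
Proof.
move=> nf an p; rewrite ltnS leq_eqVlt => /predU1P[lp|/an//].
rewrite coef_mul_vid; case: eqP => // sp.
by case: nf; exists p.
Qed.

(** If no path of length l - 1 starts at [v], then J^(l-1) e_v = J^l e_v, so [l] can be lowered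
    until such a path exists; this ends above 0 because the module is nonzero. *)
Lemma typed_gen_typed v l N (x : N) : (l <= m)%N -> ~ is_zero N -> typed_gen v l x ->
  exists2 l', (l' <= l)%N & typed_at v l' x.
Proof.
move=> + N0; elim: l => [_ [gx ax]|l IHl lm tx].
  by case: N0 => y; have [a ->] := gx y; apply/ax.
have [pf|npf] := pselect (path_from v l); first by exists l.+1.
have [gx ax] := tx; have [|l' le tx'] := IHl (ltnW lm); last by exists l' => //; apply: leqW.
split=> // a; rewrite ax; split; first exact: ford_le.
exact: path_from_ford.
Qed.

Section Cyclic.
Context (M : lmodType R) (u : M).
Definition cyclic_set : set M := [set y | exists a, y = a *: u].
Lemma cyclic_submodule : submodule cyclic_set.
Proof.
split; first by exists 0; rewrite scale0r.
by move=> a _ _ [b ->] [c ->]; exists (a * b + c); rewrite scalerDl scalerA.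
Qed.
Definition cyclic_mod : lmodType R := subm cyclic_submodule.
Lemma cyclic_gen_in : cyclic_set u. Proof. by exists 1; rewrite scale1r. Qed.
Definition cyclic_gen : cyclic_mod := subm_mk cyclic_submodule cyclic_gen_in.

Lemma cyclic_typed_gen v l : (forall a, a *: u = 0 <-> ford l (a * vid v)) ->
  typed_gen v l cyclic_gen.
Proof.
move=> h; split=> [y|a].
  by have [a e] := submP y; exists a; apply: val_inj; rewrite /= e.
by rewrite -h; split=> [/(congr1 val)|e] //; apply: val_inj.
Qed.
End Cyclic.

Lemma mon_typed p : (plen p < m)%N -> path_from (ptgt p) (m - plen p).-1 ->
  typed_at (ptgt p) (m - plen p) (cyclic_gen (mon p : R^o)).
Proof.
move=> lt pf; split=> //; last by rewrite subn_gt0 lt leq_subr.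
apply: cyclic_typed_gen => a; apply: order_ann; first exact: vid_mon_mul.
split; first exact: ford_mon.
by exists p => //; rewrite coef_mon lt eqxx oner_eq0.
Qed.

Lemma typed_canonical v l : (0 < l <= m)%N -> path_from v l.-1 ->
  exists p, [/\ ptgt p = v, plen p = (m - l)%N & typed_at v l (cyclic_gen (mon p : R^o))].
Proof.
move=> /andP[l0 lm] pf; have [p [tp lp]] := path_into v (m - l); exists p; split=> //.
have e : (m - plen p)%N = l by rewrite lp subKn.
have := @mon_typed p; rewrite e tp; apply=> //.
by rewrite lp ltn_subrL l0.
Qed.

Lemma typed_embed N : typed N -> exists f : {linear N -> R^o}, injective f.
Proof.
move=> [v [l [x [tx lm pf]]]]; have [p [_ _ [tc _ _]]] := typed_canonical lm pf.
have [f /bij_inj f_inj] := typed_gen_iso tx tc.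
exists (subm_val _ \o f : {linear N -> R^o}) => y z /= e; apply: f_inj.
exact: val_inj.
Qed.

End Typed.

(** * Radicals and Loewy length *)

Section Radical.
Context (k : fieldType) (Q : quiver) (m : nat) (R : algebra k).
Context (pi : {rmorphism path_algebra k Q -> R}).
Hypothesis pres : presents pi (ideal_pow (arrow_ideal k Q) m).
Hypothesis m_gt0 : (0 < m)%N.
Implicit Types (p q : qpath Q) (v w : vertex Q) (a b r : R) (s l n : nat).
Implicit Types (N M : lmodType R).
Local Notation coef := (coef pres).
Local Notation mon := (mon pi).
Local Notation vid := (vid pi).
Local Notation ford := (ford pres).

(* J U *)
Definition frad M (U : set M) : set M :=
  [set y | forall V, submodule V -> (forall a u, ford 1 a -> U u -> V (a *: u)) -> V y].

Lemma frad_submodule M (U : set M) : submodule (frad U).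
Proof.
split=> [V [V0 _] //|a x y Ux Uy V sV h]; have [_ VP] := sV.
by apply: VP; [apply: Ux | apply: Uy].
Qed.

Lemma frad_sub M (U : set M) : submodule U -> frad U `<=` U.
Proof. by move=> sU x; apply=> // a u _; apply: submoduleZ. Qed.

Lemma submodule_add M (V W : set M) : submodule V -> submodule W ->
  submodule [set z | exists x y, [/\ V x, W y & z = x + y]].
Proof.
move=> [V0 VP] [W0 WP]; split; first by exists 0, 0; rewrite addr0.
move=> a _ _ [x [y [Vx Wy ->]]] [x' [y' [Vx' Wy' ->]]].
exists (a *: x + x'), (a *: y + y'); split; [exact: VP | exact: WP |].
by rewrite scalerDr addrACA.
Qed.

(* Nakayama's lemma, as ford m is zero. *)
Lemma frad_maximal M (U V : set M) : submodule U -> maximal_submodule U V -> frad U `<=` V.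
Proof.
move=> sU [sV VU VneU Vmax] y Uy.
have [] := Vmax _ (submodule_add sV (frad_submodule U)) _ _.
- by move=> x Vx; exists x, 0; split; rewrite ?addr0 //; case: (frad_submodule U).
- move=> _ [x [z [Vx Uz ->]]]; apply: submoduleD => //; first exact: VU.
  exact: frad_sub.
- move=> e; suff : [set z | exists x y, [/\ V x, frad U y & z = x + y]] y by rewrite e.
  by exists 0, y; split; rewrite ?add0r //; case: sV.
move=> e; case: VneU; rewrite eqEsubset; split=> // u Uu.
(* Starting from J^m U = 0, the inclusion of J^(m-n) U in [V] is passed from n to n + 1 by means of
   U = V + J U; at n = m it says that U lies in V. *)
suff h n : (n <= m)%N -> forall a z, ford (m - n) a -> U z -> V (a *: z).
  by rewrite -[u]scale1r; apply: (h m) => //; rewrite subnn.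
elim: n => [_ a z|n IHn lt a z az Uz].
  by rewrite subn0 => /ford_eq0-> _; rewrite scale0r; case: sV.
have : [set z | exists x y, [/\ V x, frad U y & z = x + y]] z by rewrite e.
move=> [x [t [Vx Ut ->]]]; rewrite scalerDr; apply: submoduleD => //; first exact: submoduleZ.
have sW : submodule [set t | forall b, ford (m - n.+1) b -> V (b *: t)].
  split=> [b _|b t1 t2 h1 h2 c cf]; first by rewrite scaler0; case: sV.
  rewrite scalerDr scalerA; apply: submoduleD => //; last exact: h2.
  by apply: h1; apply: fordMr.
apply: (Ut _ sW) az => c u' c1 Uu' b bf; rewrite scalerA; apply: IHn => //; first exact: ltnW.
by rewrite -subnSK // -addn1; apply: ford_mul.
Qed.

Lemma mod_vid_sum M (x : M) : x = \sum_v vid v *: x.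
Proof. by rewrite -scaler_suml vid_sum scale1r. Qed.

(* U / frad U is a sum of one-dimensional modules. *)
Lemma maximal_avoiding M (U V : set M) z : submodule U -> submodule V -> frad U `<=` V ->
  V `<=` U -> U z -> ~ V z ->
  (forall W, submodule W -> V `<=` W -> W `<=` U -> ~ W z -> W = V) ->
  maximal_submodule U V.
Proof.
move=> sU sV FV VU Uz Vz Vmax; split=> // [e|W sW VW WU]; first by apply: Vz; rewrite e.
have [Wz|nWz] := pselect (W z); last by left; apply: Vmax.
right; rewrite eqEsubset; split=> // u Uu; rewrite [u]mod_vid_sum.
apply: submodule_sum => // w _; set u' := vid w *: u.
have Uu' : U u' by apply: submoduleZ.
have [/VW//|Vu'] := pselect (V u').
pose V' := [set z | exists x y, [/\ V x, cyclic_set u' y & z = x + y]].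
have sV' : submodule V' by apply: submodule_add => //; apply: cyclic_submodule.
have [x [_ [Vx [a ->] ze]]] : V' z.
  apply: contrapT => V'z; apply: Vu'; rewrite -(Vmax V') //.
  - by exists 0, u'; split; rewrite ?add0r //; [case: sV | apply: cyclic_gen_in].
  - by move=> x Vx; exists x, 0; split; rewrite ?addr0 //; case: (cyclic_submodule u').
  - move=> _ [x [_ [Vx [a ->] ->]]]; apply: submoduleD => //; first exact: VU.
    exact: submoduleZ.
(* On u' = e_w u the element [a] acts modulo J U as the scalar [c]. As z = x + a u' is not in [V],
   this scalar is nonzero and u' can be recovered from z. *)
pose c := coef (lazy_path w) a; pose n := a * vid w - scal R c * vid w.
have n1 : ford 1 n.
  apply/asboolP/ford1P => v; rewrite raddfB /= coef_scal coef_mul_vid /psrc /= coef_lazy_vid // [w == v]eq_sym -/c.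
  have [->|_] := eqVneq v w; first by rewrite mulr1 subrr.
  by rewrite mulr0 subrr.
have au' : a *: u' = n *: u' + scal R c *: u'.
  have vu : vid w *: u' = u' by rewrite /u' scalerA vidM eqxx.
  by rewrite -{1}vu scalerA -[X in _ = _ + _ *: X]vu scalerA -scalerDl subrK.
have Vn : V (n *: u') by apply: FV => V1 _; apply.
have c0 : c != 0.
  apply/eqP => c0; apply: Vz; rewrite ze au' c0 rmorph0 scale0r addr0.
  exact: submoduleD.
have -> : u' = scal R c^-1 *: (z - (x + n *: u')).
  rewrite ze au' addrA [_ - _]addrC addKr scalerA -rmorphM mulVf //.
  by rewrite rmorph1 scale1r.
apply: submoduleZ => //; apply: submoduleB => //; apply: VW.
exact: submoduleD.
Qed.

(** If y is not in J U, then some z = e_v y is not either. By Zorn's lemma, as [M] is arbitrary,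
    there is a submodule maximal among those between J U and U that avoid z; it is a maximal
    submodule of U and does not contain y. *)
Lemma rad_frad M (U : set M) : submodule U -> Defs.rad U = frad U.
Proof.
move=> sU; rewrite eqEsubset; split=> y; last first.
  by move=> Fy; split=> [|V Vm]; [apply: frad_sub | apply: (frad_maximal sU Vm)].
move=> [Uy Vy]; apply: contrapT => nFy.
have [v zF] : exists v, ~ frad U (vid v *: y).
  apply: contrapT => h; apply: nFy; rewrite [y]mod_vid_sum.
  apply: submodule_sum => [|v _]; first exact: frad_submodule.
  by apply: contrapT => h'; apply: h; exists v.
pose z := vid v *: y; have Uz : U z by apply: submoduleZ.
pose good (V : set M) := [/\ submodule V, frad U `<=` V, V `<=` U & ~ V z].
have gF : good (frad U) by split=> //; [apply: frad_submodule | apply: frad_sub].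
have [|V [[V0|[sV FV VU Vz]] Vmax]] := @Zorn_bigcup M [set V | V = set0 \/ good V].
- move=> F FP Ftot; have [Fe|] := pselect (forall V, F V -> V = set0).
    by left; rewrite predeqE => x; split=> // -[V /Fe->].
  move=> /existsNP[V0 /not_implyP[FV0 V0n]]; right.
  have [//|[sV0 FV VU Vz]] := FP V0 FV0; split.
  + split; first by exists V0 => //; case: sV0.
    move=> a x x' [V FV1 Vx] [V' FV' Vx'].
    have [V1 [F1 V1x V1x']] : exists V1, [/\ F V1, V1 x & V1 x'].
      have [h|h] := Ftot V V' FV1 FV'; first by exists V'; split=> //; apply: h.
      by exists V; split=> //; apply: h.
    exists V1 => //; have [e|[[_ VP] _ _ _]] := FP V1 F1; last exact: VP.
    by rewrite e in V1x.
  + by move=> x /FV; exists V0.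
  + by move=> x [V /FP[->//|[_ _ VU' _]] /VU'].
  + by move=> [V /FP[->//|[_ _ _ Vz']] /Vz'].
- case: (Vmax (frad U)); last by right.
  by rewrite V0; split=> // h; have [F0 _] := frad_submodule U; apply: (h 0).
apply: (Vz); apply: submoduleZ => //; apply: Vy; apply: (maximal_avoiding (z := z)) => //.
move=> W sW VW WU Wz; apply: contrapT => ne; apply: (Vmax W); last by right; split=> // x /FV /VW.
by split=> // WV; apply: ne; rewrite eqEsubset.
Qed.

Definition layer n M (x : M) : set M := [set y | exists2 a, ford n a & y = a *: x].

Lemma layer_submodule n M (x : M) : submodule (layer n x).
Proof.
split; first by exists 0; [apply: ford_zero | rewrite scale0r].
move=> a _ _ [b bf ->] [c cf ->]; exists (a * b + c); last by rewrite scalerDl scalerA.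
by apply: fordD => //; apply: fordMl.
Qed.

Lemma frad_layer n M (x : M) : frad (layer n x) = layer n.+1 x.
Proof.
rewrite eqEsubset; split=> [y|_ [a af ->] V sV h].
  apply; first exact: layer_submodule.
  by move=> a _ a1 [b bf ->]; exists (a * b); [apply: (@ford_mul _ _ _ _ _ _ 1) | rewrite scalerA].
rewrite [a](coef_expand pres) scaler_suml; apply: submodule_sum => // p _.
have [lt|le] := ltnP (plen p) n.+1.
  by rewrite af // rmorph0 mul0r scale0r; case: sV.
rewrite -scalerA; apply: submoduleZ => //; rewrite (mon_cut pi n) -scalerA; apply: h.
  by apply: ford_mon; rewrite plen_drop subn_gt0.
exists (mon (ptake n p)) => //; apply: ford_mon.
by rewrite plen_take // ltnW.
Qed.

Lemma rad_pow_layer n M (x : M) : rad_pow n (layer 0 x) = layer n x.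
Proof.
elim: n => // n IHn; rewrite /rad_pow iterS -/(rad_pow n _) IHn.
by rewrite rad_frad ?frad_layer //; apply: layer_submodule.
Qed.

Lemma loewy_length_cyclic M (x : M) l : (forall y, exists a, y = a *: x) -> (0 < l)%N ->
  (forall a, ford l a -> a *: x = 0) -> (exists2 a, ford l.-1 a & a *: x <> 0) ->
  loewy_length M = l.
Proof.
move=> gx l0 hl [a al a0].
have eT : [set: M] = layer 0 x.
  by rewrite predeqE => y; split=> // _; have [b ->] := gx y; exists b.
have z0 i : rad_pow i [set: M] = [set 0] <-> (l <= i)%N.
  rewrite eT rad_pow_layer; split=> [e|le].
    rewrite leqNgt; apply/negP => lt; apply: a0.
    suff : [set 0] (a *: x) by [].
    rewrite -e; exists a => //; apply: ford_le al; by rewrite -ltnS prednK.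
  rewrite predeqE => y; split=> [[b bf ->]|->].
    by rewrite /= hl //; apply: ford_le bf.
  by exists 0; [apply: ford_zero | rewrite scale0r].
rewrite /loewy_length; case: xgetP => [n _ [/z0 e1 e2]|/(_ l)[]]; last first.
  by split=> [|i lt]; [apply/z0 | move/z0; rewrite leqNgt lt].
by apply/eqP; rewrite eqn_leq e1 andbT leqNgt; apply/negP => /e2; apply; apply/z0.
Qed.

End Radical.

(** * Indecomposable modules in adr(R) and sub(R) *)

Section Classification.
Context (k : fieldType) (Q : quiver) (m : nat) (R : algebra k).
Context (pi : {rmorphism path_algebra k Q -> R}).
Hypothesis pres : presents pi (ideal_pow (arrow_ideal k Q) m).
Hypothesis m_gt0 : (0 < m)%N.
Hypothesis Q_ns : no_sources Q.
Implicit Types (p q : qpath Q) (v w : vertex Q) (a b r : R) (s l n : nat).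
Implicit Types (N M : lmodType R).
Local Notation coef := (coef pres).
Local Notation mon := (mon pi).
Local Notation vid := (vid pi).
Local Notation ford := (ford pres).
Local Notation typed := (typed pres).
Local Notation typed_at := (typed_at pres).
Local Notation typed_gen := (typed_gen pres).

Lemma loewy_length_typed v l N (x : N) : typed_at v l x -> loewy_length N = l.
Proof.
move=> [[gx ax] /andP[l0 lm] [p [sp lp]]].
apply: (loewy_length_cyclic (pres := pres) m_gt0 gx l0) => [a af|].
  by apply/ax/fordMr.
exists (mon p) => [|/ax]; first by apply: ford_mon; rewrite lp.
rewrite -sp mon_vid_mul => /(_ p); rewrite lp ltn_predL l0 => /(_ isT)/eqP.
by rewrite coef_mon lp eqxx andbT -ltnS prednK // ltnS lm oner_eq0.
Qed.

(** The vertex rules out the empty quiver, whose algebra is zero and has Loewy length 0. A path of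
    length m - 1 into [v] shows that J^(m-1) is nonzero. *)
Lemma loewy_length_regular v : loewy_length (R^o : lmodType R) = m.
Proof.
apply: (loewy_length_cyclic (pres := pres) (x := 1 : R^o) m_gt0) => // [y|a /ford_eq0->|].
- by exists y; rewrite [_ *: _]mulr1.
- by rewrite scale0r.
have [p [_ lp]] := path_into Q_ns v m.-1.
exists (mon p); first by apply: ford_mon; rewrite lp.
rewrite [_ *: _]mulr1 => /(congr1 (coef p)); rewrite raddf0 coef_mon lp eqxx ltn_predL m_gt0.
by move/eqP; rewrite oner_eq0.
Qed.

Lemma left_ideal_layer (x : R) : left_ideal x = layer pres 0 (x : R^o).
Proof. by rewrite predeqE => y; split=> [[r ->]|[r _ ->]]; exists r. Qed.

Lemma adr_typed M : (exists e i,
    [/\ primitive_idempotent e, (1 <= i <= loewy_length (R^o : lmodType R))%N &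
        subquotient_iso (left_ideal e) (rad_pow i (left_ideal e)) M]) ->
  facsum typed (@id M).
Proof.
move=> [e [i [pe /andP[_ im] [g [g_lin g_im gK]]]]].
have [M0|M0] := pselect (is_zero M).
  by rewrite (_ : id = fun=> 0); [apply: facsum0 | apply/funext].
apply: facsum_in; have [v [u [u' [uu' u'u u1 eE]]]] := primitive_conj pres m_gt0 pe.
rewrite (loewy_length_regular v) in im.
have sL : submodule (left_ideal e) by rewrite left_ideal_layer; apply: layer_submodule.
(* [z] generates R e, since e = u z, and z u = e_v, so right multiplication by [u] moves
   annihilators from [e] to the vertex. *)
pose z : R^o := vid v * u'.
have Lz : left_ideal e z by exists u'; rewrite eE !mulrA u'u mul1r.
suff tz : typed_gen v i (g z).
  by have [l _ tl] := typed_gen_typed im M0 tz; exists v, l, (g z).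
split=> [y|a].
  have [_ [r ->] <-] : (g @` left_ideal e) y by rewrite g_im.
  exists (r * u); rewrite -(linear_onZ _ sL g_lin Lz); congr g.
  by rewrite [RHS]/GRing.scale /= /z eE !mulrA.
rewrite -(linear_onZ _ sL g_lin Lz).
rewrite (gK _ (submoduleZ a sL Lz)) left_ideal_layer rad_pow_layer //.
have zu : z * u = vid v by rewrite /z -mulrA u'u mulr1.
split=> [[b bf h]|af].
  have -> : a * vid v = b * u * vid v.
    transitivity ((a * z : R) * u); first by rewrite -mulrA zu.
    by rewrite (h : a * z = b * e) eE -!mulrA u'u mulr1.
  by do 2!apply: fordMr.
exists (a * vid v * u'); first exact: fordMr.
rewrite [LHS]/GRing.scale [RHS]/GRing.scale /= eE /z !mulrA.
by rewrite -[_ * u' * u]mulrA u'u mulr1 -[a * _ * vid v]mulrA vidM eqxx.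
Qed.

Lemma typed_adr N : typed N -> adr_mod N.
Proof.
move=> [v [l [x tx]]]; have [tg /andP[l0 lm] pf] := tx; have [gx ax] := tg.
apply: add_in; exists (vid v), l; split.
- exact: (primitive_vid pres m_gt0).
- by rewrite (loewy_length_regular v) l0.
rewrite !left_ideal_layer rad_pow_layer //; exists (fun a : R => a *: x); split.
- by move=> a b c _ _; rewrite scalerDl scalerA.
- rewrite predeqE => y; split=> // _; have [a ->] := gx y.
  exists (a * vid v); first by exists a.
  by rewrite -scalerA (typed_gen_vid tg).
- move=> _ [a _ ->]; rewrite [_ *: (vid v : R^o)]/GRing.scale /= ax -mulrA vidM eqxx.
  split=> [af|[b bf ->]]; last by apply: fordMr.
  by exists (a * vid v) => //; rewrite [RHS]/GRing.scale /= -mulrA vidM eqxx.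
Qed.

Lemma typed_sub N : typed N -> sub_mod N.
Proof.
move=> /(typed_embed m_gt0 Q_ns)[f f_inj]; apply: add_in; exists 1%N.
have g_lin a x y : (\row_(j < 1) (f (a *: x + y) : R)) =
    a *: (\row_j (f x : R)) + \row_j (f y : R).
  by apply/rowP => j; rewrite !mxE linearP.
exists (make_linear g_lin) => x y /rowP/(_ ord0); rewrite !mxE; exact: f_inj.
Qed.

(* For a path p of length s this is the projection of J^s onto R p. *)
Definition start_proj p r : R :=
  \sum_(q <- short Q m | (plen p <= plen q)%N && (ptake (plen p) q == p)) scal R (coef q r) * mon q.

Lemma coef_start_proj p q r : coef q (start_proj p r) =
  if (plen p <= plen q)%N && (ptake (plen p) q == p) then coef q r else 0.
Proof.
rewrite raddf_sum /= big_mkcond /=.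
have [lt|le] := ltnP (plen q) m; last first.
  rewrite big1 ?coef_long ?if_same // => q' _.
  by case: ifP => // _; rewrite coef_long.
rewrite (bigD1_seq q) ?mem_short ?short_uniq //= coef_scal coef_mon lt eqxx mulr1.
rewrite big1 ?addr0 // => q' /negbTE ne; rewrite coef_scal coef_mon ne andbF mulr0.
by rewrite if_same.
Qed.

Lemma start_proj_in p r : cyclic_set (mon p : R^o) (start_proj p r).
Proof.
exists (\sum_(q <- short Q m | (plen p <= plen q)%N && (ptake (plen p) q == p))
  scal R (coef q r) * mon (pdrop (plen p) q)).
rewrite [RHS]/GRing.scale /= mulr_suml; apply: eq_bigr => q /andP[_ /eqP e].
by rewrite [mon q](mon_cut pi (plen p)) e -mulrA.
Qed.

(** Left multiplication prolongs paths at their end, so it keeps their first arrows; paths shorter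
    than [p], which could be prolonged to ones starting with [p], do not occur in [r]. *)
Lemma start_proj_mul p a r : ford (plen p) r ->
  start_proj p (a * r) = a * start_proj p r.
Proof.
move=> rf; apply: (@coef_inj _ _ _ _ _ pres) => q; rewrite coef_start_proj.
have [lt|le] := ltnP (plen q) m; last by rewrite !coef_long ?if_same.
rewrite !coef_mul //; case: ifP => c.
  apply: eq_bigr => i _; rewrite coef_start_proj; case: ifP => // c'.
  have le : (i <= plen q)%N by rewrite -ltnS.
  have [lti|lei] := ltnP i (plen p); first by rewrite rf // plen_take.
  move: c'; rewrite plen_take // lei /=; move: c => /andP[_ /eqP c].
  by rewrite (_ : ptake _ _ = p) ?eqxx // -[RHS]c; apply: qpathP; rewrite // /parrows /= take_takel.
apply/esym/big1 => i _; rewrite coef_start_proj; case: ifP => [/andP[l1 /eqP e]|_]; last exact: mulr0.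
have le : (i <= plen q)%N by rewrite -ltnS.
move: c l1; rewrite plen_take // => c l1.
move: c; rewrite (leq_trans l1 le) /= (_ : ptake _ _ = p) ?eqxx //.
by rewrite -[RHS]e; apply: qpathP; rewrite // /parrows /= take_takel.
Qed.

Lemma start_projD p r r' : start_proj p (r + r') = start_proj p r + start_proj p r'.
Proof.
apply: (@coef_inj _ _ _ _ _ pres) => q; rewrite raddfD /= !coef_start_proj raddfD.
by case: ifP; rewrite ?addr0.
Qed.

Section SubmodulesOfFree.
Context (n : nat).

Definition row_supp M (f : M -> 'rV[R]_n) : {set seq_sub (short Q m) * 'I_n} :=
  [set t | `[< exists y, coef (ssval t.1) (f y ord0 t.2) <> 0 >]].

Lemma mem_row_supp M (f : M -> 'rV[R]_n) p j (pm : p \in short Q m) y :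
  coef p (f y ord0 j) <> 0 -> (SeqSub pm, j) \in row_supp f.
Proof. by move=> h; rewrite inE; apply/asboolP; exists y. Qed.

(* A path p of minimal length in the support of the embedding f gives a direct summand of M
   isomorphic to R p; its complement is the kernel of the composition of f with the projection
   onto R p, hence has smaller support. *)
Lemma sub_typed_aux d M (f : {linear M -> 'rV[R]_n}) : (#|row_supp f| <= d)%N ->
  injective f -> facsum typed (@id M).
Proof.
elim: d M f => [|d IHd] M f card_f f_inj.
  rewrite (_ : id = fun=> 0); first exact: facsum0.
  apply/funext => y; apply: f_inj; rewrite linear0; apply/rowP => j; rewrite mxE.
  apply: (@coef_inj _ _ _ _ _ pres) => p; rewrite raddf0; apply: contrapT => h.
  have [lt|le] := ltnP (plen p) m; last by apply: h; rewrite coef_long.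
  have pm : p \in short Q m by rewrite mem_short.
  move: card_f; rewrite leqn0 cards_eq0 => /eqP e.
  by have := mem_row_supp pm h; rewrite e inE.
have [M0|M0] := pselect (is_zero M).
  by rewrite (_ : id = fun=> 0); [apply: facsum0 | apply/funext].
have exP : exists s, `[< exists p j y, plen p = s /\ coef p (f y ord0 j) <> 0 >].
  apply: contrapT => h; apply: M0 => y; apply: f_inj; rewrite linear0; apply/rowP => j.
  rewrite mxE; apply: (@coef_inj _ _ _ _ _ pres) => p; rewrite raddf0; apply: contrapT => h'.
  by apply: h; exists (plen p); apply/asboolP; exists p, j, y.
have [s /asboolP[p [j [y [ps p0]]]] s_min] := ex_minnP exP.
have fs z i : ford s (f z ord0 i).
  move=> q lt; apply: contrapT => h; move: lt; rewrite ltnNge => /negP; apply; apply: s_min.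
  by apply/asboolP; exists q, i, z.
have lts : (s < m)%N by rewrite ltnNge; apply/negP => le; apply: p0; rewrite coef_long // ps.
(* The component of [y] at the end of [p]: its image keeps the coefficient at [p], and [x] can serve
   as the image of the generator of R p. *)
pose w := ptgt p; pose x := vid w *: y.
have tN : typed_gen w (m - s) (cyclic_gen (mon p : R^o)).
  apply: cyclic_typed_gen => a; apply: order_ann; first exact: vid_mon_mul.
  split; first by apply: ford_mon; rewrite ps.
  by exists p => //; rewrite coef_mon ps lts eqxx oner_eq0.
set N := cyclic_mod (mon p : R^o) in tN; set c := cyclic_gen _ in tN.
have N0 : ~ is_zero N.
  move=> /(_ c) /(congr1 val) /= /(congr1 (coef p)); rewrite raddf0 coef_mon ps lts eqxx.
  by move/eqP; rewrite oner_eq0.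
have tyN : typed N.
  by have [|l _ tl] := typed_gen_typed _ N0 tN; [apply: leq_subr | exists w, l, c].
pose g0 (z : M) : R^o := start_proj p (f z ord0 j).
have g_lin a z z' : g0 (a *: z + z') = a *: g0 z + g0 z'.
  rewrite /g0 linearP !mxE start_projD start_proj_mul //.
  by rewrite ps; apply: fs.
pose g : {linear M -> N} :=
  subm_lift (cyclic_submodule (mon p : R^o)) (f := make_linear g_lin)
    (fun z => start_proj_in p (f z ord0 j)).
(* Well defined because the entries of f x lie in J^s, which J^(m-s) annihilates. *)
have [h hE] : exists h : {linear N -> M}, forall a, h (a *: c) = a *: x.
  apply: (typed_gen_map tN) => a af; apply: f_inj; rewrite linear0; apply/rowP => i.
  rewrite /x scalerA linearZ !mxE; apply: (@ford_eq0 _ _ _ _ _ pres).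
  by apply: (@ford_le _ _ _ _ _ pres _ _ _ (eq_leq (esym (subnK (ltnW lts))))); apply: ford_mul.
have [r [rE vr rv]] := typed_hom (g \o h : {linear N -> N}) tN tN.
(* The coefficient of [r] at the lazy path is that of f y at [p], hence nonzero, so g h is an
   automorphism of R p. *)
have r0 : coef (lazy_path w) r != 0.
  have : coef p (val (g (h c))) = coef p (r * mon p).
    by have gh : g (h c) = r *: c := rE; rewrite gh.
  rewrite -[c]scale1r hE scale1r /= /linear_fun /g0 coef_start_proj leqnn ptake_len eqxx /=.
  rewrite /x linearZ mxE coef_vid_mul eqxx coef_mul_mon ?ps // leqnn -{1}ps ptake_len eqxx /=.
  by rewrite -{1}ps pdrop_len => <-; apply/eqP.
have [b [bK Kb]] := linear_inverse (typed_hom_bij m_gt0 tN tN rE vr rv r0).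
have sK : submodule [set z | g z = 0] by apply: (submodule_preim g (submodule0 N)).
have IH : facsum typed (@id (subm sK)).
  apply: (IHd _ (f \o subm_val sK : {linear subm sK -> 'rV[R]_n})); last first.
    by move=> z z' /= /f_inj e; apply: val_inj.
  rewrite -ltnS; apply: leq_trans card_f; apply: proper_card; apply/properP; split.
    apply/fintype.subsetP => -[[q qm] i]; rewrite !inE => /asboolP[z h0].
    by apply/asboolP; exists (val z).
  have pm : p \in short Q m by rewrite mem_short ps.
  exists (SeqSub pm, j); first exact: mem_row_supp p0.
  rewrite inE; apply/negP => /asboolP[z /= []].
  have := congr1 val (submP z : g (val z) = 0) => /= /(congr1 (coef p)).
  by rewrite raddf0 /= /linear_fun /g0 coef_start_proj leqnn ptake_len eqxx.
(* As b inverts g h, this is the component of z in the kernel of [g]; the other component h b g z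
   factors through R p. *)
have kK z : g (z - h (b (g z))) = 0 
  by have e : g (h (b (g z))) = g z := Kb (g z); rewrite linearB e subrr.
have k_lin a z z' : (a *: z + z') - h (b (g (a *: z + z'))) =
    a *: (z - h (b (g z))) + (z' - h (b (g z'))).
  by rewrite (linearP g) (linearP b) (linearP h) scalerBr opprD addrACA.
have := facsum_comp (subm_val sK) (subm_lift sK (f := make_linear k_lin) kK) IH.
move=> /(@facsumS _ _ _ _ N g (h \o b : {linear N -> M}) tyN).
rewrite (_ : (fun _ => _) = id) //; apply/funext => z.
by rewrite /= /linear_fun subrK.
Qed.

End SubmodulesOfFree.

Lemma sub_typed M : (exists n (f : {linear M -> 'rV[R]_n}), injective f) -> facsum typed (@id M).
Proof. by move=> [n [f f_inj]]; apply: (sub_typed_aux (f := f)). Qed.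

Lemma indecomposable_adr N : adr_mod N /\ indecomposable N <-> typed N.
Proof.
split=> [[aN iN]|tN]; last first.
  split; [exact: typed_adr | apply: local_indecomposable; exact: (typed_local m_gt0 tN)].
have [M tM iso] := add_closure_indecomposable (fun N' => @typed_local _ _ _ _ _ pres m_gt0 N')
  adr_typed aN iN.
by apply: typed_iso tM; apply: isomorphic_sym.
Qed.

Lemma indecomposable_sub N : sub_mod N /\ indecomposable N <-> typed N.
Proof.
split=> [[aN iN]|tN]; last first.
  split; [exact: typed_sub | apply: local_indecomposable; exact: (typed_local m_gt0 tN)].
have [M tM iso] := add_closure_indecomposable (fun N' => @typed_local _ _ _ _ _ pres m_gt0 N')
  sub_typed aN iN.
by apply: typed_iso tM; apply: isomorphic_sym.
Qed.

End Classification.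

(** * Dimension *)

Section Bases.
Context (k : fieldType) (R : algebra k).
Implicit Types (M N : lmodType R).

Definition lincomb M d (b : 'I_d -> M) (c : 'rV[k]_d) : M := \sum_i scal R (c ord0 i) *: b i.

Lemma basis_coords M d (b : 'I_d -> M) : is_basis b ->
  bijective (lincomb b).
Proof.
move=> bb; apply: inj_surj_bijective => [c c' e|y].
  have [c0 [_ c0u]] := bb (lincomb b c).
  have h (u : 'rV[k]_d) : lincomb b u = lincomb b c -> c0 = [ffun i => u ord0 i].
    move=> eu; apply: c0u; rewrite -eu; apply: eq_bigr => i _; by rewrite ffunE.
  apply/rowP => i; have := h c' (esym e); rewrite (h c erefl) => /ffunP/(_ i).
  by rewrite !ffunE.
have [c [-> _]] := bb y; exists (\row_i c i); apply: eq_bigr => i _.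
by rewrite mxE.
Qed.

Lemma lincomb_mul M N d d' (b : 'I_d -> M) (b' : 'I_d' -> N) (f : {linear M -> N})
    (B : 'M[k]_(d, d')) : (forall i, f (b i) = lincomb b' (row i B)) ->
  forall c, f (lincomb b c) = lincomb b' (c *m B).
Proof.
move=> h c; rewrite linear_sum /=.
transitivity (\sum_i \sum_j scal R (c ord0 i * B i j) *: b' j).
  apply: eq_bigr => i _; rewrite linearZ /= h scaler_sumr; apply: eq_bigr => j _.
  by rewrite scalerA -rmorphM mxE.
rewrite exchange_big; apply: eq_bigr => j _.
by rewrite mxE rmorph_sum -scaler_suml.
Qed.

Lemma basis_matrix M N d d' (b : 'I_d -> M) (b' : 'I_d' -> N) (f : {linear M -> N}) :
  is_basis b' -> exists B : 'M[k]_(d, d'), forall c, f (lincomb b c) = lincomb b' (c *m B).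
Proof.
move=> /basis_coords[g gK Kg]; exists (\matrix_i g (f (b i))).
by apply: lincomb_mul => i; rewrite rowK Kg.
Qed.

Lemma lincomb0 M d (b : 'I_d -> M) : lincomb b 0 = 0.
Proof. by rewrite /lincomb big1 // => i _; rewrite mxE rmorph0 scale0r. Qed.

Lemma basis_inj M N d d' (b : 'I_d -> M) (b' : 'I_d' -> N) (f : {linear M -> N}) :
  is_basis b -> is_basis b' -> injective f -> (d <= d')%N /\ (d = d' -> surj f).
Proof.
move=> bb bb' f_inj; have [B BE] := basis_matrix b f bb'.
have [bij bij'] := (basis_coords bb, basis_coords bb').
have fB : row_free B.
  apply: inj_row_free => c cB; apply: (bij_inj bij); rewrite lincomb0; apply: f_inj.
  by rewrite BE cB lincomb0 linear0.
have rB : \rank B = d by apply/eqP.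
split=> [|e y]; first by rewrite -rB rank_leq_col.
have /row_fullP[C CB] : row_full B by rewrite /row_full rB e.
have [g gK Kg] := bij'; exists (lincomb b (g y *m C)).
by rewrite BE -mulmxA CB mulmx1 Kg.
Qed.

Lemma basis_surj M N d d' (b : 'I_d -> M) (b' : 'I_d' -> N) (f : {linear M -> N}) :
  is_basis b -> is_basis b' -> surj f -> (d' <= d)%N /\ (d = d' -> injective f).
Proof.
move=> bb bb' f_surj; have [B BE] := basis_matrix b f bb'.
have [[g gK Kg] bij'] := (basis_coords bb, basis_coords bb').
have h (c' : 'rV[k]_d') : exists c, c *m B = c'.
  have [y fy] := f_surj (lincomb b' c'); exists (g y).
  by apply: (bij_inj bij'); rewrite -BE Kg.
have fB : row_full B.
  apply/row_fullP; exists (\matrix_i sval (cid (h (row i 1%:M)))).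
  by apply/row_matrixP => i; rewrite row_mul rowK; case: cid.
have rB : \rank B = d' by apply/eqP.
split=> [|e]; first by rewrite -rB rank_leq_row.
have fB' : row_free B by rewrite /row_free rB e.
apply: linear_inj => y; rewrite -[y]Kg BE -(lincomb0 b') => /(bij_inj bij') h0.
by rewrite (row_free_inj fB' (etrans h0 (esym (mul0mx _ _)))) lincomb0.
Qed.

Lemma dim_basis M d (b : 'I_d -> M) : is_basis b -> Defs.dim M = d.
Proof.
move=> bb; rewrite /Defs.dim; case: xgetP => [d' _ [b' bb']|/(_ d)[]]; last by exists b.
have id_inj : injective (idfun : {linear M -> M}) by [].
apply/eqP; rewrite eqn_leq (basis_inj bb' bb id_inj).1.
by rewrite (basis_inj bb bb' id_inj).1.
Qed.

Lemma dim_inj M N (f : {linear M -> N}) :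
  finite_dimensional M -> finite_dimensional N -> injective f ->
  (Defs.dim M <= Defs.dim N)%N /\ (Defs.dim M = Defs.dim N -> surj f).
Proof.
move=> [d [b bb]] [d' [b' bb']] f_inj; rewrite (dim_basis bb) (dim_basis bb').
exact: (basis_inj bb bb').
Qed.

Lemma dim_surj M N (f : {linear M -> N}) :
  finite_dimensional M -> finite_dimensional N -> surj f ->
  (Defs.dim N <= Defs.dim M)%N /\ (Defs.dim M = Defs.dim N -> injective f).
Proof.
move=> [d [b bb]] [d' [b' bb']] f_surj; rewrite (dim_basis bb) (dim_basis bb').
exact: (basis_surj bb bb').
Qed.

End Bases.

(** * Homomorphisms between the modules R e_v / J^l e_v *)

Section Properties.
Context (k : fieldType) (Q : quiver) (m : nat) (R : algebra k).
Context (pi : {rmorphism path_algebra k Q -> R}).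
Hypothesis pres : presents pi (ideal_pow (arrow_ideal k Q) m).
Hypothesis m_gt0 : (0 < m)%N.
Hypothesis Q_ns : no_sources Q.
Implicit Types (p q : qpath Q) (v w : vertex Q) (a b r : R) (s l n : nat).
Implicit Types (N M : lmodType R).
Local Notation coef := (coef pres).
Local Notation mon := (mon pi).
Local Notation vid := (vid pi).
Local Notation ford := (ford pres).
Local Notation typed := (typed pres).
Local Notation typed_at := (typed_at pres).
Local Notation typed_gen := (typed_gen pres).

(** Serves both for [R], with all paths of length below m, and for R e_v / J^l e_v, with the paths
    of length below l that start at v. *)
Lemma path_basis M (x : M) (s : seq (qpath Q)) : uniq s -> {subset s <= short Q m} ->
  (forall y, exists a, y = a *: x) ->
  (forall a, a *: x = 0 <-> forall p, p \in s -> coef p a = 0) ->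
  is_basis (fun i : 'I_(size s) => mon (tnth (in_tuple s) i) *: x).
Proof.
move=> s_uniq s_short gx ax; set t := in_tuple s.
pose cb (c : {ffun 'I_(size s) -> k}) := \sum_i scal R (c i) * mon (tnth t i).
have cbE (c : {ffun 'I_(size s) -> k}) : \sum_i scal R (c i) *: (mon (tnth t i) *: x) = cb c *: x.
  by rewrite scaler_suml; apply: eq_bigr => i _; rewrite scalerA.
have cb_coef c i : coef (tnth t i) (cb c) = c i.
  have ts j : tnth t j \in s by apply: (mem_tnth j t).
  rewrite raddf_sum /= (bigD1 i) //= coef_scal coef_mon eqxx.
  rewrite -mem_short (s_short _ (ts i)) mulr1 big1 ?addr0 // => j ne.
  by rewrite coef_scal coef_mon (inj_eq (tuple_uniqP t s_uniq)) (negbTE ne) andbF mulr0.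
have key (c : {ffun 'I_(size s) -> k}) a : a *: x = cb c *: x <-> forall i, c i = coef (tnth t i) a.
  have -> : (a *: x = cb c *: x) <-> ((a - cb c) *: x = 0).
    rewrite scalerBl; split=> [->|/eqP]; first by rewrite subrr.
    by rewrite subr_eq0 => /eqP.
  rewrite ax; split=> [h i|h p ps].
    have := h _ (mem_tnth i t); rewrite raddfB /= cb_coef => /eqP.
    by rewrite subr_eq0 => /eqP.
  have /tnthP[i ->] : p \in t by [].
  by rewrite raddfB /= cb_coef h subrr.
move=> y; have [a ->] := gx y; exists [ffun i => coef (tnth t i) a].
split=> [|c]; first by rewrite cbE; apply/key => i; rewrite ffunE.
by rewrite cbE => /key h; apply/ffunP => i; rewrite ffunE h.
Qed.

Lemma finite_dimensional_regular : finite_dimensional (R^o : lmodType R).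
Proof.
do 2!eexists; apply: (@path_basis R^o 1 (short Q m)) => // [|y|a].
- exact: short_uniq.
- by exists y; rewrite [RHS]mulr1.
rewrite [_ *: _]mulr1; split=> [-> p _|h]; first by rewrite raddf0.
apply: (@coef_inj _ _ _ _ _ pres) => p; rewrite raddf0.
by have [|/coef_long->//] := ltnP (plen p) m; rewrite -mem_short => /h.
Qed.

Lemma finite_dimensional_typed N : typed N -> finite_dimensional N.
Proof.
move=> [v [l [x [[gx ax] /andP[_ lm] _]]]].
do 2!eexists; apply: (@path_basis N x [seq p <- short Q m | (psrc p == v) && (plen p < l)%N]).
- exact/filter_uniq/short_uniq.
- by move=> p; rewrite mem_filter => /andP[].
- exact: gx.
move=> a; rewrite ax; split=> [h p|h p lt].
  rewrite mem_filter => /andP[/andP[/eqP sp lt] _].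
  by have := h p lt; rewrite coef_mul_vid sp eqxx.
rewrite coef_mul_vid; case: eqP => // sp; apply: h.
by rewrite mem_filter sp eqxx lt mem_short (leq_trans lt).
Qed.

Lemma monomial_truncated : monomial_algebra pi.
Proof.
exists [set p | (m <= plen p)%N]; have [h1 h2 h3] := pres; split=> // x; rewrite h3 ideal_pow_arrow.
split=> [x0|].
  rewrite [x]path_algebraE big_seq; apply: ideal_sum => [|p px]; first exact: ideal_gen_ideal.
  have [_ _ hI] := ideal_gen_ideal [set pvec k p | p in [set p : qpath Q | (m <= plen p)%N]].
  rewrite -[X in ideal_gen _ X]mulr1; apply: hI; apply: sub_ideal_gen; exists p => //=.
  by rewrite leqNgt; apply: contraTN px => lt; rewrite -mcoeff_eq0 x0.
apply; first exact: lowfree_ideal.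
move=> _ [p /= le <-] q lt; rewrite [LHS]mcoeff_pvec; case: eqP => // e.
by rewrite -e ltnNge le in lt.
Qed.

Lemma epimorphic_zero (x : R) : epimorphic (left_ideal x) (left_ideal (0 : R)).
Proof.
exists (fun=> 0); split; first by move=> a y z _ _; rewrite scaler0 addr0.
rewrite predeqE => y; split=> [[z _ <-]|[r ->]]; first by exists 0; rewrite mul0r.
by exists 0; [exists 0; rewrite mul0r | rewrite mulr0].
Qed.

(** By [order_ann], a monomial ending at v is annihilated by [a] exactly when a e_v lies in J^(m -
    length). These conditions are nested, so the shorter monomial maps onto the longer. *)
Lemma epimorphic_mon p q : (plen p <= plen q < m)%N -> ptgt p = ptgt q ->
  epimorphic (left_ideal (mon p)) (left_ideal (mon q)).
Proof.
move=> /andP[le lt] e; have ltp := leq_ltn_trans le lt.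
have ann p' : (plen p' < m)%N -> forall a, a * mon p' = 0 <-> ford (m - plen p') (a * vid (ptgt p')).
  move=> lt' a; apply: order_ann; first exact: vid_mon_mul.
  split; first exact: ford_mon.
  by exists p' => //; rewrite coef_mon lt' eqxx oner_eq0.
pose S := cyclic_submodule (mon p : R^o).
have [||f fE] := @cyclic_linear R (subm S) R^o (cyclic_gen (mon p : R^o)) (mon q).
- by move=> y; have [a ea] := submP y; exists a; apply: val_inj; rewrite /= ea.
- move=> a /(congr1 val) /= /(ann p ltp) h; apply/(ann q lt); rewrite -e.
  by apply: ford_le h; apply: leq_sub2l.
pose g (x : R^o) : R^o := if pselect (cyclic_set (mon p : R^o) x) is left Sx
  then f (subm_mk S Sx) else 0.
have gE x (Sx : cyclic_set (mon p : R^o) x) : g x = f (subm_mk S Sx).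
  by rewrite /g; case: pselect => // Sx'; congr (f _); apply: val_inj.
have gM a : g (a * mon p) = a * mon q.
  have Sx : cyclic_set (mon p : R^o) (a * mon p) by exists a.
  by rewrite (gE _ Sx) -[RHS]fE; congr (f _); apply: val_inj.
exists g; split=> [a _ _ [b ->] [c ->]|].
  have -> : a *: (b * mon p : R^o) + (c * mon p : R^o) = (a * b + c) * mon p.
    by rewrite mulrDl -mulrA.
  by rewrite !gM mulrDl -mulrA.
rewrite predeqE => y; split=> [[_ [a ->] <-]|[a ->]]; first by exists a; rewrite gM.
by exists (a * mon p); [exists a | rewrite gM].
Qed.

Lemma ideally_ordered_truncated : ideally_ordered pi.
Proof.
split; [exact: monomial_truncated | exact: finite_dimensional_regular |].
move=> e _ _ pe [p ->] [q ->] [r pr] [r' qr'].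
have [v [u [u' [uu' u'u u1 eE]]]] := primitive_conj pres m_gt0 pe.
have ee : e * e = e by case: pe.
(* All nonzero monomials in e R end at the same vertex [v]: the element u' p' lies in e_v R and, as
   u' is 1 modulo J, still has coefficient 1 at p'. *)
have tgt p' x : mon p' = e * x -> mon p' = 0 \/ (plen p' < m)%N /\ ptgt p' = v.
  move=> ex; have [lt|le] := ltnP (plen p') m; [right | left]; last first.
    by apply: (@ford_eq0 _ _ _ _ _ pres); apply: ford_mon.
  split=> //; have h : u' * mon p' = vid v * (u' * mon p').
    have u'e : u' * e = vid v * u' by rewrite eE !mulrA u'u mul1r.
    by rewrite ex !mulrA -[vid v * u' * e]mulrA u'e mulrA vidM eqxx.
  have c1 : coef p' (u' * mon p') = 1.
    have -> : u' = (u' - 1) + 1 by rewrite subrK.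
    rewrite mulrDl mul1r raddfD /= (@ford_mul _ _ _ _ _ pres _ _ _ _ u1 (ford_mon pres (leqnn _))) //.
    by rewrite add0r coef_mon lt eqxx.
  by move: c1; rewrite h coef_vid_mul; case: eqP => // _ /esym/eqP; rewrite oner_eq0.
have [p0|[ltp tp]] := tgt p r pr; first by right; rewrite -[pi (pvec k p)]/(mon p) p0; apply: epimorphic_zero.
have [q0|[ltq tq]] := tgt q r' qr'; first by left; rewrite -[pi (pvec k q)]/(mon q) q0; apply: epimorphic_zero.
have [le|/ltnW le] := leqP (plen p) (plen q); [left | right]; apply: epimorphic_mon.
- by rewrite le.
- by rewrite tp tq.
- by rewrite le.
- by rewrite tp tq.
Qed.

(* If f x were in J x', then f would kill the nonzero layer J^(l-1) x for l = l'. *)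
Lemma typed_inj_loewy v l w l' N M (x : N) (x' : M) (f : {linear N -> M}) :
  typed_at v l x -> typed_at w l' x' -> injective f ->
  (l <= l')%N /\ (l = l' -> v = w /\ bijective f).
Proof.
move=> [tg /andP[l0 lm] [p [sp lp]]] [tg' _ _] f_inj.
have px0 : mon p *: x <> 0.
  move/tg.2; rewrite -sp mon_vid_mul => /(_ p); rewrite lp ltn_predL l0 => /(_ isT)/eqP.
  by rewrite coef_mon lp eqxx andbT -ltnS prednK // ltnS lm oner_eq0.
have [r [fx vr rv]] := typed_hom f tg tg'.
have fpx : f (mon p *: x) = (mon p * r) *: x' by rewrite linearZ /= fx scalerA.
have fmp : ford l.-1 (mon p) by apply: ford_mon; rewrite lp.
have nf : ~ ford l' (mon p * r).
  move=> h; apply: px0; apply: f_inj; rewrite linear0 fpx; apply/tg'.2.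
  exact: fordMr.
split=> [|e].
  rewrite leqNgt; apply/negP => lt; apply: nf; apply: fordMr; apply: ford_le fmp.
  by rewrite -ltnS prednK.
have [r0|r0] := eqVneq (coef (lazy_path w) r) 0.
  case: nf; apply: (@ford_le _ _ _ _ _ pres _ (l.-1 + 1)); first by rewrite addn1 prednK // e.
  apply: ford_mul => //; apply/asboolP/ford1P => u.
  rewrite -rv coef_mul_vid /psrc /=; case: eqP => // ->; exact: r0.
have [vw f_surj] := typed_hom_surj m_gt0 tg' fx vr rv r0.
by split=> //; apply: inj_surj_bijective.
Qed.

Lemma typed_at_uniq v l w l' N (x x' : N) : typed_at v l x -> typed_at w l' x' -> v = w /\ l = l'.
Proof.
move=> tx tx'; have id_inj : injective (idfun : {linear N -> N}) by [].
have [le h] := typed_inj_loewy tx tx' id_inj.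
have [le' _] := typed_inj_loewy tx' tx id_inj.
have e : l = l' by apply/eqP; rewrite eqn_leq le.
by split=> //; have [] := h e.
Qed.

Lemma typed_list : exists (I : finType) (N : I -> lmodType R),
  [/\ forall i, typed (N i), forall X, typed X -> exists i, isomorphic X (N i) &
      forall i j, isomorphic (N i) (N j) -> i = j].
Proof.
(* The pair (v, n) stands for R e_v / J^(n+1) e_v, so its second component is the Loewy length minus
   1. *)
pose I : finType := {x : vertex Q * 'I_m | `[< path_from x.1 x.2 >]}.
have ex (i : I) : exists p, typed_at (val i).1 (val i).2.+1 (cyclic_gen (mon p : R^o)).
  have lt : (0 < (val i).2.+1 <= m)%N by rewrite ltn_ord.
  have [p [_ _ tp]] := typed_canonical pres m_gt0 Q_ns lt (asboolW (valP i)).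
  by exists p.
exists I, (fun i => cyclic_mod (mon (sval (cid (ex i))) : R^o)); split=> [i|X [v [l [x tx]]]|i j].
- by case: cid => p tp; exists (val i).1, (val i).2.+1, (cyclic_gen (mon p : R^o)).
- have [tg /andP[l0 lm] pf] := tx.
  have lt : (l.-1 < m)%N by rewrite prednK.
  have pf' : `[< path_from (v, Ordinal lt).1 (v, Ordinal lt).2 >] by apply/asboolP.
  exists (exist (fun x : vertex Q * 'I_m => `[< path_from x.1 x.2 >]) (v, Ordinal lt) pf').
  case: cid => p /= [tp _ _]; move: tp; rewrite (prednK l0) => tp.
  exact: typed_gen_iso tg tp.
- case: cid => p [tp lp pp]; case: cid => q tq [f bf].
  have tf := typed_gen_transfer bf tp.
  have [e1 e2] := typed_at_uniq (And3 tf lp pp) tq.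
  apply: val_inj; case: (val i) (val j) e1 e2 => [v a] [w b] /= -> [e].
  by congr (_, _); apply: val_inj.
Qed.

Lemma indecomposables_typed (C : lmodType R -> Prop) :
  (forall N, C N /\ indecomposable N <-> typed N) ->
  forall (I : finType) (N : I -> lmodType R), indecomposables_of C N <->
  [/\ forall i, typed (N i), forall X, typed X -> exists i, isomorphic X (N i) &
      forall i j, isomorphic (N i) (N j) -> i = j].
Proof.
move=> CP I N; split=> -[h1 h2 h3]; split=> //.
- by move=> i; apply/CP/h1.
- by move=> X /CP[]; apply: h2.
- by move=> i; apply/CP/h1.
- by move=> X CX iX; apply: h2; apply/CP.
Qed.

(* The image of f is a cyclic submodule of R, as M embeds in R. *)
Lemma typed_image N M (f : {linear N -> M}) : typed N -> typed M -> ~ (forall x, f x = 0) ->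
  exists (T : lmodType R) (c : {linear N -> T}) (d : {linear T -> M}),
    [/\ typed T, surj c, injective d & forall x, f x = d (c x)].
Proof.
move=> [v [l [x [tg lm pf]]]] tM f0; have [i i_inj] := typed_embed m_gt0 Q_ns tM.
have x0 : f x <> 0.
  by move=> e; apply: f0 => y; have [a ->] := tg.1 y; rewrite linearZ /= e scaler0.
pose u : R := i (f x).
have u0 : u <> 0 by move=> e; apply: x0; apply: i_inj; rewrite linear0.
have vu : vid v * u = u.
  by rewrite -[LHS]/(vid v *: (i (f x) : R^o)) -!linearZ (typed_gen_vid tg).
have [s lts us] := order_ex pres u0.
have tT : typed_gen v (m - s) (cyclic_gen (f x)).
  apply: cyclic_typed_gen => a; rewrite -(order_ann a vu us).
  have <- : i (a *: f x) = a * u by rewrite linearZ.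
  by split=> [->|e]; [apply: linear0 | apply: i_inj; rewrite linear0].
have T0 : ~ is_zero (cyclic_mod (f x)).
  by move=> /(_ (cyclic_gen (f x))) /(congr1 val).
have fc y : cyclic_set (f x) (f y).
  by have [a ->] := tg.1 y; exists a; rewrite linearZ.
exists (cyclic_mod (f x)), (subm_lift (cyclic_submodule (f x)) fc), (subm_val _); split=> //.
- by have [|l' _ tl] := typed_gen_typed _ T0 tT; [apply: leq_subr | exists v, l', (cyclic_gen (f x))].
- move=> z; have [a ez] := submP z; exists (a *: x); apply: val_inj.
  by rewrite ez /= linearZ.
- by move=> z z' /= e; apply: val_inj.
Qed.

(* The witness y is a nonzero element of the last radical layer J^(l-1) x. *)
Lemma typed_test_element N : typed N -> exists2 y : N, y <> 0 &
  forall M (f : {linear N -> M}), typed M -> f y <> 0 -> injective f.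
Proof.
move=> [v [l [x [tg /andP[l0 lm] [p [sp lp]]]]]]; exists (mon p *: x).
  move/tg.2; rewrite -sp mon_vid_mul => /(_ p); rewrite lp ltn_predL l0 => /(_ isT)/eqP.
  by rewrite coef_mon lp eqxx andbT -ltnS prednK // ltnS lm oner_eq0.
move=> M f tM fy0; have [i i_inj] := typed_embed m_gt0 Q_ns tM.
pose u : R := i (f x).
have uE a : i (f (a *: x)) = a * u by rewrite !linearZ.
have u0 : u <> 0.
  by move=> e; apply: fy0; apply: i_inj; rewrite linear0 uE e mulr0.
have vu : vid v * u = u by rewrite -uE (typed_gen_vid tg).
have [s lts us] := order_ex pres u0.
(* If m - s were at most l - 1, the path [p] of length l - 1 would annihilate [u]. *)
have le : (l <= m - s)%N.
  rewrite leqNgt; apply/negP => lt; apply: fy0; apply: i_inj; rewrite linear0 uE.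
  apply/(order_ann _ vu us)/fordMr/ford_mon; by rewrite lp -ltnS prednK.
apply: linear_inj => y; have [a ->] := tg.1 y => /(congr1 i); rewrite linear0 uE.
by move=> /(order_ann _ vu us) h; apply/tg.2; apply: ford_le h.
Qed.

End Properties.

(** * Modules over endomorphism rings *)

Section DirectSumMaps.
Context (A : pzRingType) (I : finType) (N : I -> lmodType A).
Implicit Types (i j : I).

Fact dsum_in_linear j a (x y : N j) :
  ([ffun i => dfwith (fun i => 0 : N i) (a *: x + y) i] : dsum N) =
  a *: ([ffun i => dfwith (fun i => 0 : N i) x i] : dsum N) +
    ([ffun i => dfwith (fun i => 0 : N i) y i] : dsum N).
Proof.
apply/ffunP => i; rewrite !ffunE; have [<-|ne] := eqVneq j i.
  by rewrite !dfwith_in.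
by rewrite !dfwith_out // scaler0 addr0.
Qed.
Definition dsum_in j : {linear N j -> dsum N} := make_linear (@dsum_in_linear j).

Fact dsum_out_linear j a (x y : dsum N) : (a *: x + y) j = a *: x j + y j.
Proof. by rewrite !ffunE. Qed.
Definition dsum_out j : {linear dsum N -> N j} := make_linear (dsum_out_linear j).

Lemma dsum_inK j : cancel (dsum_in j) (dsum_out j).
Proof. by move=> x; rewrite /= /linear_fun ffunE dfwith_in. Qed.

Lemma dsum_in_out (x : dsum N) : x = \sum_j dsum_in j (x j).
Proof.
have sumE (F : I -> dsum N) i : (\sum_j F j) i = \sum_j F j i.
  exact: (linear_sum (dsum_out i)).
apply/ffunP => i; rewrite sumE (bigD1 i) //= /linear_fun ffunE dfwith_in.
by rewrite big1 ?addr0 // => j ne; rewrite ffunE dfwith_out.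
Qed.

End DirectSumMaps.

Section EndModule.
Context (A : pzRingType) (M : lmodType A).

(** A copy of [M] under another name, carrying the action of End M in place of that of [A]. *)
Definition emod : Type := Eval cbv beta delta [reverse_coercion] in M.
HB.instance Definition _ := GRing.Zmodule.on emod.
Definition emod_scale (f : End M) (x : emod) : emod := (f : {linear M -> M}) x.

Fact emod_scaleA f g x : emod_scale f (emod_scale g x) = emod_scale (f * g) x.
Proof. by []. Qed.
Fact emod_scale1 : left_id 1 emod_scale.
Proof. by []. Qed.
Fact emod_scaleDr : right_distributive emod_scale +%R.
Proof. by move=> f x y; apply: (linearD (f : {linear M -> M})). Qed.
Fact emod_scaleDl x : {morph emod_scale^~ x : f g / f + g}.
Proof. by []. Qed.
HB.instance Definition _ := GRing.Zmodule_isLmodule.Build (End M) emod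
  emod_scaleA emod_scale1 emod_scaleDr emod_scaleDl.

End EndModule.

Lemma linear_factor (A : pzRingType) (P D X : lmodType A) (f : {linear P -> D}) (g : {linear P -> X}) :
  surj f -> (forall a, f a = 0 -> g a = 0) -> exists h : {linear D -> X}, forall x, g x = h (f x).
Proof.
move=> f_surj fg; pose h y := g (sval (cid (f_surj y))).
have hE x : h (f x) = g x.
  rewrite /h; case: cid => x' /= e; apply/eqP; rewrite -subr_eq0 -linearB; apply/eqP/fg.
  by rewrite linearB e subrr.
have h_lin a y z : h (a *: y + z) = a *: h y + h z.
  have [u <-] := f_surj y; have [u' <-] := f_surj z.
  by rewrite -linearP !hE linearP.
by exists (make_linear h_lin).
Qed.

Section SimpleSubquotient.
Context (A : pzRingType) (M T : lmodType A) (U V : set M) (g : M -> T).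
Hypotheses (sU : submodule U) (UV : maximal_submodule U V) (g_lin : linear_on U g).
Hypotheses (g_im : g @` U = [set: T]) (gV : forall x, U x -> (g x = 0 <-> V x)).

(** The elements of [U] whose image is a multiple of [t] form a submodule between [V] and [U], which
    is not [V] because [t] is nonzero. *)
Lemma subquotient_simple (t t' : T) : t <> 0 -> exists a, t' = a *: t.
Proof.
move=> t0; have [sV VU _ Vmax] := UV.
have [x Ux gx] : (g @` U) t by rewrite g_im.
pose W := [set z | U z /\ exists a, g z = a *: t].
have sW : submodule W.
  split; first by split; [case: sU | exists 0; rewrite scale0r (linear_on0 sU g_lin)].
  move=> a y z [Uy [b gy]] [Uz [c gz]]; split; first by have [_ h] := sU; apply: h.
  by exists (a * b + c); rewrite g_lin // gy gz scalerDl scalerA.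
have [||WV|WU] := Vmax W sW.
- by move=> z Vz; split; [apply: VU | exists 0; rewrite scale0r; apply/gV => //; apply: VU].
- by move=> z [].
- have Wx : W x by split=> //; exists 1; rewrite scale1r.
  by case: t0; rewrite -gx; apply/(gV Ux); rewrite -WV.
have [y Uy gy] : (g @` U) t' by rewrite g_im.
by have [_ [a e]] : W y; [rewrite WU | exists a; rewrite -gy].
Qed.

End SimpleSubquotient.

Section Chains.
Context (k : fieldType) (R : algebra k) (M : lmodType R) (T : finType) (b : T -> M).
Hypothesis b_span : forall y, exists c : T -> k, y = \sum_t scal R (c t) *: b t.

(* Elements of the successive differences of a chain are linearly independent over k. *)
Lemma emod_length : @length_le (end_algebra M) (emod M) #|T|.
Proof.
move=> n F [sF cF]; rewrite leqNgt; apply/negP => lt.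
have scF i (c : k) (x : M) : (i <= n)%N -> F i x -> F i (scal R c *: x).
  move=> le Fx; exact: (@submoduleZ (end_algebra M) (emod M) (F i) (scal (end_algebra M) c) x (sF i le) Fx).
have monoF i j : (i <= j)%N -> (j <= n)%N -> F i `<=` F j.
  elim: j => [|j IHj]; first by rewrite leqn0 => /eqP-> _ x.
  rewrite leq_eqVlt => /predU1P[->_ x//|lti] ltj; apply: (@subset_trans _ (F j)).
    by apply: IHj => //; apply: ltnW.
  by case: (cF j ltj).
have ex (i : 'I_n) : exists x, F i.+1 x /\ ~ F i x.
  have [_ /existsNP[x /not_implyP[]]] := cF i (ltn_ord i).
  by exists x.
pose x i : M := sval (cid (ex i)); have xP (i : 'I_n) : F i.+1 (x i) /\ ~ F i (x i) by rewrite /x; case: cid.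
pose c i := sval (cid (b_span (x i))).
have cE i : x i = \sum_t scal R (c i t) *: b t by rewrite /c; case: cid.
pose B : 'M[k]_(n, #|T|) := \matrix_(i, j) c i (enum_val j).
have nB : ~~ row_free B by rewrite -row_leq_rank -ltnNge (leq_ltn_trans (rank_leq_col B)).
have [u [uB u0]] : exists u : 'rV[k]_n, u *m B = 0 /\ u <> 0.
  apply: contrapT => h; move/negP: nB; apply; apply: inj_row_free => u uB.
  by apply: contrapT => u0; apply: h; exists u.
have sum0 : \sum_i scal R (u ord0 i) *: x i = 0.
  under eq_bigr => i _ do rewrite cE scaler_sumr.
  rewrite exchange_big big1 //= => t _.
  under eq_bigr => i _ do rewrite scalerA -rmorphM.
  rewrite -scaler_suml -rmorph_sum /=.
  have -> : \sum_i u ord0 i * c i t = (u *m B) ord0 (enum_rank t).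
    by rewrite mxE; apply: eq_bigr => i _; rewrite mxE enum_rankK.
  by rewrite uB mxE rmorph0 scale0r.
have [i0 ui0] : exists i, u ord0 i != 0.
  apply: contrapT => h; apply: u0; apply/rowP => i; rewrite mxE; apply/eqP.
  by apply: contrapT => /negP h'; apply: h; exists i.
(* Solving the relation for the term of largest index expresses x i by elements of F i, against the
   choice of x i. *)
have [i ui i_max] := @arg_maxnP _ i0 (fun i => u ord0 i != 0) (fun i => val i) ui0.
have [_] := xP i; apply.
have -> : x i = scal R (- (u ord0 i)^-1) *: (\sum_(j | j != i) scal R (u ord0 j) *: x j).
  have := sum0; rewrite (bigD1 i) //= => /eqP; rewrite addr_eq0 => /eqP e.
  rewrite rmorphN scaleNr -scalerN -e scalerA -rmorphM mulVf //.
  by rewrite rmorph1 scale1r.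
have le : (i <= n)%N by apply: ltnW.
apply: (scF) => //; apply: (@submodule_sum (end_algebra M) (emod M) (F i) _ _ _
  (fun j => scal R (u ord0 j) *: x j : M) (sF i le)) => j ji.
have [->|uj] := eqVneq (u ord0 j) 0.
  by rewrite rmorph0 scale0r; case: (sF i le).
have lej : (j <= i)%N by apply: i_max.
apply: scF => //; have [Fj _] := xP j; apply: monoF Fj => //.
by rewrite ltn_neqAle lej andbT.
Qed.

End Chains.

(** * Standard modules *)

Section Projectives.
Context (k : fieldType) (R : algebra k) (I : finType) (N : I -> lmodType R).
Hypothesis N_local : forall i, local_end (N i).
Hypothesis N_uniq : forall i j, isomorphic (N i) (N j) -> i = j.
Implicit Types (i j : I).
Local Notation M := (dsum N).
Local Notation E := (end_algebra (dsum N)).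

Definition hom_of j (a : proj N j) : {linear N j -> M} := a.
Definition of_hom j (a : {linear N j -> M}) : proj N j := a.
Definition end_of (f : {linear M -> M}) : E := f.
Definition eps j : E := end_of (dsum_in N j \o dsum_out N j).

Lemma hom_eq j (a b : proj N j) : (forall x, hom_of a x = hom_of b x) -> a = b.
Proof. exact: homP. Qed.

Lemma eps_sum : \sum_j eps j = 1 :> E.
Proof.
have sumE (F : I -> E) (x : M) : ((\sum_j F j : E) : {linear M -> M}) x =
    \sum_j (F j : {linear M -> M}) x.
  exact: (big_morph (fun f : E => (f : {linear M -> M}) x) (fun f g => erefl) erefl).
apply: homP => x; rewrite sumE [RHS]dsum_in_out.
by apply: eq_bigr.
Qed.

Lemma eps_mod (X : lmodType E) (x : X) : x = \sum_j eps j *: x.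
Proof. by rewrite -scaler_suml eps_sum scale1r. Qed.

Lemma eps_mod_neq (X : lmodType E) (V : set X) (x : X) : submodule V -> ~ V x ->
  exists j, ~ V (eps j *: x).
Proof.
move=> sV Vx; apply: contrapT => h; apply: Vx; rewrite (eps_mod x).
by apply: submodule_sum => // j _; apply: contrapT => h'; apply: h; exists j.
Qed.

(* The non-split homomorphisms; as N j has a local endomorphism ring, they form
   the largest proper submodule of P j. *)
Definition nonsplit j : set (proj N j) :=
  [set a | forall b : {linear M -> N j}, ~ bijective (b \o hom_of a)].
Arguments nonsplit : clear implicits.

(** If a combination f a + a' splits, the identity of N j is a sum of an endomorphism through [a]
    and one through [a']; by locality one of them is bijective. *)
Lemma nonsplit_submodule j : submodule (nonsplit j).
Proof.
have [N0 Nloc] := N_local j; split=> [b bij|f a a' ha ha' b bij].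
  apply: N0 => x; exact: (bij_inj bij (erefl (b 0))).
have [g [gK Kg]] := linear_inverse bij.
pose h1 : {linear N j -> N j} := (g \o b) \o ((f : End M) : {linear M -> M}) \o hom_of a.
pose h2 : {linear N j -> N j} := (g \o b) \o hom_of a'.
have h12 x : h1 x + h2 x = x by rewrite -[RHS]gK /= -linearD -linearD.
have [h1b|h1b] := Nloc h1.
  apply: (ha (b \o ((f : End M) : {linear M -> M}) : {linear M -> N j})).
  apply: (@eq_bij _ _ (fun x => (b \o hom_of (f *: a + a' : proj N j)) (h1 x))).
    by apply: bij_comp bij h1b.
  by move=> x; exact: (Kg _).
apply: (ha' b).
apply: (@eq_bij _ _ (fun x => (b \o hom_of (f *: a + a' : proj N j)) (x - h1 x))).
  by apply: bij_comp bij h1b.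
move=> x; have -> : x - h1 x = h2 x by rewrite -{1}(h12 x) addrC addKr.
exact: (Kg _).
Qed.

(** A split map generates P j: composing it with a left inverse and then with any c gives c. *)
Lemma proper_nonsplit j (V : set (proj N j)) : submodule V -> V <> setT -> V `<=` nonsplit j.
Proof.
move=> sV VT a Va b bij; apply: VT; rewrite predeqE => c; split=> // _.
have [g [gK Kg]] := linear_inverse bij.
have -> : c = end_of (hom_of c \o (g \o b)) *: a.
  by apply: hom_eq => x; exact: (congr1 (hom_of c) (esym (gK x))).
exact: submoduleZ.
Qed.

Lemma dsum_in_split j : ~ nonsplit j (of_hom (dsum_in N j)).
Proof.
move/(_ (dsum_out N j)); apply; exists id => x; exact: dsum_inK.
Qed.

Lemma nonsplit_neqT j : nonsplit j <> setT.
Proof. by move=> e; apply: (@dsum_in_split j); rewrite e. Qed.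

Lemma rad_proj j : Defs.rad [set: proj N j] = nonsplit j.
Proof.
have sN := @nonsplit_submodule j; rewrite eqEsubset; split=> [a [_]|a ha].
  apply; split=> //; first exact: nonsplit_neqT.
  move=> W sW NW _; have [WT|WT] := pselect (W = setT); first by right.
  by left; rewrite eqEsubset; split=> //; apply: proper_nonsplit.
split=> // V [sV _ VT Vmax].
by have [<-//|e] := Vmax _ sN (proper_nonsplit sV VT) (@subsetT _ _); case: (nonsplit_neqT e).
Qed.

Lemma simple_top j (T : lmodType E) (h : {linear proj N j -> T}) :
  (forall t t' : T, t <> 0 -> exists f, t' = f *: t) -> h (of_hom (dsum_in N j)) <> 0 ->
  is_top (proj N j) T.
Proof.
move=> T_simple h0; exists h; split=> [f a b _ _|| a _].
- exact: linearP.
- rewrite predeqE => t; split=> // _; have [f ->] := T_simple _ t h0.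
  by exists (f *: of_hom (dsum_in N j)); rewrite ?linearZ.
(* If a nonsplit [a] had nonzero image, the inclusion of N j minus a multiple of [a] would lie in
   the proper submodule ker h, and the inclusion would be nonsplit. *)
rewrite rad_proj; split=> [ha|ha]; last first.
  apply: contrapT => ha0; have [f e] := T_simple _ (h (of_hom (dsum_in N j))) ha0.
  have : nonsplit j (of_hom (dsum_in N j) - f *: a).
    apply: (@proper_nonsplit _ [set c | h c = 0]).
    - exact: (submodule_preim h (submodule0 T)).
    - by move=> eT; apply: h0; rewrite -[_ = 0]/([set c | h c = 0] _) eT.
    - by rewrite /= linearB linearZ /= e subrr.
  move=> hN; apply: (@dsum_in_split j); rewrite -[of_hom _](subrK (f *: a)).
  exact: (submoduleD (@nonsplit_submodule j) hN (submoduleZ f (@nonsplit_submodule j) ha)).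
apply: (@proper_nonsplit _ [set c | h c = 0]) => //.
- exact: (submodule_preim h (submodule0 T)).
- by move=> eT; apply: h0; rewrite -[_ = 0]/([set c | h c = 0] _) eT.
Qed.

(** A preimage b of [t] remains split after [eps j'], so N j is a retract of N j', which is
    indecomposable. *)
Lemma top_eps j j' (T : lmodType E) (t : T) :
  is_top (proj N j) T -> eps j' *: t <> 0 -> j' = j.
Proof.
move=> [h [h_lin h_im hK]] t0; have sT := submoduleT (proj N j).
have [b _ hb] : (h @` setT) t by rewrite h_im.
apply: N_uniq; have : ~ nonsplit j (eps j' *: b).
  by move=> nb; apply: t0; rewrite -hb -(linear_onZ _ sT h_lin) //; apply/hK => //; rewrite rad_proj.
move=> /existsNP[c /contrapT cb]; have [g [gK Kg]] := linear_inverse cb.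
pose p : {linear N j -> N j'} := dsum_out N j' \o hom_of b.
pose q : {linear N j' -> N j} := g \o (c \o dsum_in N j').
apply: (@retract_isomorphic _ _ _ p q) => //; first exact: local_indecomposable.
by have [] := N_local j.
Qed.

Section Standard.
Context (le : I -> I -> Prop) (i : I) (y : N i) (d : nat).
Hypothesis y_inj : forall j (f : {linear N i -> N j}), f y <> 0 -> injective f.
Hypothesis le_inj : forall j (f : {linear N i -> N j}), injective f -> le j i.
Hypothesis le_factor : forall j (f : {linear N i -> N j}), f y = 0 -> ~ (forall x, f x = 0) ->
  exists j' (c : {linear N i -> N j'}) (e : {linear N j' -> N j}),
    (forall x, f x = e (c x)) /\ ~ le j' i.
Hypothesis proj_length : length_le (proj N i) d.

(* The standard module of i, as the kernel of evaluation at y consists of the sums of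
   maps that factor through some N j with j not below i. *)
Definition ev_set : set (emod M) := [set z | exists a : proj N i, z = hom_of a y].

Lemma ev_submodule : @submodule E (emod M) ev_set.
Proof.
split; first by exists 0.
by move=> f _ _ [a ->] [b ->]; exists (f *: a + b).
Qed.

Definition ev_mod : lmodType E := @subm E (emod M) ev_set ev_submodule.

Fact ev_in (a : proj N i) : ev_set (hom_of a y). Proof. by exists a. Qed.

Fact ev_linear (f : E) (a b : proj N i) :
  (subm_mk ev_submodule (ev_in (f *: a + b)) : ev_mod) =
  f *: (subm_mk ev_submodule (ev_in a) : ev_mod) + subm_mk ev_submodule (ev_in b).
Proof. exact: val_inj. Qed.
Definition ev_map : {linear proj N i -> ev_mod} := make_linear ev_linear.

Lemma ev_map_surj : surj ev_map.
Proof. by move=> z; have [a e] := submP z; exists a; apply: val_inj. Qed.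

Lemma ev_map_eq0 a : ev_map a = 0 <-> hom_of a y = 0.
Proof. by split=> [/(congr1 val)|e] //; apply: val_inj. Qed.

(** A composition factor with nonzero component at j comes from some a y with nonzero component in N
    j. That component of [a] does not kill [y], so it is injective and j is below i. *)
Lemma ev_mod_factors : factors_le (proj N) le i ev_mod.
Proof.
move=> T [n [F [[_ _ cF] [t lt [g [g_lin g_im gK]]]]]].
have [sU UV] := cF t lt; have [sV VU VneU _] := UV.
have [z [Uz Vz]] : exists z, F t.+1 z /\ ~ F t z.
  apply: contrapT => h; apply: VneU; rewrite eqEsubset; split=> // z Uz.
  by apply: contrapT => h'; apply: h; exists z.
have [j Vjz] := eps_mod_neq sV Vz.
have T_simple := subquotient_simple sU UV g_lin g_im gK.
have Ujz : F t.+1 (eps j *: z) by apply: submoduleZ.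
exists j.
  have [a ea] := ev_map_surj z.
  apply: (le_inj (f := dsum_out N j \o hom_of a)); apply: y_inj => /= ay0.
  apply: Vjz; rewrite -ea (_ : _ *: _ = 0); first by case: sV.
  by apply: val_inj; exact: (etrans (congr1 (dsum_in N j) ay0) (linear0 _)).
(* The map from P j to [T] induced by z: it sends b to the class of b applied to the j-th component
   of z, and the inclusion of N j to the class of [eps j *: z]. *)
have h_lin (f : E) (b b' : proj N j) : g (end_of (hom_of (f *: b + b') \o dsum_out N j) *: z) =
    f *: g (end_of (hom_of b \o dsum_out N j) *: z) + g (end_of (hom_of b' \o dsum_out N j) *: z).
  rewrite -g_lin; [|exact: submoduleZ|exact: submoduleZ].
  by rewrite scalerA -scalerDl; congr (g (_ *: z)); apply: homP.
apply: (simple_top (h := make_linear h_lin) T_simple) => g0.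
by apply: Vjz; apply/(gK _ Ujz); exact: g0.
Qed.

(** If [g] does not kill some a with a y = 0, a component of a factors through N j' with j' not
    below i. The image [x] in [X] of the map N i -> N j' is then nonzero and fixed by [eps j'],
    which forces the simple of j' to be a composition factor of [X]. *)
Lemma ev_mod_universal (X : lmodType E) (g : {linear proj N i -> X}) : surj g ->
  factors_le (proj N) le i X -> exists h : {linear ev_mod -> X}, forall x, g x = h (ev_map x).
Proof.
move=> g_surj X_le; apply: linear_factor => [|a /ev_map_eq0 ay]; first exact: ev_map_surj.
apply: contrapT => ga.
have [j gj] := eps_mod_neq (submodule0 X) ga.
pose f : {linear N i -> N j} := dsum_out N j \o hom_of a.
have fy : f y = 0 := etrans (congr1 (dsum_out N j) ay) (linear0 _).
have f0 : ~ (forall x, f x = 0).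
  move=> f0; apply: gj; rewrite /= -linearZ (_ : eps j *: a = 0) ?linear0 //.
  by apply: hom_eq => x; exact: (etrans (congr1 (dsum_in N j) (f0 x)) (linear0 _)).
have [j' [c [e [fE nle]]]] := le_factor fy f0.
pose x := g (of_hom (dsum_in N j' \o c)).
have x0 : x <> 0.
  move=> x0; apply: gj; rewrite /= -linearZ.
  pose F : E := end_of (dsum_in N j \o (e \o dsum_out N j')).
  have -> : eps j *: a = F *: of_hom (dsum_in N j' \o c).
    apply: hom_eq => u; transitivity (dsum_in N j (e (dsum_out N j' (dsum_in N j' (c u))))) => //.
    by rewrite dsum_inK -fE.
  have gF : g (F *: of_hom (dsum_in N j' \o c)) = F *: x  by apply: linearZZ.
  by rewrite gF x0 scaler0.
have ex : eps j' *: x = x.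
  rewrite -linearZ; congr (g _); apply: hom_eq => u.
  exact: (congr1 (dsum_in N j') (dsum_inK (c u))).
have [n [F FS]] := composition_series_ex (length_le_surj g_surj proj_length).
have [F0 Fn cF] := FS.
(* The first term of the series containing [x] yields a factor on which [eps j'] acts
   nontrivially. *)
have exP : exists t, `[< F t x >] by exists n; apply/asboolP; rewrite Fn.
have [[|t] /asboolP Fx t_min] := ex_minnP exP; first by case: x0; rewrite F0 in Fx.
have lt : (t < n)%N by apply: t_min; apply/asboolP; rewrite Fn.
have Fx' : ~ F t x by move=> /asboolP /t_min; rewrite ltnn.
have [T iT] := composition_subquotient FS lt.
have [h [h_lin h_im hK]] := iT; have [sU UV] := cF t lt.
have [|j0 le0 top0] := X_le T; first by exists n, F; split=> //; exists t.
apply: nle; suff -> : j' = j0 by [].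
by apply: (top_eps (t := h x) top0); rewrite -(linear_onZ _ sU h_lin) // ex; move/(hK _ Fx).
Qed.

Lemma ev_mod_standard : is_standard (proj N) le i ev_mod.
Proof.
exists ev_map; split; [exact: ev_map_surj | exact: ev_mod_factors |].
by move=> X g; apply: ev_mod_universal.
Qed.

End Standard.
End Projectives.

(** * The isomorphism of endomorphism algebras *)

Section Conjugation.
Context (k : fieldType) (R : algebra k) (M M' : lmodType R).
Context (u : {linear M -> M'}) (u' : {linear M' -> M}).
Hypotheses (uK : cancel u u') (u'K : cancel u' u).

Definition end_conj (f : end_algebra M) : end_algebra M' :=
  (u \o ((f : {linear M -> M}) \o u') : {linear M' -> M'}).

Fact end_conj_zmod : zmod_morphism end_conj.
Proof. by move=> f g; apply: homP => x /=; rewrite -linearB. Qed.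
Fact end_conj_monoid : monoid_morphism end_conj.
Proof.
split=> [|f g]; apply: homP => x; first exact: u'K.
by rewrite /= -[RHS]/(u ((f : {linear M -> M}) (u' (u ((g : {linear M -> M}) (u' x)))))) uK.
Qed.
HB.instance Definition _ := GRing.isZmodMorphism.Build (end_algebra M) (end_algebra M')
  end_conj end_conj_zmod.
HB.instance Definition _ := GRing.isMonoidMorphism.Build (end_algebra M) (end_algebra M')
  end_conj end_conj_monoid.
Definition end_conjugation : {rmorphism end_algebra M -> end_algebra M'} := end_conj.

Lemma end_conjugation_alg : alg_hom end_conjugation.
Proof.
move=> c; apply: homP => x; rewrite /= -[LHS]/(u (scal R c *: u' x)) linearZ /= u'K.
by [].
Qed.

End Conjugation.

Lemma end_conjugation_bij (k : fieldType) (R : algebra k) (M M' : lmodType R)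
    (u : {linear M -> M'}) (u' : {linear M' -> M}) (uK : cancel u u') (u'K : cancel u' u) :
  bijective (end_conjugation uK u'K).
Proof.
exists (end_conjugation u'K uK) => f; apply: homP => x.
  by rewrite -[LHS]/(u' (u ((f : {linear M -> M}) (u' (u x))))) !uK.
by rewrite -[LHS]/(u (u' ((f : {linear M' -> M'}) (u (u' x))))) !u'K.
Qed.

Section DirectSumIso.
Context (A : pzRingType) (I I' : finType) (N : I -> lmodType A) (N' : I' -> lmodType A).
Context (t : I' -> I) (f : forall i, {linear N (t i) -> N' i}).
Hypotheses (t_bij : bijective t) (f_bij : forall i, bijective (f i)).

Fact dsum_map_linear a (x y : dsum N) :
  ([ffun i => f i ((a *: x + y) (t i))] : dsum N') =
  a *: ([ffun i => f i (x (t i))] : dsum N') + ([ffun i => f i (y (t i))] : dsum N').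
Proof. by apply/ffunP => i; rewrite !ffunE linearP. Qed.
Definition dsum_map : {linear dsum N -> dsum N'} := make_linear dsum_map_linear.

Lemma dsum_map_bij : bijective dsum_map.
Proof.
have [s tK sK] := t_bij; apply: inj_surj_bijective => [|y].
  apply: linear_inj => x /ffunP h; apply/ffunP => i; rewrite -(sK i) ffunE.
  by apply: (bij_inj (f_bij (s i))); have := h (s i); rewrite !ffunE linear0.
(* Quantifying over every [i'] with t i' = i lets i be replaced by t (s i), after which the
   transport between types becomes trivial. *)
have ex i : exists z : N i, forall i' (e : t i' = i), f i' (ecast i (N i) (esym e) z) = y i'.
  rewrite -(sK i); have [g gK Kg] := f_bij (s i); exists (g (y (s i))) => i' e.
  have e' := esym (bij_inj t_bij e); case: _ / e' e => e.
  by rewrite eq_axiomK /= Kg.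
exists [ffun i => sval (cid (ex i))]; apply/ffunP => i; rewrite !ffunE.
by case: cid => z h; exact: (h i erefl).
Qed.

End DirectSumIso.

Section Final.
Context (k : fieldType) (Q : quiver) (m : nat) (R : algebra k).
Context (pi : {rmorphism path_algebra k Q -> R}).
Hypothesis pres : presents pi (ideal_pow (arrow_ideal k Q) m).
Hypothesis m_gt0 : (0 < m)%N.
Hypothesis Q_ns : no_sources Q.
Local Notation coef := (coef pres).
Local Notation mon := (mon pi).
Local Notation vid := (vid pi).
Local Notation ford := (ford pres).
Local Notation typed := (typed pres).
Local Notation typed_at := (typed_at pres).
Local Notation typed_gen := (typed_gen pres).

Section TypedFamily.
Context (I : finType) (N : I -> lmodType R).
Hypothesis N_typed : forall i, typed (N i).
Hypothesis N_all : forall X, typed X -> exists i, isomorphic X (N i).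
Hypothesis N_uniq : forall i j, isomorphic (N i) (N j) -> i = j.
Implicit Types (i j : I).

(** Evaluation at a generator of N i embeds P i into the direct sum, which finitely many multiples
    of generators by paths span over k. *)
Lemma typed_proj_length i : exists d, length_le (proj N i) d.
Proof.
have ex j : exists x : N j, forall y, exists a, y = a *: x.
  by have [v [l [x [[gx _] _ _]]]] := N_typed j; exists x.
pose x j := sval (cid (ex j)).
have gx j y : exists a, y = a *: x j by rewrite /x; case: cid.
pose T : finType := (I * 'I_(size (short Q m)))%type.
pose b (t : T) : dsum N := mon (tnth (in_tuple (short Q m)) t.2) *: dsum_in N t.1 (x t.1).
have b_span y : exists c : T -> k, y = \sum_t scal R (c t) *: b t.
  have ex' j : exists a, y j = a *: x j by apply: gx.
  pose a j := sval (cid (ex' j)); have aE j : y j = a j *: x j by rewrite /a; case: cid.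
  exists (fun t => coef (tnth (in_tuple (short Q m)) t.2) (a t.1)).
  transitivity (\sum_j \sum_n
      scal R (coef (tnth (in_tuple (short Q m)) n) (a j)) *: b (j, n)); last by rewrite pair_bigA.
  rewrite [LHS]dsum_in_out.
  apply: eq_bigr => j _; rewrite aE linearZ /= {1}[a j](coef_expand pres) scaler_suml [LHS]big_tnth.
  by apply: eq_bigr => n _; rewrite scalerA.
exists #|T|.
have g_lin (f : end_algebra (dsum N)) (c c' : proj N i) :
  (hom_of (f *: c + c') (x i) : emod (dsum N)) = f *: (hom_of c (x i) : emod (dsum N)) + hom_of c' (x i).
  by [].
apply: (length_le_inj (g := make_linear g_lin)) (emod_length b_span).
apply: linear_inj => c h; apply: hom_eq => y; have [r ->] := gx i y.
by rewrite linearZ /= [hom_of c (x i)]h scaler0.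
Qed.

(** Stated for any numerical function [phi] with these two monotonicity properties, so that it
    applies to dimension and to Loewy length alike. *)
Lemma typed_standard (phi : I -> nat) i (y : N i) :
  (forall i j (f : {linear N i -> N j}), injective f -> i <> j -> (phi i < phi j)%N) ->
  (forall i j (f : {linear N i -> N j}), surj f -> ~ injective f -> i <> j /\ (phi j <= phi i)%N) ->
  y <> 0 -> (forall (M : lmodType R) (f : {linear N i -> M}), typed M -> f y <> 0 -> injective f) ->
  is_standard (proj N) (fun j i => j = i \/ (phi i < phi j)%N) i (ev_mod y).
Proof.
move=> phi_inj phi_surj y0 y_test; have [d Pd] := typed_proj_length i.
apply: (ev_mod_standard _ _ _ _ _ Pd) => // [j|j f fy|j f f_inj|j f fy f0].
- exact: (typed_local m_gt0 (N_typed j)).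
- exact: y_test fy.
- have [<-|ne] := eqVneq i j; [by left | right].
  by apply: phi_inj f_inj _; apply/eqP.
have [T [c [e [tT c_surj e_inj fE]]]] := typed_image m_gt0 Q_ns (N_typed i) (N_typed j) f0.
have [j' [h hb]] := N_all tT; have [h' [hK Kh]] := linear_inverse hb.
exists j', (h \o c : {linear N i -> N j'}), (e \o h' : {linear N j' -> N j}).
split=> [x|]; first by rewrite fE /= hK.
have hc_surj : surj (h \o c : {linear N i -> N j'}).
  by move=> z; have [x cx] := c_surj (h' z); exists x; rewrite /= cx Kh.
have [||ne le] := phi_surj i j' (h \o c : {linear N i -> N j'}) => //.
  (* The map h c kills [y], because f does and the remaining factor of f is injective. *)
  move=> hc_inj; apply: y0; apply: hc_inj; apply: (bij_inj (Bijective Kh hK)).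
  by apply: e_inj; rewrite /= !hK -!fE fy linear0.
by case=> [e'|]; [apply: ne | rewrite ltnNge le].
Qed.

Lemma typed_dim_inj i j (f : {linear N i -> N j}) : injective f -> i <> j ->
  (Defs.dim (N i) < Defs.dim (N j))%N.
Proof.
move=> f_inj ne; have [le eq_surj] := dim_inj (finite_dimensional_typed (N_typed i))
  (finite_dimensional_typed (N_typed j)) f_inj.
rewrite ltn_neqAle le andbT; apply/eqP => /eq_surj f_surj; apply: ne; apply: N_uniq.
by exists f; apply: inj_surj_bijective.
Qed.

Lemma typed_dim_surj i j (f : {linear N i -> N j}) : surj f -> ~ injective f ->
  i <> j /\ (Defs.dim (N j) <= Defs.dim (N i))%N.
Proof.
move=> f_surj f_inj; have [le eq_inj] := dim_surj (finite_dimensional_typed (N_typed i))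
  (finite_dimensional_typed (N_typed j)) f_surj.
by split=> // e; apply: f_inj; apply: eq_inj; rewrite e.
Qed.

Lemma typed_loewy_inj i j (f : {linear N i -> N j}) : injective f -> i <> j ->
  (loewy_length (N i) < loewy_length (N j))%N.
Proof.
move=> f_inj ne; have [v [l [x tx]]] := N_typed i; have [w [l' [x' tx']]] := N_typed j.
rewrite (loewy_length_typed m_gt0 tx) (loewy_length_typed m_gt0 tx').
have [le eq_bij] := typed_inj_loewy m_gt0 tx tx' f_inj.
rewrite ltn_neqAle le andbT; apply/eqP => /eq_bij[_ f_bij]; apply: ne; apply: N_uniq.
by exists f.
Qed.

Lemma typed_loewy_surj i j (f : {linear N i -> N j}) : surj f -> ~ injective f ->
  i <> j /\ (loewy_length (N j) <= loewy_length (N i))%N.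
Proof.
move=> f_surj f_inj; split; first by have [] := typed_dim_surj f_surj f_inj.
have [v [l [x tx]]] := N_typed i; have [w [l' [x' tx']]] := N_typed j.
rewrite (loewy_length_typed m_gt0 tx) (loewy_length_typed m_gt0 tx').
have [[gx ax] _ _] := tx; have [[gx' ax'] /andP[l0 lm] [p [sp lp]]] := tx'.
rewrite leqNgt; apply/negP => lt; have [z fz] := f_surj x'; have [a ea] := gx z.
have : mon p *: x' = 0.
  rewrite -fz ea -linearZ scalerA; apply: (etrans _ (linear0 f)); congr (f _).
  by apply/ax; do 2!apply: fordMr; apply: ford_mon; rewrite lp -ltnS prednK.
move/ax'; rewrite -sp mon_vid_mul => /(_ p); rewrite lp ltn_predL l0 => /(_ isT)/eqP.
by rewrite coef_mon lp eqxx andbT -ltnS prednK // ltnS lm oner_eq0.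
Qed.

End TypedFamily.

(** The algebra isomorphism is conjugation by an isomorphism u of the two direct sums. The standard
    modules lie inside these sums, and u itself restricts to a semilinear isomorphism between them
    once the test elements correspond. *)
Lemma typed_quasi_hereditary (I I' : finType) (N : I -> lmodType R) (N' : I' -> lmodType R) :
  [/\ forall i, typed (N i), forall X, typed X -> exists i, isomorphic X (N i) &
      forall i j, isomorphic (N i) (N j) -> i = j] ->
  [/\ forall i, typed (N' i), forall X, typed X -> exists i, isomorphic X (N' i) &
      forall i j, isomorphic (N' i) (N' j) -> i = j] ->
  quasi_hereditary_isomorphic N (loewy_le N) N' (ideal_layer_le N').
Proof.
move=> [Nt Na Nu] [N't N'a N'u].
have ex i' : exists i, isomorphic (N i) (N' i').
  by have [i /isomorphic_sym iso] := Na _ (N't i'); exists i.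
pose t i' := sval (cid (ex i')).
have ex_f i' : exists f : {linear N (t i') -> N' i'}, bijective f by rewrite /t; case: cid.
pose f i' := sval (cid (ex_f i')); have f_bij i' : bijective (f i') by rewrite /f; case: cid.
have t_bij : bijective t.
  apply: inj_surj_bijective => [i j e|i].
    apply: N'u; apply: (isomorphic_trans (isomorphic_sym _)); first by exists (f i).
    by rewrite e; exists (f j).
  have [i' iso] := N'a _ (Nt i); exists i'; apply: Nu.
  apply: isomorphic_trans (isomorphic_sym iso); by exists (f i').
have [s tK sK] := t_bij.
have [u' [uK u'K]] := linear_inverse (dsum_map_bij t_bij f_bij).
set u := dsum_map f in uK u'K; pose phi := end_conjugation uK u'K.
exists phi; split; [exact: end_conjugation_bij | exact: end_conjugation_alg |].
exists s; split=> [|i]; first by exists t.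
rewrite -(sK i) tK; move: (s i) => i' {i}.
have [y y0 y_test] := typed_test_element m_gt0 Q_ns (Nt (t i')).
have [g [gK Kg]] := linear_inverse (f_bij i').
(* The test element is transported rather than chosen anew, so that u maps the evaluations at [y]
   onto those at [y']. *)
pose y' := f i' y.
have y'0 : y' <> 0.
  by move=> e; apply: y0; apply: (bij_inj (f_bij i')); rewrite linear0.
have y'_test (M : lmodType R) (h : {linear N' i' -> M}) : typed M -> h y' <> 0 -> injective h.
  move=> tM hy; have hf_inj := y_test M (h \o f i' : {linear N (t i') -> M}) tM hy.
  move=> z z' e; rewrite -[z]Kg -[z']Kg; congr (f i' _); apply: hf_inj.
  by rewrite /= !Kg.
exists (ev_mod y), (ev_mod y'); split.
- apply: typed_standard => //; [exact: typed_loewy_inj | exact: typed_loewy_surj].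
- apply: typed_standard => //; [exact: typed_dim_inj | exact: typed_dim_surj].
have Fin (z : ev_mod y) : ev_set y' (u (val z)).
  have [a ->] := submP z.
  exists (of_hom (u \o (hom_of a \o g) : {linear N' i' -> dsum N'})).
  by rewrite /= /y' gK.
pose F (z : ev_mod y) : ev_mod y' := subm_mk (ev_submodule y') (Fin z).
have F_lin : linear_for (phi \; *:%R) F.
  move=> a z z'; apply: val_inj.
  rewrite -[LHS]/(u ((a : {linear dsum N -> dsum N}) (val z) + val z')) linearD.
  rewrite -[RHS]/(u ((a : {linear dsum N -> dsum N}) (u' (u (val z)))) + u (val z')).
  by rewrite uK.
pose F' : {linear ev_mod y -> ev_mod y' | phi \; *:%R} :=
  HB.pack F (GRing.isLinear.Build _ _ _ _ F F_lin).
exists F'.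
have Gin (z : ev_mod y') : ev_set y (u' (val z)).
  have [a ->] := submP z.
  exists (of_hom (u' \o (hom_of a \o f i') : {linear N (t i') -> dsum N})).
  by [].
exists (fun z => subm_mk (ev_submodule y) (Gin z)) => z; apply: val_inj.
  exact: uK.
exact: u'K.
Qed.

End Final.

Theorem proposition6p12 (k : closedFieldType) (Q : quiver) (m : nat)
    (R : algebra k) (pi : {rmorphism path_algebra k Q -> R}) :
  no_sources Q -> (0 < m)%N ->
  presents pi (ideal_pow (arrow_ideal k Q) m) ->
  [/\ ideally_ordered pi,
      exists (I : finType) (N : I -> lmodType R), indecomposables_of (@adr_mod R) N,
      exists (I : finType) (N : I -> lmodType R), indecomposables_of (@sub_mod R) N &
      forall (I I' : finType) (N : I -> lmodType R) (N' : I' -> lmodType R),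
        indecomposables_of (@adr_mod R) N -> indecomposables_of (@sub_mod R) N' ->
        quasi_hereditary_isomorphic N (loewy_le N) N' (ideal_layer_le N')].
Proof.
move=> Q_ns m_gt0 pres; have adrP := indecomposable_adr pres m_gt0 Q_ns.
have subP := indecomposable_sub pres m_gt0 Q_ns.
have [I [N NP]] := typed_list pres m_gt0 Q_ns.
split; first exact: (ideally_ordered_truncated pres m_gt0).
- by exists I, N; apply/(indecomposables_typed adrP).
- by exists I, N; apply/(indecomposables_typed subP).
move=> {NP} {}I I' {}N N' /(indecomposables_typed adrP) NP /(indecomposables_typed subP) NP'.
exact: (typed_quasi_hereditary m_gt0 Q_ns NP NP').
Qed.
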